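(* Let $1<p<\infty$. Let $(b_n)_{n\ge1}$ be a sequence of elements of the closed unit ball of $H^\infty$. Put $B_0=1$ and $B_n:=b_1b_2\cdots b_n$ for $n\ge1$. Assume that the product $B:=\prod_{n=1}^\infty b_n$ converges uniformly on compact subsets of $\mathbb{D}$ to an element $B\in H^\infty$. Then for every $f\in H^p$, \[ f=B\,T_{\bar B}f+\sum_{n=1}^{\infty}B_{n-1}\cdot Q_{b_n}T_{\bar B_{n-1}}f, \] where the series converges in $H^p$-norm.
   Context: $\mathbb{D}$ is the open unit disc and $\mathbb{T}$ the unit circle; $H^p$ ($1<p<\infty$) is the Hardy space on $\mathbb{D}$, identified with a closed subspace of $L^p(\mathbb{T})$ via boundary values, and $H^\infty$ is the space of bounded analytic functions on $\mathbb{D}$ with the sup norm. $P_+:L^p(\mathbb{T})\to H^p$ is the M. Riesz (Szegő) projection. For $\varphi\in L^\infty(\mathbb{T})$ the Toeplitz operator $T_\varphi:H^p\to H^p$ is $T_\varphi f=P_+(\varphi f)$; for $B\in H^\infty$, $\bar B$ denotes the complex conjugate of its boundary function. For $b$ in the closed unit ball of $H^\infty$, $P_b:=T_bT_{\bar b}$ and $Q_b:=I-P_b$. *)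

(* Defs.v *)
From HB Require Import structures.
From Stdlib Require Import ClassicalEpsilon.
From mathcomp Require Import all_boot all_order all_algebra.
From mathcomp Require Import all_classical all_reals all_analysis.
From mathcomp Require Import complex.
Set Implicit Arguments. Unset Strict Implicit. Unset Printing Implicit Defensive.
Import Order.TTheory GRing.Theory Num.Theory.
Import numFieldNormedType.Exports.
Local Open Scope classical_set_scope.
Local Open Scope ring_scope.

(* Complex numbers C = R[i] over an abstract real field R : realType.
   The unit circle T is parametrized by theta in [0, 2 pi]. *)

Section Hardy.
Variable R : realType.
Local Notation C := (complex R).

Definition cabs (z : C) : R := Normc.normc z.

Definition expi (t : R) : C := Complex (cos t) (sin t).

Definition cderivable (f : C -> C) (z : C) : Prop :=
  exists d : C, forall eps : R, 0 < eps -> exists delta : R, 0 < delta /\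
    forall h : C, 0 < cabs h < delta ->
      cabs ((f (z + h) - f z) / h - d) < eps.

Definition holo_disc (f : C -> C) : Prop :=
  forall z : C, cabs z < 1 -> cderivable f z.

Definition Hinf (f : C -> C) : Prop :=
  holo_disc f /\ exists M : R, forall z : C, cabs z < 1 -> cabs (f z) <= M.

Definition Hinf_ball (f : C -> C) : Prop :=
  holo_disc f /\ forall z : C, cabs z < 1 -> cabs (f z) <= 1.

(* boundary function: radial limit  lim_{r -> 1^-} f (r e^{i theta})
   (exists for a.e. theta when f is in H^infty, by Fatou's theorem) *)
Definition bdry (f : C -> C) (t : R) : C :=
  Complex (lim ((fun r : R => complex.Re (f ((r%:C)%C * expi t))) @ at_left 1))
          (lim ((fun r : R => complex.Im (f ((r%:C)%C * expi t))) @ at_left 1)).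

Definition Tdom : set R := `[0, pi *+ 2]%classic.
Local Notation mu := (@lebesgue_measure R).

Definition cint (g : R -> C) : C :=
  Complex (Rintegral mu Tdom (fun t => complex.Re (g t)) / (pi *+ 2))
          (Rintegral mu Tdom (fun t => complex.Im (g t)) / (pi *+ 2)).

Definition inLp (p : R) (f : R -> C) : Prop :=
  measurable_fun Tdom (fun t => complex.Re (f t)) /\
  measurable_fun Tdom (fun t => complex.Im (f t)) /\
  (\int[mu]_(t in Tdom) ((cabs (f t)) `^ p)%:E < +oo)%E.

Definition Lpnorm (p : R) (f : R -> C) : R :=
  (Rintegral mu Tdom (fun t => (cabs (f t)) `^ p) / (pi *+ 2)) `^ p^-1.

Definition fcoef (f : R -> C) (k : int) : C :=
  cint (fun t => f t * expi (- (k%:~R * t))).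

(* H^p as the closed subspace of L^p(T) of boundary functions: the
   functions with vanishing negative Fourier coefficients *)
Definition inHp (p : R) (f : R -> C) : Prop :=
  inLp p f /\ forall k : int, k < 0 -> fcoef f k = 0.

(* M. Riesz projection P_+ : L^p -> H^p, P_+ f = sum_{k>=0} \hat f(k) e^{ikt},
   i.e. the element of H^p with the same nonnegative Fourier coefficients *)
Definition Pplus (p : R) (f : R -> C) : R -> C :=
  epsilon (inhabits (fun _ => 0))
    (fun g => inHp p g /\ forall k : int, 0 <= k -> fcoef g k = fcoef f k).

Definition Toep (p : R) (phi : R -> C) (f : R -> C) : R -> C :=
  Pplus p (fun t => phi t * f t).

Definition cbdry (b : C -> C) : R -> C := fun t => conjc (bdry b t).

Definition Pb (p : R) (b : C -> C) (f : R -> C) : R -> C :=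
  Toep p (bdry b) (Toep p (cbdry b) f).
Definition Qb (p : R) (b : C -> C) (f : R -> C) : R -> C :=
  fun t => f t - Pb p b f t.

(* finite Blaschke-type partial products B_n = b_1 ... b_n, B_0 = 1;
   the sequence b is indexed so that b n.+1 is b_{n+1}  (b 0 unused) *)
Definition partprod (b : nat -> C -> C) (n : nat) : C -> C :=
  fun z => \prod_(1 <= k < n.+1) b k z.

End Hardy.

(* Main.v *)
Require Import Defs.
From HB Require Import structures.
From mathcomp Require Import all_boot all_order all_algebra.
From mathcomp Require Import all_classical all_reals all_analysis.
From mathcomp Require Import measurable_realfun complex.
From mathcomp Require Import ring lra.
Set Implicit Arguments. Unset Strict Implicit. Unset Printing Implicit Defensive.
Import Order.TTheory GRing.Theory Num.Theory.
Import numFieldNormedType.Exports.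
Local Open Scope classical_set_scope.
Local Open Scope ring_scope.

(* The series telescopes.  Put [u_n = T_{conj B_n} f].  Multiplication by the
   conjugate of a bounded analytic function preserves the kernel of [P_+], so
   [T_{conj b_{n+1}} u_n = u_{n+1}] and
   [B_n Q_{b_{n+1}} u_n = B_n u_n - B_{n+1} u_{n+1}]; hence the remainder after
   [N] terms is [B_N u_N - B u] with [u = T_{conj B} f].
   - [u_N -> u]: by M. Riesz' theorem the operators are uniformly bounded, and on
     analytic polynomials they only involve finitely many Taylor coefficients of
     [B_N], which converge.
   - [(B_N - B) u -> 0]: if [B = 0] then [u = 0].  Otherwise, for [M >= N],
     [B_M = B_N R] with [R] in the unit ball; comparing the coefficients at the
     first nonzero Taylor coefficient of [B] gives [R(0) -> 1], and
     [|B_M - B_N|_2^2 <= |1 - R|_2^2 <= 2 - 2 Re R(0)], so [B_N -> B] in [L^2].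
   M. Riesz' theorem is proved for [1 < p <= 2] from the bound of
   [|F|^p] by [(Re F)^p] and [- Re (F^p)] when [Re F > 0], and passes from [p]
   to [2 p] because the square of the analytic half [d] of [q] is the analytic
   half of [(2 d - q) q].  Fatou's theorem follows from the convergence of
   Poisson integrals at Lebesgue points. *)

(** Two definitions shape the work. [Pplus] is an [epsilon] and [bdry] is built from [lim]: before
    M. Riesz' and Fatou's theorems nothing is known about their values, and afterwards these are
    determined only almost everywhere. Hence boundary functions are replaced by representatives
    bounded at every point ([hardy_bdd]), Toeplitz images by the coefficient condition [is_toep],
    and equality by [aeT]. Size is measured by [Np], the p-th power of the norm; a triangle
    inequality with factor 2^p is enough for all limits. Cauchy's theorem is needed only to compare
    Fourier coefficients on concentric circles: f(exp w) is integrated over rectangles in the left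
    half-plane, where circles become vertical segments. The base range p <= 2 ensures p |arg F| <=
    pi, where the cosine is monotone; doubling then reaches every p > 1 without duality. L^2
    convergence of B_N suffices in every L^p because B_N - B is bounded by 2. *)

Section ComplexBasics.
Context {R : realType}.
Local Notation C := R[i].
Implicit Types (x y z : C) (a s t : R).

Lemma ReD x y : complex.Re (x + y) = complex.Re x + complex.Re y.
Proof. by case: x y => [a b] [c d]. Qed.
Lemma ImD x y : complex.Im (x + y) = complex.Im x + complex.Im y.
Proof. by case: x y => [a b] [c d]. Qed.
Lemma ReN x : complex.Re (- x) = - complex.Re x.
Proof. by case: x. Qed.
Lemma ImN x : complex.Im (- x) = - complex.Im x.
Proof. by case: x. Qed.
Lemma ReB x y : complex.Re (x - y) = complex.Re x - complex.Re y.
Proof. by rewrite ReD ReN. Qed.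
Lemma ImB x y : complex.Im (x - y) = complex.Im x - complex.Im y.
Proof. by rewrite ImD ImN. Qed.
Lemma ReM x y : complex.Re (x * y) =
  complex.Re x * complex.Re y - complex.Im x * complex.Im y.
Proof. by case: x y => [a b] [c d]. Qed.
Lemma ImM x y : complex.Im (x * y) =
  complex.Re x * complex.Im y + complex.Im x * complex.Re y.
Proof. by case: x y => [a b] [c d]. Qed.
Lemma ReJ x : complex.Re (conjc x) = complex.Re x. Proof. by case: x. Qed.
Lemma ImJ x : complex.Im (conjc x) = - complex.Im x. Proof. by case: x. Qed.
Lemma complex_ext x y : complex.Re x = complex.Re y ->
  complex.Im x = complex.Im y -> x = y.
Proof. by case: x y => [a b] [c d] /= -> ->. Qed.
Lemma Re0 : complex.Re (0 : C) = 0. Proof. by []. Qed.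
Lemma Re1 : complex.Re (1 : C) = 1. Proof. by []. Qed.
Lemma Im1 : complex.Im (1 : C) = 0. Proof. by []. Qed.
Lemma complex_Re_sum (I : Type) (r : seq I) (P : pred I) (F : I -> C) :
  complex.Re (\sum_(i <- r | P i) F i) = \sum_(i <- r | P i) complex.Re (F i).
Proof. by apply: (big_morph _ ReD Re0). Qed.
Lemma cabsE x : cabs x = Num.sqrt (complex.Re x ^+ 2 + complex.Im x ^+ 2).
Proof. by case: x. Qed.
Lemma cabs_ge0 x : 0 <= cabs x.
Proof. by rewrite cabsE sqrtr_ge0. Qed.
Lemma cabs0 : cabs (0 : C) = 0. Proof. exact: Normc.normc0. Qed.
Lemma cabs1 : cabs (1 : C) = 1. Proof. exact: Normc.normc1. Qed.
Lemma cabsM x y : cabs (x * y) = cabs x * cabs y.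
Proof. exact: Normc.normcM. Qed.
Lemma cabsD x y : cabs (x + y) <= cabs x + cabs y.
Proof. exact: le_normcD. Qed.
Lemma cabsN x : cabs (- x) = cabs x.
Proof. exact: normcN. Qed.
Lemma cabsC x y : cabs (x - y) = cabs (y - x).
Proof. by rewrite -cabsN opprB. Qed.
Lemma cabsB x y : cabs (x - y) <= cabs x + cabs y.
Proof. by rewrite (le_trans (cabsD _ _))// cabsN. Qed.
Lemma cabs_dist x y : `|cabs x - cabs y| <= cabs (x - y).
Proof.
rewrite ler_norml; apply/andP; split.
  by have := cabsD (y - x) x; rewrite subrK cabsC; lra.
by have := cabsD (x - y) y; rewrite subrK; lra.
Qed.
Lemma cabsV x : cabs x^-1 = (cabs x)^-1.
Proof. exact: Normc.normcV. Qed.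
Lemma cabsX x n : cabs (x ^+ n) = cabs x ^+ n.
Proof. by elim: n => [|n IH]; rewrite ?expr0 ?cabs1// !exprS cabsM IH. Qed.
Lemma cabs_eq0 x : (cabs x == 0) = (x == 0).
Proof.
apply/eqP/eqP => [/Normc.eq0_normc//|->]; exact: cabs0.
Qed.
Lemma cabs_gt0 x : (0 < cabs x) = (x != 0).
Proof. by rewrite lt_def cabs_ge0 andbT cabs_eq0. Qed.
Lemma cabs_sqr x : cabs x ^+ 2 = complex.Re x ^+ 2 + complex.Im x ^+ 2.
Proof. by rewrite cabsE sqr_sqrtr// addr_ge0// sqr_ge0. Qed.
Lemma cabsJ x : cabs (conjc x) = cabs x.
Proof. by rewrite !cabsE ReJ ImJ sqrrN. Qed.
Lemma Re_le_cabs x : `|complex.Re x| <= cabs x.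
Proof.
by rewrite cabsE -sqrtr_sqr ler_sqrt ?addr_ge0 ?sqr_ge0// lerDl sqr_ge0.
Qed.
Lemma Im_le_cabs x : `|complex.Im x| <= cabs x.
Proof.
by rewrite cabsE -sqrtr_sqr ler_sqrt ?addr_ge0 ?sqr_ge0// lerDr sqr_ge0.
Qed.
Lemma Re_le_cabs' x : complex.Re x <= cabs x.
Proof. exact: le_trans (ler_norm _) (Re_le_cabs x). Qed.
Lemma cabs_real a : cabs (a%:C)%C = `|a|.
Proof. by rewrite cabsE /= expr0n addr0 sqrtr_sqr. Qed.
Lemma cabs_le_ReIm x : cabs x <= `|complex.Re x| + `|complex.Im x|.
Proof.
rewrite -(@ler_pXn2r _ 2)// ?nnegrE ?cabs_ge0 ?addr_ge0// cabs_sqr.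
rewrite sqrrD !real_normK ?num_real//.
have : 0 <= `|complex.Re x| * `|complex.Im x| by rewrite mulr_ge0.
lra.
Qed.
Lemma cabs_sum (I : Type) (r : seq I) (P : pred I) (F : I -> C) :
  cabs (\sum_(i <- r | P i) F i) <= \sum_(i <- r | P i) cabs (F i).
Proof.
apply: (big_ind2 (fun x (a : R) => cabs x <= a)); rewrite ?cabs0//.
by move=> x1 x2 y1 y2 h1 h2; rewrite (le_trans (cabsD _ _))// lerD.
Qed.

Lemma realcD a s : ((a + s)%:C = a%:C + s%:C :> C)%C.
Proof. by apply: complex_ext; rewrite /= ?addr0. Qed.
Lemma realcM a s : ((a * s)%:C = a%:C * s%:C :> C)%C.
Proof. by apply: complex_ext; rewrite /= ?mulr0 ?mul0r ?subr0 ?addr0. Qed.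
Lemma realcX a n : ((a ^+ n)%:C = a%:C ^+ n :> C)%C.
Proof. by elim: n => [|n IH]//; rewrite !exprS realcM IH. Qed.
Lemma realcN a : ((- a)%:C = - a%:C :> C)%C.
Proof. by apply: complex_ext; rewrite /= ?oppr0. Qed.
Lemma Re_realcM a x : complex.Re (a%:C * x)%C = a * complex.Re x.
Proof. by rewrite ReM /= mul0r subr0. Qed.
Lemma Im_realcM a x : complex.Im (a%:C * x)%C = a * complex.Im x.
Proof. by rewrite ImM /= mul0r addr0. Qed.
Lemma mulc_conj x : x * conjc x = ((cabs x ^+ 2)%:C)%C.
Proof.
apply: complex_ext; rewrite ?ReM ?ImM ReJ ImJ /= ?cabs_sqr; ring.
Qed.
Lemma conjcM x y : conjc (x * y) = conjc x * conjc y.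
Proof. by apply: complex_ext; rewrite !(ReJ, ImJ, ReM, ImM); ring. Qed.
Lemma conjcB x y : conjc (x - y) = conjc x - conjc y.
Proof. by apply: complex_ext; rewrite !(ReJ, ImJ, ReB, ImB); ring. Qed.

Lemma expi0 : expi (0 : R) = 1.
Proof. by rewrite /expi cos0 sin0. Qed.
Lemma expiD s t : expi (s + t) = expi s * expi t.
Proof.
by apply: complex_ext; rewrite /expi ?ReM ?ImM /= ?cosD ?sinD; ring.
Qed.
Lemma cabs_expi t : cabs (expi t) = 1.
Proof. by rewrite cabsE /= cos2Dsin2 sqrtr1. Qed.
Lemma expi_neq0 t : expi t != 0.
Proof. by rewrite -cabs_eq0 cabs_expi oner_neq0. Qed.
Lemma expiN t : expi (- t) = conjc (expi t).
Proof. by apply: complex_ext; rewrite /= ?cosN ?sinN. Qed.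
Lemma expiNV t : expi (- t) = (expi t)^-1.
Proof.
apply: (mulfI (expi_neq0 t)); rewrite divff ?expi_neq0//.
by rewrite -expiD subrr expi0.
Qed.
Lemma expi_nat n t : expi (n%:R * t) = expi t ^+ n.
Proof.
elim: n => [|n IH]; first by rewrite mul0r expi0 expr0.
by rewrite exprS -natr1 mulrDl mul1r expiD IH mulrC.
Qed.
Lemma expi_2pi : expi (pi *+ 2 : R) = 1.
Proof. by rewrite /expi cos2pi sin2pi. Qed.

Lemma polar x : exists t, x = ((cabs x)%:C)%C * expi t.
Proof.
have [->|x0] := eqVneq x 0; first by exists 0; rewrite cabs0 mul0r.
have r0 : 0 < cabs x by rewrite cabs_gt0.
set r := cabs x in r0 *; pose a := complex.Re x / r.
have a1 : -1 <= a <= 1.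
  by rewrite -ler_norml /a normrM normfV (gtr0_norm r0) ler_pdivrMr// mul1r Re_le_cabs.
have aE : complex.Re x = r * a by rewrite /a mulrC divfK// gt_eqF.
have bE : r * Num.sqrt (1 - a ^+ 2) = `|complex.Im x|.
  rewrite -[X in X * _](gtr0_norm r0) -sqrtr_sqr -sqrtrM ?sqr_ge0// -sqrtr_sqr.
  congr Num.sqrt; rewrite mulrBr mulr1 -exprMn -aE /r cabs_sqr; ring.
have [im0|im0] := leP 0 (complex.Im x).
  exists (acos a); apply: complex_ext; rewrite ?Re_realcM ?Im_realcM /=.
    by rewrite acosK.
  by rewrite sin_acos// bE ger0_norm.
exists (- acos a); apply: complex_ext; rewrite ?Re_realcM ?Im_realcM /= ?cosN ?sinN.
  by rewrite acosK.
by rewrite sin_acos// mulrN bE ltr0_norm// opprK.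
Qed.

End ComplexBasics.

(** * Integration over the circle *)

Section AeIntegral.
Local Open Scope ereal_scope.
Context d (T : measurableType d) (R : realType) (mu : {measure set T -> \bar R}).

Import HBNNSimple.

Let ge0_ae_le (f g : T -> \bar R) :
  (forall x, 0 <= f x) -> (forall x, 0 <= g x) ->
  {ae mu, forall x, f x = g x} -> \int[mu]_x f x <= \int[mu]_x g x.
Proof.
move=> f0 g0 [N [mN N0 subN]]; rewrite !ge0_integralTE//.
apply: ge_ereal_sup => _ [h /= hf <-].
have mNC : measurable (~` N) by exact: measurableC.
pose h' : {nnsfun T >-> R} := proj_nnsfun h mNC.
have -> : sintegral mu h = sintegral mu h'.
  rewrite -!integralT_nnsfun; apply: ae_eq_integral => //.
  - by apply/measurable_EFinP; exact: measurable_funP.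
  - by apply/measurable_EFinP; exact: measurable_funP.
  exists N; split => // x /= xN; apply: contrapT => Nx; apply: xN => _.
  change ((h x)%:E = (h x * \1_(~` N) x)%:E).
  by rewrite indicE mem_set// mulr1.
apply: ereal_sup_ubound; exists h'; last by [].
move=> x; change ((h x * \1_(~` N) x)%:E <= g x); rewrite indicE; case: (pselect (N x)) => Nx.
  by rewrite memNset ?mulr0//= => /(_ Nx).
rewrite mem_set// mulr1.
have <- : f x = g x by apply: contrapT => fg; apply: Nx; exact: subN.
exact: hf.
Qed.

(* No measurability assumption: nonnegative integrals are suprema over
   simple functions, which may be cut off on the exceptional null set. *)
Lemma ae_eq_integral_nomeas (D : set T) (f g : T -> \bar R) :
  {ae mu, forall x, D x -> f x = g x} ->
  \int[mu]_(x in D) f x = \int[mu]_(x in D) g x.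
Proof.
have H (u v : T -> \bar R) : (forall x, 0 <= u x) -> (forall x, 0 <= v x) ->
    {ae mu, forall x, D x -> u x = v x} ->
    \int[mu]_(x in D) u x = \int[mu]_(x in D) v x.
  move=> u0 v0 uv; rewrite integral_mkcond [RHS]integral_mkcond.
  have p0 (w : T -> \bar R) x : (forall x, 0 <= w x) -> 0 <= (w \_ D) x.
    by move=> w0; rewrite /patch; case: ifP.
  apply/eqP; rewrite eq_le; apply/andP; split; apply: ge0_ae_le => [x|x|];
    try exact: p0.
    by apply: filterS uv => x uv; rewrite /patch; case: ifPn; rewrite // inE => /uv.
  apply: filterS uv => x uv; rewrite /patch; case: ifPn; rewrite // inE => /uv.
  exact: esym.
move=> fg; rewrite integralE [RHS]integralE; congr (_ - _); apply: H => //;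
  by apply: filterS fg => x fg Dx; rewrite ?funeposE ?funenegE fg.
Qed.

End AeIntegral.

(* Lebesgue measure bundled as a measure, so that the filter instances for
   almost-everywhere quantification are found. *)
Definition leb {R : realType} : {measure set (measurableTypeR R) -> \bar R} :=
  @lebesgue_measure R.

Section Averages.
Context {R : realType}.
Local Notation mu := (@leb R).
Local Notation T := (@Tdom R).
Implicit Types (f g h : R -> R) (P Q : R -> Prop).

Definition aeT (P : R -> Prop) : Prop := {ae mu, forall t, T t -> P t}.

Lemma aeT_all P : (forall t, T t -> P t) -> aeT P.
Proof. by move=> h; apply/aeW => t; exact: h. Qed.
Lemma aeS P Q : {ae mu, forall t : R, P t} -> (forall t, P t -> Q t) ->
  {ae mu, forall t : R, Q t}.
Proof.
by move=> h PQ; apply: (@filterS _ _ (ae_filter_ringOfSetsType mu) _ _ PQ h).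
Qed.
Lemma aeTS P Q : aeT P -> (forall t, (T t -> P t) -> Q t) ->
  {ae mu, forall t : R, Q t}.
Proof. by move=> h PQ; apply: (@filterS _ _ (ae_filter_ringOfSetsType mu) _ _ PQ h). Qed.
Lemma aeT1 P Q : (forall t, T t -> P t -> Q t) -> aeT P -> aeT Q.
Proof. by move=> PQ h; apply: (aeTS h) => t {}h Tt; apply: PQ => //; exact: h. Qed.
Lemma aeT2 P1 P2 Q : (forall t, T t -> P1 t -> P2 t -> Q t) ->
  aeT P1 -> aeT P2 -> aeT Q.
Proof.
move=> PQ H1 H2; apply: (@filterS2 _ _ (ae_filter_ringOfSetsType mu) _ _ _ _ H1 H2).
by move=> t h1 h2 Tt; apply: PQ; [|exact: h1|exact: h2].
Qed.
Lemma aeT_forall (P : nat -> R -> Prop) :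
  (forall n, aeT (P n)) -> aeT (fun t => forall n, P n t).
Proof.
move=> PQ; apply: (aeS (ae_foralln PQ)) => t h Tt n; exact: h.
Qed.

Definition RI h := mu.-integrable T (EFin \o h).
Definition avg h := Rintegral mu T h / (pi *+ 2).

Lemma mT : measurable (T : set (measurableTypeR R)). Proof. exact: measurable_itv. Qed.
Lemma twopi_gt0 : 0 < pi *+ 2 :> R.
Proof. by rewrite mulr2n addr_gt0 ?pi_gt0. Qed.
Lemma twopi_neq0 : pi *+ 2 != 0 :> R.
Proof. by rewrite gt_eqF// twopi_gt0. Qed.
Lemma muT : mu T = (pi *+ 2)%:E.
Proof.
by rewrite /Tdom /leb /= lebesgue_measure_itv /= lte_fin twopi_gt0 oppr0 addr0.
Qed.
Lemma muT_lty : (mu T < +oo)%E. Proof. by rewrite muT ltry. Qed.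

Lemma RI_meas h : RI h -> measurable_fun T h.
Proof. by move=> /measurable_int/measurable_EFinP. Qed.
Lemma RI_le h g : measurable_fun T h -> RI g ->
  (forall t, T t -> `|h t| <= g t) -> RI h.
Proof.
rewrite /RI => mh ig hg; apply: (@le_integrable _ _ _ mu T mT _ (EFin \o g)) ig => /=.
  exact/measurable_EFinP.
by move=> t Tt; rewrite lee_fin (le_trans (hg _ Tt))// ler_norm.
Qed.
Lemma RI_cst (c : R) : RI (cst c).
Proof.
apply: measurable_bounded_integrable; [exact: mT|exact: muT_lty| |].
  exact: measurable_cst.
exists `|c|; split; first exact: num_real.
by move=> x cx t _ /=; exact: ltW.
Qed.
Lemma RI_bounded h (M : R) : measurable_fun T h ->
  (forall t, T t -> `|h t| <= M) -> RI h.
Proof. by move=> mh hM; apply: RI_le mh (RI_cst M) _. Qed.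
Lemma RID f g : RI f -> RI g -> RI (fun t => f t + g t).
Proof. by move=> fi gi; exact: (@integrableD _ _ _ mu T mT (EFin \o f) (EFin \o g)). Qed.
Lemma RIZ (c : R) f : RI f -> RI (fun t => c * f t).
Proof. by move=> fi; exact: (@integrableZl _ _ _ mu T mT c (EFin \o f)). Qed.
Lemma RIN f : RI f -> RI (fun t => - f t).
Proof. by move=> fi; exact: (@integrableN _ _ _ mu T (EFin \o f)). Qed.
Lemma RIB f g : RI f -> RI g -> RI (fun t => f t - g t).
Proof. by move=> fi gi; apply: RID => //; exact: RIN. Qed.
Lemma RI_abs f : RI f -> RI (fun t => `|f t|).
Proof. by move=> fi; exact: (integrable_abse fi). Qed.
Lemma RI_sum (I : Type) (r : seq I) (F : I -> R -> R) :
  (forall i, RI (F i)) -> RI (fun t => \sum_(i <- r) F i t).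
Proof.
move=> FI; elim: r => [|i r IH].
  by under eq_fun do rewrite big_nil; exact: RI_cst.
by under eq_fun do rewrite big_cons; exact: RID.
Qed.

Lemma avgD f g : RI f -> RI g -> avg (fun t => f t + g t) = avg f + avg g.
Proof. by move=> fi gi; rewrite /avg RintegralD//; [rewrite mulrDl|exact: mT]. Qed.
Lemma avgZ (c : R) f : RI f -> avg (fun t => c * f t) = c * avg f.
Proof. by move=> fi; rewrite /avg RintegralZl//; [rewrite mulrA|exact: mT]. Qed.
Lemma avgB f g : RI f -> RI g -> avg (fun t => f t - g t) = avg f - avg g.
Proof. by move=> fi gi; rewrite /avg RintegralB//; [rewrite mulrBl|exact: mT]. Qed.
Lemma avgN f : RI f -> avg (fun t => - f t) = - avg f.
Proof.
by move=> fi; under eq_fun do rewrite -mulN1r; rewrite avgZ// mulN1r.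
Qed.
Lemma avg_cst (c : R) : avg (cst c) = c.
Proof.
rewrite /avg Rintegral_cst; last exact: mT.
by rewrite muT /= -mulrA divff ?mulr1// twopi_neq0.
Qed.
Lemma avg_sum (I : Type) (r : seq I) (F : I -> R -> R) :
  (forall i, RI (F i)) ->
  avg (fun t => \sum_(i <- r) F i t) = \sum_(i <- r) avg (F i).
Proof.
move=> FI; elim: r => [|i r IH].
  by under eq_fun do rewrite big_nil; rewrite big_nil; exact: avg_cst.
under eq_fun do rewrite big_cons; rewrite avgD// ?IH ?big_cons//.
exact: RI_sum.
Qed.
Lemma avg_ge0 f : (forall t, T t -> 0 <= f t) -> 0 <= avg f.
Proof.
by move=> f0; rewrite divr_ge0 ?Rintegral_ge0// ltW ?twopi_gt0.
Qed.
Lemma avg_le f g : RI f -> RI g -> (forall t, T t -> f t <= g t) ->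
  avg f <= avg g.
Proof.
move=> fi gi fg; rewrite ler_pM2r ?invr_gt0 ?twopi_gt0//.
by apply: le_Rintegral => //; exact: mT.
Qed.
Lemma avg_abs f : RI f -> `|avg f| <= avg (fun t => `|f t|).
Proof.
move=> fi; rewrite /avg normrM [X in _ * X]gtr0_norm ?invr_gt0 ?twopi_gt0//.
by rewrite ler_pM2r ?invr_gt0 ?twopi_gt0// le_normr_Rintegral//; exact: mT.
Qed.
Lemma avg_ae_eq f g : aeT (fun t => f t = g t) -> avg f = avg g.
Proof.
move=> fg; congr (fine _ / _); apply: ae_eq_integral_nomeas.
by apply: (aeTS fg) => t h Tt; rewrite h.
Qed.
Lemma avg_eq f g : (forall t, T t -> f t = g t) -> avg f = avg g.
Proof. by move=> fg; apply: avg_ae_eq; exact: aeT_all. Qed.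
Lemma avgE (f : R -> R) : RI f -> ((avg f * (pi *+ 2))%:E = \int[mu]_(t in T) (f t)%:E)%E.
Proof.
move=> fi; rewrite /avg mulfVK ?twopi_neq0// /Rintegral fineK//.
by apply: integrable_fin_num => //; exact: mT.
Qed.

Lemma avg_dct (h : nat -> R -> R) (f g : R -> R) :
  (forall n, measurable_fun T (h n)) -> measurable_fun T f -> RI g ->
  aeT (fun t => h ^~ t @ \oo --> f t) ->
  aeT (fun t => forall n, `|h n t| <= g t) ->
  RI f /\ (fun n => avg (h n)) @ \oo --> avg f.
Proof.
move=> mh mf gi hf hg.
have [|||||] := @dominated_convergence _ _ _ mu T mT (fun n => EFin \o h n) (EFin \o f) (EFin \o g).
- by move=> n; apply/measurable_EFinP; exact: mh.
- by apply/measurable_EFinP.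
- apply: (aeTS hf) => t ht Tt; apply/fine_cvgP; split; first by apply: nearW.
  exact: ht.
- exact: gi.
- by apply: (aeTS hg) => t ht n Tt /=; rewrite lee_fin; exact: ht.
move=> fi _ cv; split; first exact: fi.
apply: cvgMr_tmp.
move: cv; rewrite -(@fineK _ (\int[mu]_(x in T) (f x)%:E)); last first.
  by apply: integrable_fin_num => //; exact: mT.
by move/fine_cvgP => [_].
Qed.

(** Fatou's lemma, with the lower limit identified almost everywhere; the uniform bound on the
    averages also supplies the integrability of the limit. *)
Lemma avg_fatou (h : nat -> R -> R) (f : R -> R) (A : R) :
  (forall n, RI (h n)) -> measurable_fun T f ->
  (forall n t, T t -> 0 <= h n t) -> (forall t, T t -> 0 <= f t) ->
  aeT (fun t => h ^~ t @ \oo --> f t) ->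
  (forall n, avg (h n) <= A) -> RI f /\ avg f <= A.
Proof.
move=> hi mf h0 f0 hf hA.
have le1 : (\int[mu]_(t in T) (f t)%:E <= (A * (pi *+ 2))%:E)%E.
  have -> : (\int[mu]_(t in T) (f t)%:E =
      \int[mu]_(t in T) limn_einf (fun n => (h n t)%:E))%E.
    apply: ae_eq_integral_nomeas; apply: (aeTS hf) => t ht Tt.
    have c : (fun n => (h n t)%:E) @ \oo --> (f t)%:E.
      by apply/fine_cvgP; split; [by apply: nearW|exact: ht].
    have [cE _] := cvg_limn_einf_sup c; by rewrite cE.
  apply: le_trans (fatou _ mT _ _) _.
  - by move=> n; apply/measurable_EFinP; exact: RI_meas.
  - by move=> n t Tt; rewrite lee_fin h0.
  rewrite limn_einf_lim; apply: lime_le; first exact: is_cvg_einfs.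
  apply: nearW => n; apply: (@le_trans _ _ (\int[mu]_(t in T) (h n t)%:E)%E).
    by apply: ereal_inf_lbound; exists n => /=.
  by rewrite -avgE// lee_fin ler_pM2r ?twopi_gt0.
have fi : RI f.
  apply/integrableP; split; first exact/measurable_EFinP.
  rewrite (@le_lt_trans _ _ ((A * (pi *+ 2))%:E))// ?ltry//.
  rewrite (le_trans _ le1)// le_eqVlt; apply/orP; left; apply/eqP.
  by apply: eq_integral => t; rewrite inE => Tt /=; rewrite ger0_norm// f0.
split => //.
by rewrite -(ler_pM2r twopi_gt0) -lee_fin avgE.
Qed.

(** By monotone convergence the sum has a finite integral, so it is finite almost everywhere, and
    there the increasing partial sums converge. *)
Lemma avg_series_ae (u : nat -> R -> R) (A : R) :
  (forall n, RI (u n)) -> (forall n t, T t -> 0 <= u n t) ->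
  (forall N, \sum_(0 <= n < N) avg (u n) <= A) ->
  aeT (fun t => cvgn (series (u ^~ t))).
Proof.
move=> ui u0 uA.
pose S t := (\sum_(0 <= n <oo) (u n t)%:E)%E.
have mS : measurable_fun T S.
  apply: ge0_emeasurable_sum => [k t Tt _|k _]; first by rewrite lee_fin u0.
  by apply/measurable_EFinP; exact: RI_meas.
have Si : (\int[mu]_(t in T) S t <= (A * (pi *+ 2))%:E)%E.
  rewrite integral_nneseries; 
    [|exact: mT|by move=> n; apply/measurable_EFinP; exact: RI_meas|
     by move=> n t Tt; rewrite lee_fin u0].
  apply: lime_le.
    by apply: is_cvg_nneseries => n _ _; apply: integral_ge0 => t Tt; rewrite lee_fin u0.
  apply: nearW => N; rewrite (eq_bigr (fun n => (avg (u n) * (pi *+ 2))%:E)); last first.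
    by move=> n _; rewrite avgE.
  by rewrite sumEFin lee_fin -mulr_suml ler_pM2r ?twopi_gt0.
have S0 t : T t -> (0 <= S t)%E by move=> Tt; apply: nneseries_ge0 => n _ _; rewrite lee_fin u0.
have : mu.-integrable T S.
  apply/integrableP; split => //; rewrite (le_lt_trans _ (ltry (A * (pi *+ 2))))//.
  rewrite (le_trans _ Si)// le_eqVlt; apply/orP; left; apply/eqP.
  by apply: eq_integral => t; rewrite inE => Tt /=; rewrite gee0_abs// S0.
move/(integrable_ae mT) => H; apply: (aeS H) => t h Tt.
have {}h := h Tt.
apply: nondecreasing_is_cvgn.
  apply/nondecreasing_seqP => n; rewrite /series /= big_nat_recr//= lerDl; exact: u0.
exists (fine (S t)) => _ [N _ <-]; rewrite -lee_fin fineK//.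
rewrite /series /= -sumEFin; apply: (@nneseries_lim_ge _ (fun n => (u n t)%:E) xpredT 0%N) => n *.
by rewrite lee_fin; exact: (u0 n t Tt).
Qed.

(** Cutting the functions off on the exceptional null set makes the sequence converge everywhere, so
    that the limit is measurable. *)
Lemma aeT_cvg_meas (h : nat -> R -> R) :
  (forall n, measurable_fun T (h n)) -> aeT (fun t => cvgn (h ^~ t)) ->
  exists f, measurable_fun T f /\ aeT (fun t => h ^~ t @ \oo --> f t).
Proof.
move=> mh [N [mN N0 subN]].
pose h' n t := h n t * \1_(~` N) t.
have mh' n : measurable_fun T (h' n).
  apply: measurable_funM => //; apply: measurable_indic; exact: measurableC.
have ch' t : T t -> cvgn (h' ^~ t).
  move=> Tt; rewrite /h' indicE; case: (pselect (N t)) => Nt.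
    rewrite memNset; last by move=> /(_ Nt).
    by under eq_fun do rewrite mulr0; exact: is_cvg_cst.
  rewrite mem_set//; under eq_fun do rewrite mulr1.
  by apply: contrapT => c; apply: Nt; apply: subN => /= /(_ Tt).
exists (fun t => limn (h' ^~ t)); split.
  by apply: (measurable_fun_cvg mh') => t Tt; exact: ch'.
exists N; split => // t /= nt; apply: contrapT => Nt; apply: nt => Tt.
have := ch' _ Tt; rewrite /h' indicE mem_set//.
by under eq_fun do rewrite mulr1.
Qed.

End Averages.

(** * Convergence of complex sequences *)

Section ComplexSequences.
Context {R : realType}.
Local Notation C := R[i].
Implicit Types (u v : nat -> C) (l m c : C).

(** Phrased through the modulus, so that only limits of real sequences occur. *)
Definition ccvg u l := (fun n => cabs (u n - l)) @ \oo --> (0 : R).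

Lemma squeeze0 (a b : nat -> R) : (forall n, 0 <= a n <= b n) ->
  b @ \oo --> 0 -> a @ \oo --> 0.
Proof.
move=> ab b0; apply: (@squeeze_cvgr _ _ _ _ (cst 0) b) => //; last exact: cvg_cst.
by apply: nearW => n /=; have /andP[-> ->] := ab n.
Qed.

Lemma ccvg_Re u l : ccvg u l ->
  (fun n => complex.Re (u n)) @ \oo --> complex.Re l.
Proof.
move=> h; apply/subr_cvg0; apply: norm_cvg0; apply: squeeze0 h => n /=.
by rewrite normr_ge0 -ReB Re_le_cabs.
Qed.
Lemma ccvg_Im u l : ccvg u l ->
  (fun n => complex.Im (u n)) @ \oo --> complex.Im l.
Proof.
move=> h; apply/subr_cvg0; apply: norm_cvg0; apply: squeeze0 h => n /=.
by rewrite normr_ge0 -ImB Im_le_cabs.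
Qed.
Lemma ccvg_ReIm u l :
  (fun n => complex.Re (u n)) @ \oo --> complex.Re l ->
  (fun n => complex.Im (u n)) @ \oo --> complex.Im l -> ccvg u l.
Proof.
move=> hr hi.
apply: (@squeeze0 _ (fun n => `|complex.Re (u n) - complex.Re l| +
    `|complex.Im (u n) - complex.Im l|)).
  by move=> n; rewrite cabs_ge0 -ReB -ImB cabs_le_ReIm.
rewrite -[X in _ --> X]addr0; apply: cvgD; rewrite -[X in _ --> X](@normr0 _ R);
  by apply: cvg_norm; apply/subr_cvg0.
Qed.
Lemma ccvg_cst c : ccvg (fun=> c) c.
Proof. by rewrite /ccvg subrr cabs0; exact: cvg_cst. Qed.
Lemma ccvg_le (a : nat -> R) u l : (forall n, cabs (u n - l) <= a n) ->
  a @ \oo --> 0 -> ccvg u l.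
Proof. by move=> ua; apply: squeeze0 => n; rewrite cabs_ge0 ua. Qed.
Lemma ccvgD u v l m : ccvg u l -> ccvg v m -> ccvg (fun n => u n + v n) (l + m).
Proof.
move=> ul vm; apply: (@ccvg_le (fun n => cabs (u n - l) + cabs (v n - m))).
  by move=> n; rewrite opprD addrACA cabsD.
by rewrite -[X in _ --> X]addr0; apply: cvgD.
Qed.
Lemma ccvgZ c u l : ccvg u l -> ccvg (fun n => c * u n) (c * l).
Proof.
move=> ul; apply: (@ccvg_le (fun n => cabs c * cabs (u n - l))).
  by move=> n; rewrite -mulrBr cabsM.
by rewrite -[X in _ --> X](mulr0 (cabs c)); apply: cvgMl_tmp.
Qed.
Lemma ccvg_cabs u l : ccvg u l -> (fun n => cabs (u n)) @ \oo --> cabs l.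
Proof.
move=> h; apply/subr_cvg0; apply: norm_cvg0; apply: squeeze0 h => n /=.
by rewrite normr_ge0 cabs_dist.
Qed.
Lemma ccvg_unique u l m : ccvg u l -> ccvg u m -> l = m.
Proof.
move=> ul um; apply: complex_ext.
  by apply: (cvg_unique (@norm_hausdorff _ R^o) (ccvg_Re ul) (ccvg_Re um)).
by apply: (cvg_unique (@norm_hausdorff _ R^o) (ccvg_Im ul) (ccvg_Im um)).
Qed.
Lemma ccvgM u v l m : ccvg u l -> ccvg v m -> ccvg (fun n => u n * v n) (l * m).
Proof.
move=> ul vm.
have [[[ur ui] vr] vi] := (ccvg_Re ul, ccvg_Im ul, ccvg_Re vm, ccvg_Im vm).
apply: ccvg_ReIm.
  rewrite ReM; under eq_fun do rewrite ReM.
  by apply: cvgB; apply: cvgM.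
rewrite ImM; under eq_fun do rewrite ImM.
by apply: cvgD; apply: cvgM.
Qed.
Lemma ccvg_sum (I : Type) (r : seq I) (U : I -> nat -> C) (L : I -> C) :
  (forall i, ccvg (U i) (L i)) ->
  ccvg (fun n => \sum_(i <- r) U i n) (\sum_(i <- r) L i).
Proof.
move=> UL; elim: r => [|i r IH].
  by rewrite big_nil; under eq_fun do rewrite big_nil; exact: ccvg_cst.
by rewrite big_cons; under eq_fun do rewrite big_cons; exact: ccvgD.
Qed.
Lemma ccvgJ u l : ccvg u l -> ccvg (fun n => conjc (u n)) (conjc l).
Proof.
by rewrite /ccvg; under eq_fun do rewrite -cabsJ conjcB ?conjcK.
Qed.
End ComplexSequences.

(** * Averages of complex-valued functions *)

Section ComplexIntegral.
Context {R : realType}.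
Local Notation C := R[i].
Local Notation T := (@Tdom R).
Local Notation Re := complex.Re.
Local Notation Im := complex.Im.
Implicit Types (f g b : R -> C) (c : C).

Definition cmeas f :=
  measurable_fun T (fun t => Re (f t)) /\ measurable_fun T (fun t => Im (f t)).
Definition CI f := RI (fun t => Re (f t)) /\ RI (fun t => Im (f t)).

Lemma CI_cmeas f : CI f -> cmeas f.
Proof. by move=> [? ?]; split; exact: RI_meas. Qed.
Lemma cmeas_cst c : cmeas (fun=> c).
Proof. by split; exact: measurable_cst. Qed.
Lemma cmeasD f g : cmeas f -> cmeas g -> cmeas (fun t => f t + g t).
Proof.
move=> [fr fi] [gr gi]; split.
  by under eq_fun do rewrite ReD; exact: measurable_funD.
by under eq_fun do rewrite ImD; exact: measurable_funD.
Qed.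
Lemma cmeasM f g : cmeas f -> cmeas g -> cmeas (fun t => f t * g t).
Proof.
move=> [fr fi] [gr gi]; split.
  by under eq_fun do rewrite ReM; apply: measurable_funB; exact: measurable_funM.
by under eq_fun do rewrite ImM; apply: measurable_funD; exact: measurable_funM.
Qed.
Lemma cmeasZ c f : cmeas f -> cmeas (fun t => c * f t).
Proof. by move=> mf; apply: cmeasM => //; exact: cmeas_cst. Qed.
Lemma cmeasN f : cmeas f -> cmeas (fun t => - f t).
Proof. by move=> mf; under eq_fun do rewrite -mulN1r; exact: cmeasZ. Qed.
Lemma cmeasB f g : cmeas f -> cmeas g -> cmeas (fun t => f t - g t).
Proof. by move=> mf mg; apply: cmeasD => //; exact: cmeasN. Qed.
Lemma cmeasJ f : cmeas f -> cmeas (fun t => conjc (f t)).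
Proof.
move=> [fr fi]; split; first by under eq_fun do rewrite ReJ.
by under eq_fun do rewrite ImJ; exact: measurable_funN.
Qed.
Lemma cmeas_sum (I : Type) (r : seq I) (F : I -> R -> C) :
  (forall i, cmeas (F i)) -> cmeas (fun t => \sum_(i <- r) F i t).
Proof.
move=> mF; elim: r => [|i r IH].
  by under eq_fun do rewrite big_nil; exact: cmeas_cst.
by under eq_fun do rewrite big_cons; exact: cmeasD.
Qed.
Lemma cmeasX f n : cmeas f -> cmeas (fun t => f t ^+ n).
Proof.
move=> mf; elim: n => [|n IH]; first exact: cmeas_cst.
by under eq_fun do rewrite exprS; exact: cmeasM.
Qed.
Lemma cmeas_real (h : R -> R) : measurable_fun T h -> cmeas (fun t => (h t)%:C%C).
Proof. by move=> mh; split => //; exact: measurable_cst. Qed.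
Lemma cmeas_continuous (h : R -> R) : continuous h -> measurable_fun T h.
Proof. by move=> ch; apply: measurable_funTS; exact: continuous_measurable_fun. Qed.
Lemma cmeas_expi (a : R) : cmeas (fun t => expi (a * t)).
Proof.
split; apply: cmeas_continuous => t /=; apply: continuous_comp.
- by apply: mulrl_continuous.
- exact: continuous_cos.
- by apply: mulrl_continuous.
- exact: continuous_sin.
Qed.
Lemma cmeas_cabs f : cmeas f -> measurable_fun T (fun t => cabs (f t)).
Proof.
move=> [fr fi]; under eq_fun do rewrite cabsE.
apply: (@measurableT_comp _ _ _ _ _ _ (@Num.sqrt R)).
  by apply: continuous_measurable_fun; exact: sqrt_continuous.
by apply: measurable_funD; exact: measurable_funX.
Qed.

Lemma CI_abs f : CI f -> RI (fun t => cabs (f t)).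
Proof.
move=> [fr fi]; apply: (RI_le _ (RID (RI_abs fr) (RI_abs fi))).
  by apply: cmeas_cabs; apply: CI_cmeas.
by move=> t _; rewrite ger0_norm ?cabs_ge0// cabs_le_ReIm.
Qed.
Lemma CI_le f (h : R -> R) : cmeas f -> RI h ->
  (forall t, T t -> cabs (f t) <= h t) -> CI f.
Proof.
move=> [mr mi] hi fh; split; apply: (RI_le _ hi) => // t Tt;
  apply: le_trans (fh t Tt); [exact: Re_le_cabs|exact: Im_le_cabs].
Qed.
Lemma CI_bounded f (M : R) : cmeas f -> (forall t, T t -> cabs (f t) <= M) -> CI f.
Proof. by move=> mf; apply: CI_le => //; exact: RI_cst. Qed.
Lemma CI_cst c : CI (fun=> c).
Proof. by apply: (@CI_bounded _ (cabs c)) => //; exact: cmeas_cst. Qed.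
Lemma CI_expi (a : R) : CI (fun t => expi (a * t)).
Proof.
apply: (@CI_bounded _ 1); first exact: cmeas_expi.
by move=> t _; rewrite cabs_expi.
Qed.
Lemma CID f g : CI f -> CI g -> CI (fun t => f t + g t).
Proof.
move=> fi gi; apply: (CI_le _ (RID (CI_abs fi) (CI_abs gi))).
  by apply: cmeasD; apply: CI_cmeas.
by move=> t _; exact: cabsD.
Qed.
Lemma CI_mul f b (M : R) : cmeas b -> (forall t, T t -> cabs (b t) <= M) ->
  CI f -> CI (fun t => b t * f t).
Proof.
move=> mb bM fi; apply: (CI_le _ (RIZ M (CI_abs fi))).
  by apply: cmeasM => //; apply: CI_cmeas.
by move=> t Tt; rewrite cabsM ler_wpM2r ?cabs_ge0// bM.
Qed.
Lemma CIZ c f : CI f -> CI (fun t => c * f t).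
Proof. by apply: (@CI_mul _ _ (cabs c)) => //; exact: cmeas_cst. Qed.
Lemma CIN f : CI f -> CI (fun t => - f t).
Proof. by move=> fi; under eq_fun do rewrite -mulN1r; exact: CIZ. Qed.
Lemma CIB f g : CI f -> CI g -> CI (fun t => f t - g t).
Proof. by move=> fi gi; apply: CID => //; exact: CIN. Qed.
Lemma CI_mul_expi f (a : R) : CI f -> CI (fun t => f t * expi (a * t)).
Proof.
move=> fi; under eq_fun do rewrite mulrC.
apply: (@CI_mul _ _ 1) => //; first exact: cmeas_expi.
by move=> t _; rewrite cabs_expi.
Qed.
Lemma CI_sum (I : Type) (r : seq I) (F : I -> R -> C) :
  (forall i, CI (F i)) -> CI (fun t => \sum_(i <- r) F i t).
Proof.
move=> mF; elim: r => [|i r IH].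
  by under eq_fun do rewrite big_nil; exact: CI_cst.
by under eq_fun do rewrite big_cons; exact: CID.
Qed.
Lemma cintE f : cint f =
  Complex (avg (fun t => Re (f t))) (avg (fun t => Im (f t))).
Proof. by []. Qed.
Lemma cint_ae_eq f g : aeT (fun t => f t = g t) -> cint f = cint g.
Proof.
by move=> fg; rewrite !cintE; congr Complex; apply: avg_ae_eq;
  apply: aeT1 fg => t _ ->.
Qed.
Lemma cint_eq f g : (forall t, T t -> f t = g t) -> cint f = cint g.
Proof. by move=> fg; apply: cint_ae_eq; exact: aeT_all. Qed.
Lemma cintD f g : CI f -> CI g ->
  cint (fun t => f t + g t) = cint f + cint g.
Proof.
move=> [fr fi] [gr gi]; rewrite !cintE; apply: complex_ext; rewrite /= -avgD//;
  by apply: avg_eq => t _; rewrite ?ReD ?ImD.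
Qed.
Lemma cintZ c f : CI f -> cint (fun t => c * f t) = c * cint f.
Proof.
move=> [fr fi]; rewrite !cintE; apply: complex_ext.
  rewrite ReM /= -!avgZ// -avgB; [|exact: RIZ..].
  by apply: avg_eq => t _; rewrite ReM.
rewrite ImM /= -!avgZ// -avgD; [|exact: RIZ..].
by apply: avg_eq => t _; rewrite ImM.
Qed.
Lemma cintN f : CI f -> cint (fun t => - f t) = - cint f.
Proof.
by move=> fi; under eq_fun do rewrite -mulN1r; rewrite cintZ// mulN1r.
Qed.
Lemma cintB f g : CI f -> CI g -> cint (fun t => f t - g t) = cint f - cint g.
Proof. by move=> fi gi; rewrite cintD ?cintN//; exact: CIN. Qed.
Lemma cint_cst c : cint (fun=> c) = c.
Proof. by rewrite cintE !avg_cst; case: c. Qed.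
Lemma cint_sum (I : Type) (r : seq I) (F : I -> R -> C) :
  (forall i, CI (F i)) ->
  cint (fun t => \sum_(i <- r) F i t) = \sum_(i <- r) cint (F i).
Proof.
move=> FI; elim: r => [|i r IH].
  by under eq_fun do rewrite big_nil; rewrite big_nil; exact: cint_cst.
under eq_fun do rewrite big_cons; rewrite cintD// ?IH ?big_cons//.
exact: CI_sum.
Qed.
Lemma Re_cint f : Re (cint f) = avg (fun t => Re (f t)).
Proof. by []. Qed.
Lemma cabs_cint f : CI f -> cabs (cint f) <= avg (fun t => cabs (f t)).
Proof.
move=> fi; have [c0|cn0] := eqVneq (cint f) 0.
  by rewrite c0 cabs0 avg_ge0// => t _; exact: cabs_ge0.
(* rotate the integral onto the positive real axis *)
pose w := conjc (cint f) / ((cabs (cint f))%:C)%C.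
have a0 : cabs (cint f) != 0 by rewrite cabs_eq0.
have w1 : cabs w = 1.
  by rewrite cabsM cabsJ cabsV cabs_real ger0_norm ?cabs_ge0// divff.
have wf : w * cint f = ((cabs (cint f))%:C)%C.
  rewrite /w mulrAC [conjc _ * _]mulrC mulc_conj expr2 realcM mulfK//.
  by rewrite -cabs_eq0 cabs_real normr_eq0.
have -> : cabs (cint f) = Re (cint (fun t => w * f t)).
  by rewrite cintZ// wf.
rewrite Re_cint; apply: avg_le; [by have [] := CIZ w fi|exact: CI_abs|].
by move=> t _; rewrite (le_trans (Re_le_cabs' _))// cabsM w1 mul1r.
Qed.

Lemma cint_dct (h : nat -> R -> C) f (g : R -> R) :
  (forall n, cmeas (h n)) -> cmeas f -> RI g ->
  aeT (fun t => ccvg (h ^~ t) (f t)) ->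
  aeT (fun t => forall n, cabs (h n t) <= g t) ->
  CI f /\ ccvg (fun n => cint (h n)) (cint f).
Proof.
move=> mh [mfr mfi] gi hf hg.
have [fr cr] : RI (fun t => Re (f t)) /\
    (fun n => avg (fun t => Re (h n t))) @ \oo --> avg (fun t => Re (f t)).
  apply: (avg_dct (g := g)) => //.
  - by move=> n; have [] := mh n.
  - by apply: aeT1 hf => t _; exact: ccvg_Re.
  - by apply: aeT1 hg => t _ h1 n; rewrite (le_trans (Re_le_cabs _)).
have [fi ci] : RI (fun t => Im (f t)) /\
    (fun n => avg (fun t => Im (h n t))) @ \oo --> avg (fun t => Im (f t)).
  apply: (avg_dct (g := g)) => //.
  - by move=> n; have [] := mh n.
  - by apply: aeT1 hf => t _; exact: ccvg_Im.
  - by apply: aeT1 hg => t _ h1 n; rewrite (le_trans (Im_le_cabs _)).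
by split; [split|apply: ccvg_ReIm].
Qed.

Lemma aeT_ccvg_meas (h : nat -> R -> C) :
  (forall n, cmeas (h n)) -> aeT (fun t => exists l, ccvg (h ^~ t) l) ->
  exists f, cmeas f /\ aeT (fun t => ccvg (h ^~ t) (f t)).
Proof.
move=> mh hc.
have [|fr [mfr hr]] := aeT_cvg_meas (fun n => (mh n).1).
  by apply: aeT1 hc => t _ [l /ccvg_Re hl]; apply/cvg_ex; exists (Re l).
have [|fi [mfi hi]] := aeT_cvg_meas (fun n => (mh n).2).
  by apply: aeT1 hc => t _ [l /ccvg_Im hl]; apply/cvg_ex; exists (Im l).
exists (fun t => Complex (fr t) (fi t)); split => //.
by apply: aeT2 hr hi => t _ hr' hi'; apply: ccvg_ReIm.
Qed.

End ComplexIntegral.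

(** * Fourier coefficients *)

Section FourierCoefficients.
Context {R : realType}.
Local Notation C := R[i].
Local Notation T := (@Tdom R).
Implicit Types (f g : R -> C) (c : C) (k m : int).

Lemma expi_int2pi k : expi (k%:~R * (pi *+ 2) : R) = 1.
Proof.
case: k => n; first by rewrite -pmulrn expi_nat expi_2pi expr1n.
by rewrite NegzE mulrNz mulNr expiN -pmulrn expi_nat expi_2pi expr1n conjc1.
Qed.

(** The fundamental theorem of calculus over one period. *)
Lemma avg_deriv (F f : R -> R) : continuous f ->
  (forall x : R, is_derive x (1 : R) F (f x)) -> F 0 = F (pi *+ 2) -> avg f = 0.
Proof.
move=> cf dF F0; rewrite /avg /Rintegral.
have cF : continuous F.
  by move=> x; apply: differentiable_continuous; apply/derivable1_diffP; have [] := dF x.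
have -> : (\int[leb]_(t in T) (f t)%:E)%E = ((F (pi *+ 2))%:E - (F 0)%:E)%E.
  apply: continuous_FTC2.
  - exact: twopi_gt0.
  - exact: continuous_subspaceT.
  - split.
    + by move=> x _; have [] := dF x.
    + by apply: cvg_at_right_filter; exact: cF.
    + by apply: cvg_at_left_filter; exact: cF.
  - by move=> x _; rewrite derive1E; have [_ ->] := dF x.
by rewrite F0 -EFinB subrr mul0r.
Qed.

(** Orthogonality of the characters: for k != 0 the real and imaginary parts have the periodic
    antiderivatives sin(kt)/k and -cos(kt)/k. *)
Lemma cint_expi_int k : cint (fun t : R => expi (k%:~R * t)) = (k == 0)%:R.
Proof.
have [->|k0] := eqVneq k 0.
  by under eq_fun do rewrite mul0r expi0; rewrite cint_cst.
pose c : R := k%:~R; have c0 : c != 0 by rewrite intr_eq0.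
have e2 := expi_int2pi k.
have dlin (x : R) : is_derive x 1 (fun t : R => c * t) c.
  by apply: is_derive_eq (is_deriveZ c (is_derive_id x (1 : R))) _; rewrite /GRing.scale /= mulr1.
rewrite cintE; apply: complex_ext => /=.
  apply: (@avg_deriv (fun t => c^-1 * sin (c * t))).
  - move=> t; apply: continuous_comp; last exact: continuous_cos.
    exact: mulrl_continuous.
  - move=> x; have h : is_derive x 1 (sin \o (fun t => c * t)) (cos (c * x) * c).
      exact: is_derive1_comp.
    have h2 := is_deriveZ c^-1 h.
    apply: is_derive_eq h2 _.
    by rewrite /GRing.scale /= mulrC -mulrA divff// mulr1.
  - rewrite mulr0 sin0 mulr0; have := congr1 (@complex.Im R) e2.
    by rewrite /= => ->; rewrite mulr0.
apply: (@avg_deriv (fun t => - c^-1 * cos (c * t))).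
- move=> t; apply: continuous_comp; last exact: continuous_sin.
  exact: mulrl_continuous.
- move=> x; have h : is_derive x 1 (cos \o (fun t => c * t)) (- sin (c * x) * c).
    exact: is_derive1_comp.
  have h2 := is_deriveZ (- c^-1) h.
  apply: is_derive_eq h2 _.
  by rewrite /GRing.scale /= !mulNr mulrN opprK mulrC mulfK.
- rewrite mulr0 cos0; have := congr1 (@complex.Re R) e2.
  by rewrite /= => ->.
Qed.

Lemma fcoefE f k : fcoef f k = cint (fun t => f t * expi ((- k)%:~R * t)).
Proof. by rewrite /fcoef; congr cint; apply/funext => t; rewrite rmorphN mulNr. Qed.
Lemma fcoef_ae_eq f g k : aeT (fun t => f t = g t) -> fcoef f k = fcoef g k.
Proof. by move=> fg; apply: cint_ae_eq; apply: aeT1 fg => t _ ->. Qed.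
Lemma fcoefD f g k : CI f -> CI g ->
  fcoef (fun t => f t + g t) k = fcoef f k + fcoef g k.
Proof.
move=> fi gi; rewrite !fcoefE -cintD; [|exact: CI_mul_expi..].
by apply: cint_eq => t _; rewrite mulrDl.
Qed.
Lemma fcoefZ c f k : CI f -> fcoef (fun t => c * f t) k = c * fcoef f k.
Proof.
move=> fi; rewrite !fcoefE -cintZ; last exact: CI_mul_expi.
by apply: cint_eq => t _; rewrite mulrA.
Qed.
Lemma fcoefB f g k : CI f -> CI g ->
  fcoef (fun t => f t - g t) k = fcoef f k - fcoef g k.
Proof.
move=> fi gi; rewrite !fcoefE -cintB; [|exact: CI_mul_expi..].
by apply: cint_eq => t _; rewrite mulrBl.
Qed.
Lemma fcoef_sum (I : Type) (r : seq I) (F : I -> R -> C) k :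
  (forall i, CI (F i)) ->
  fcoef (fun t => \sum_(i <- r) F i t) k = \sum_(i <- r) fcoef (F i) k.
Proof.
move=> FI; rewrite fcoefE; under [RHS]eq_bigr do rewrite fcoefE.
rewrite -cint_sum; last by move=> i; exact: CI_mul_expi.
by apply: cint_eq => t _; rewrite mulr_suml.
Qed.
Lemma cabs_fcoef f k : CI f -> cabs (fcoef f k) <= avg (fun t => cabs (f t)).
Proof.
move=> fi; rewrite fcoefE (le_trans (cabs_cint _))//; first exact: CI_mul_expi.
by rewrite le_eqVlt; apply/orP; left; apply/eqP/avg_eq => t _; rewrite cabsM cabs_expi mulr1.
Qed.
Lemma fcoef_expiM m f k :
  fcoef (fun t => expi (m%:~R * t) * f t) k = fcoef f (k - m).
Proof.
rewrite !fcoefE; apply: cint_eq => t _; rewrite mulrAC -expiD mulrC -mulrDl.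
by rewrite -rmorphD opprB addrC.
Qed.
Lemma fcoef_expi m k :
  fcoef (fun t : R => expi (m%:~R * t)) k = (k == m)%:R.
Proof.
rewrite fcoefE; under eq_fun do rewrite -expiD -mulrDl -rmorphD.
by rewrite cint_expi_int subr_eq0 eq_sym.
Qed.
Lemma fcoef_cst c k : fcoef (fun=> c : C) k = c *+ (k == 0).
Proof.
rewrite -[LHS]/(fcoef (fun t => c) k).
have -> : (fun _ : R => c) = fun t => c * expi ((0 : int)%:~R * t).
  by apply/funext => t; rewrite mul0r expi0 mulr1.
by rewrite fcoefZ ?fcoef_expi ?mulr_natr//; exact: CI_expi.
Qed.

Lemma fcoef_dct (h : nat -> R -> C) f (g : R -> R) k :
  (forall n, cmeas (h n)) -> cmeas f -> RI g ->
  aeT (fun t => ccvg (h ^~ t) (f t)) ->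
  aeT (fun t => forall n, cabs (h n t) <= g t) ->
  ccvg (fun n => fcoef (h n) k) (fcoef f k).
Proof.
move=> mh mf gi hf hg; rewrite fcoefE; under eq_fun do rewrite fcoefE.
have [] := @cint_dct R (fun n t => h n t * expi ((- k)%:~R * t))
  (fun t => f t * expi ((- k)%:~R * t)) g => //.
- by move=> n; apply: cmeasM => //; exact: cmeas_expi.
- by apply: cmeasM => //; exact: cmeas_expi.
- apply: aeT1 hf => t _ ht; apply: ccvgM => //; exact: ccvg_cst.
- by apply: aeT1 hg => t _ ht n; rewrite cabsM cabs_expi mulr1.
Qed.

Lemma fcoef_J f k : CI f -> fcoef (fun t => conjc (f t)) k = conjc (fcoef f (- k)).
Proof.
move=> fi; rewrite !fcoefE !cintE.
have [r i] := CI_mul_expi (k%:~R) fi.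
apply: complex_ext; rewrite ?ReJ ?ImJ /= opprK.
  apply: avg_eq => t _; rewrite rmorphN mulNr expiN !ReM !(ReJ, ImJ); ring.
rewrite -avgN//; apply: avg_eq => t _.
by rewrite rmorphN mulNr expiN !ImM !(ReJ, ImJ); ring.
Qed.

Lemma measurable_powR_comp p (h : R -> R) : measurable_fun T h ->
  measurable_fun T (fun t => h t `^ p).
Proof. by move=> mh; apply: (measurableT_comp (measurable_powR p) mh). Qed.

Lemma measurable_cabs_powR p f : cmeas f ->
  measurable_fun T (fun t => cabs (f t) `^ p).
Proof. by move=> mf; apply: measurable_powR_comp; exact: cmeas_cabs. Qed.

Lemma cmeas_horner (q : {poly C}) : cmeas (fun t : R => q.[expi t]).
Proof.
under eq_fun do rewrite horner_coef.
apply: cmeas_sum => i; apply: cmeasZ; apply: cmeasX.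
rewrite (_ : @expi R = fun t => expi (1 * t)); first exact: cmeas_expi.
by apply/funext => t; rewrite mul1r.
Qed.
End FourierCoefficients.

(** * Cauchy's theorem and Taylor coefficients *)

Section ComplexDerivatives.
Context {R : realType}.
Local Notation C := R[i].
Implicit Types (f g : C -> C) (z d w h : C) (e : R).

(** The derivative without a quotient: increments h = 0 need no separate treatment, which keeps the
    chain rule simple. *)
Definition cdiff f z d := forall e, 0 < e -> exists delta : R, 0 < delta /\
  forall h, cabs h < delta -> cabs (f (z + h) - f z - d * h) <= e * cabs h.

Lemma cderivable_cdiff f z : cderivable f z -> exists d, cdiff f z d.
Proof.
move=> [d fd]; exists d => e e0; have [de [de0 H]] := fd _ e0.
exists de; split => // h hde; have [->|h0] := eqVneq h 0.
  by rewrite addr0 subrr mulr0 subr0 cabs0 mulr0.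
have := H h; rewrite cabs_gt0 h0 hde => /(_ isT) /ltW.
have -> : f (z + h) - f z - d * h = ((f (z + h) - f z) / h - d) * h.
  by rewrite mulrBl divfK.
by rewrite cabsM ler_pM2r ?cabs_gt0.
Qed.
Lemma cdiff_cderivable f z d : cdiff f z d -> cderivable f z.
Proof.
move=> fd; exists d => e e0; have e20 : 0 < e / 2 by rewrite divr_gt0.
have [de [de0 H]] := fd _ e20.
exists de; split => // h /andP[h0 hde].
have hn0 : h != 0 by rewrite -cabs_gt0.
rewrite -(ltr_pM2r h0) -cabsM mulrBl divfK//.
by rewrite (le_lt_trans (H h hde))// ltr_pM2r// ltr_pdivrMr// ltr_pMr// ltr1n.
Qed.

Lemma cdiff_cont f z d : cdiff f z d -> forall e, 0 < e ->
  exists delta : R, 0 < delta /\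
  forall h, cabs h < delta -> cabs (f (z + h) - f z) < e.
Proof.
move=> fd e e0; have [de [de0 H]] := fd _ ltr01.
have K0 : 0 < cabs d + 1 by rewrite ltr_wpDl ?cabs_ge0.
exists (Num.min de (e / (cabs d + 1))); split.
  by rewrite lt_min de0 divr_gt0.
move=> h; rewrite lt_min => /andP[h1 h2].
have -> : f (z + h) - f z = (f (z + h) - f z - d * h) + d * h by rewrite subrK.
rewrite (le_lt_trans (cabsD _ _))// cabsM.
rewrite (@le_lt_trans _ _ ((cabs d + 1) * cabs h))//.
  by rewrite mulrDl addrC lerD2l H.
by rewrite mulrC -ltr_pdivlMr.
Qed.

Lemma cdiff_eq f z d d' : d = d' -> cdiff f z d -> cdiff f z d'.
Proof. by move=> ->. Qed.
Lemma cdiff_cst (c : C) z : cdiff (fun=> c) z 0.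
Proof.
move=> e e0; exists 1; split => // h _.
by rewrite subrr mul0r subr0 cabs0 mulr_ge0 ?cabs_ge0 ?ltW.
Qed.
Lemma cdiff_id z : cdiff id z 1.
Proof.
move=> e e0; exists 1; split => // h _.
have -> : id (z + h) - id z - 1 * h = 0 by rewrite /=; ring.
by rewrite cabs0 mulr_ge0 ?cabs_ge0 ?ltW.
Qed.
Lemma cdiffD f g z d d' : cdiff f z d -> cdiff g z d' ->
  cdiff (fun w => f w + g w) z (d + d').
Proof.
move=> fd gd e e0; have e20 : 0 < e / 2 by rewrite divr_gt0.
have [d1 [d10 H1]] := fd _ e20; have [d2 [d20 H2]] := gd _ e20.
exists (Num.min d1 d2); split; first by rewrite lt_min d10.
move=> h; rewrite lt_min => /andP[h1 h2].
have -> : f (z + h) + g (z + h) - (f z + g z) - (d + d') * h =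
  (f (z + h) - f z - d * h) + (g (z + h) - g z - d' * h) by ring.
rewrite (le_trans (cabsD _ _))// (splitr e) mulrDl.
by apply: lerD; [exact: H1|exact: H2].
Qed.
Lemma cdiff_comp f g z d d' : cdiff f z d -> cdiff g (f z) d' ->
  cdiff (g \o f) z (d' * d).
Proof.
move=> fd gd e e0.
have K0 : 0 < cabs d + 1 by rewrite ltr_wpDl ?cabs_ge0.
have L0 : 0 < cabs d' + 1 by rewrite ltr_wpDl ?cabs_ge0.
(* The error splits into that of [g] at the increment k = f(z+h) - f(z) and [d'] times that of [f];
   each gets half of [e]. The bound 1 on [e2] yields |k| <= (|d| + 1) |h|. *)
pose e1 := e / 2 / (cabs d + 1); have e10 : 0 < e1 by rewrite !divr_gt0.
pose e2 := Num.min 1 (e / 2 / (cabs d' + 1)).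
have e20 : 0 < e2 by rewrite lt_min ltr01 !divr_gt0.
have [d1 [d10 H1]] := gd _ e10; have [d2 [d20 H2]] := fd _ e20.
have [d3 [d30 H3]] := cdiff_cont fd d10.
exists (Num.min d2 d3); split; first by rewrite lt_min d20.
move=> h; rewrite lt_min => /andP[h2 h3] /=.
set k := f (z + h) - f z; have fk : f (z + h) = f z + k by rewrite /k; ring.
have kb : cabs (k - d * h) <= e2 * cabs h by exact: H2.
have kb1 : cabs k <= (cabs d + 1) * cabs h.
  have -> : k = (k - d * h) + d * h by rewrite subrK.
  rewrite (le_trans (cabsD _ _))// cabsM mulrDl addrC lerD2l.
  by rewrite (le_trans kb)// ler_wpM2r ?cabs_ge0// ge_min lexx.
rewrite fk; have -> : g (f z + k) - g (f z) - d' * d * h =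
   (g (f z + k) - g (f z) - d' * k) + d' * (k - d * h) by ring.
rewrite (le_trans (cabsD _ _))// (splitr e) mulrDl; apply: lerD.
  rewrite (le_trans (H1 _ (H3 _ h3)))//.
  rewrite (@le_trans _ _ (e1 * ((cabs d + 1) * cabs h)))//.
    by rewrite ler_wpM2l// ltW.
  by rewrite mulrA /e1 divfK// gt_eqF.
rewrite cabsM (@le_trans _ _ (cabs d' * (e2 * cabs h)))//.
  by rewrite ler_wpM2l ?cabs_ge0.
rewrite mulrA ler_wpM2r ?cabs_ge0//.
rewrite (@le_trans _ _ ((cabs d' + 1) * e2))//.
  by rewrite ler_wpM2r ?(ltW e20)// lerDl.
by rewrite mulrC -ler_pdivlMr// ge_min lexx orbT.
Qed.
Lemma cdiff_sqr z : cdiff (fun w => w * w) z (z + z).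
Proof.
move=> e e0; exists e; split => // h he.
have -> : (z + h) * (z + h) - z * z - (z + z) * h = h * h by ring.
by rewrite cabsM ler_wpM2r ?cabs_ge0// ltW.
Qed.
Lemma cdiffZ (c : C) f z d : cdiff f z d -> cdiff (fun w => c * f w) z (c * d).
Proof.
move=> fd; apply: (@cdiff_comp f (fun w => c * w) z d c) => // e e0.
exists 1; split => // h _; have -> : c * (f z + h) - c * f z - c * h = 0 by ring.
by rewrite cabs0 mulr_ge0 ?cabs_ge0 ?ltW.
Qed.
(* the product rule follows from the chain rule and the polarization identity *)
Lemma cdiffM f g z d d' : cdiff f z d -> cdiff g z d' ->
  cdiff (fun w => f w * g w) z (d * g z + f z * d').
Proof.
move=> fd gd.
have sq (u : C -> C) (du : C) : cdiff u z du ->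
    cdiff (fun w => u w * u w) z ((u z + u z) * du).
  by move=> ud; apply: (cdiff_comp ud (@cdiff_sqr (u z))).
have H := cdiffD (sq _ _ (cdiffD fd gd))
  (cdiffD (cdiffZ (-1) (sq _ _ fd)) (cdiffZ (-1) (sq _ _ gd))).
have h2 : (2 : C) != 0 by rewrite pnatr_eq0.
have H2 := cdiffZ (2^-1) H.
have -> : (fun w => f w * g w) = fun w => 2^-1 *
   ((f w + g w) * (f w + g w) + (-1 * (f w * f w) + -1 * (g w * g w))).
  by apply/funext => w; field.
by apply: cdiff_eq H2; field.
Qed.

Lemma cdiff_horner (p : {poly C}) z : exists d, cdiff (fun w => p.[w]) z d.
Proof.
elim/poly_ind: p => [|p c [d pd]].
  by exists 0; under eq_fun do rewrite horner0; exact: cdiff_cst.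
exists (d * z + p.[z] * 1 + 0).
under eq_fun do rewrite hornerMXaddC.
exact: (cdiffD (cdiffM pd (cdiff_id z)) (cdiff_cst c z)).
Qed.

Lemma is_derive_eps (f : R -> R) (x l : R) : is_derive x (1 : R) f l ->
  forall e, 0 < e -> exists delta, 0 < delta /\
  forall h : R, `|h| < delta -> `|f (x + h) - f x - l * h| <= e * `|h|.
Proof.
move=> [fd fl] e e0.
have : (fun h : R => h^-1 *: ((f \o shift x) (h *: (1 : R)) - f x)) @ 0^' --> l.
  by rewrite -fl; exact: fd.
move/cvgrPdist_lt/(_ e e0).
rewrite near_withinE => /nbhs_ballP[de /= de0 H].
exists de; split => // h hde; have [->|h0] := eqVneq h 0.
  by rewrite addr0 subrr mulr0 subr0 normr0 mulr0.
have := H h; rewrite /ball /= sub0r normrN => /(_ hde h0) /ltW.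
have -> : f (x + h) - f x - l * h = - ((l - h^-1 *: (f (h *: (1 : R) + x) - f x)) * h).
  rewrite /GRing.scale /= mulr1 mulrBl mulrAC mulVf// mul1r [h + x]addrC; ring.
by rewrite normrN normrM ler_pM2r ?normr_gt0.
Qed.

Definition cexp w : C := (expR (complex.Re w))%:C%C * expi (complex.Im w).

Lemma cexpD w z : cexp (w + z) = cexp w * cexp z.
Proof. rewrite /cexp ReD ImD expRD expiD realcM; ring. Qed.
Lemma cexp0 : cexp 0 = 1.
Proof. by rewrite /cexp expR0 expi0 mul1r. Qed.
Lemma cabs_cexp w : cabs (cexp w) = expR (complex.Re w).
Proof. by rewrite cabsM cabs_expi mulr1 cabs_real gtr0_norm ?expR_gt0. Qed.
Lemma cexp_neq0 w : cexp w != 0.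
Proof. by rewrite -cabs_eq0 cabs_cexp gt_eqF ?expR_gt0. Qed.

Lemma cdiff_cexp0 : cdiff cexp 0 1.
Proof.
(* First-order expansions of exp, cos and sin: the errors add up to 1 + 2 units [e1 * r] in the real
   part and 2 + 1 in the imaginary part, hence the 6. The bound 1 on [e1] gives exp x <= 2, and r <
   e1 / 2 gives |exp x - 1| <= e1. *)
move=> e e0; pose e1 := Num.min (e / 6) 1.
have e10 : 0 < e1 by rewrite lt_min ltr01 andbT divr_gt0.
have [d1 [d10 H1]] := is_derive_eps (is_derive_expR (0 : R)) e10.
have [d2 [d20 H2]] := is_derive_eps (is_derive_sin (0 : R)) e10.
have [d3 [d30 H3]] := is_derive_eps (is_derive_cos (0 : R)) e10.
exists (Num.min (Num.min d1 d2) (Num.min d3 (e1 / 2))).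
split; first by rewrite !lt_min d10 d20 d30 divr_gt0.
move=> h; rewrite !lt_min => /andP[/andP[h1 h2] /andP[h3 h4]].
rewrite add0r cexp0 mul1r.
have := H1 (complex.Re h) (le_lt_trans (Re_le_cabs h) h1).
have := H2 (complex.Im h) (le_lt_trans (Im_le_cabs h) h2).
have := H3 (complex.Im h) (le_lt_trans (Im_le_cabs h) h3).
rewrite !add0r expR0 sin0 cos0 oppr0 mul0r !subr0 !mul1r ?addr0.
have := Re_le_cabs h; have := Im_le_cabs h.
set x := complex.Re h; set y := complex.Im h; set E := expR x; set r := cabs h in h4 *.
move=> yr xr Cy Sy Ex.
have r0 : 0 <= r by exact: cabs_ge0.
have e11 : e1 <= 1 by rewrite /e1 ge_min lexx orbT.
have e1e : 6 * e1 <= e.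
  have : e1 <= e / 6 by rewrite /e1 ge_min lexx.
  by rewrite ler_pdivlMr// mulrC.
have E1 : `|E - 1| <= e1.
  have := ler_normD (E - 1 - x) x; rewrite subrK => /le_trans; apply.
  have : e1 * `|x| <= 1 * `|x| by rewrite ler_wpM2r.
  lra.
have E2 : `|E| <= 2.
  have := ler_normD (E - 1) 1; rewrite subrK normr1; lra.
apply: (le_trans (cabs_le_ReIm _)).
have -> : complex.Re (cexp h - 1 - h) = (E - 1 - x) + E * (cos y - 1).
  rewrite /cexp !(ReB, Re_realcM, Re1) /= -/x -/y -/E; ring.
have -> : complex.Im (cexp h - 1 - h) = E * (sin y - y) + y * (E - 1).
  rewrite /cexp !(ImB, Im_realcM, Im1) /= -/x -/y -/E; ring.
have b1 : `|E * (cos y - 1)| <= 2 * (e1 * r).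
  rewrite normrM ler_pM// (le_trans Cy)// ler_wpM2l// ltW//.
have b2 : `|E * (sin y - y)| <= 2 * (e1 * r).
  rewrite normrM ler_pM// (le_trans Sy)// ler_wpM2l// ltW//.
have b3 : `|y * (E - 1)| <= r * e1 by rewrite normrM ler_pM.
have b4 : `|E - 1 - x| <= e1 * r by rewrite (le_trans Ex)// ler_wpM2l// ltW.
have := ler_normD (E - 1 - x) (E * (cos y - 1)).
have := ler_normD (E * (sin y - y)) (y * (E - 1)).
have : 6 * e1 * r <= e * r by rewrite ler_wpM2r.
lra.
Qed.
Lemma cdiff_cexp w : cdiff cexp w (cexp w).
Proof.
move=> e e0; have W0 : 0 < cabs (cexp w) by rewrite cabs_gt0 cexp_neq0.
have [de [de0 H]] := cdiff_cexp0 (divr_gt0 e0 W0).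
exists de; split => // h hde; have := H h hde; rewrite add0r cexp0 mul1r.
have -> : cexp (w + h) - cexp w - cexp w * h = cexp w * (cexp h - 1 - h).
  rewrite cexpD; ring.
by rewrite cabsM mulrAC ler_pdivlMr// mulrC.
Qed.

(** Meant for horizontal and vertical segments, whose parametrization by arc length is
    1-Lipschitz. *)
Lemma cdiff_conv_arc f (g : R -> C) (t : R) d : cdiff f (g t) d ->
  (forall s, cabs (g s - g t) <= `|s - t|) ->
  {for t, continuous (fun s => complex.Re (f (g s)))} /\
  {for t, continuous (fun s => complex.Im (f (g s)))}.
Proof.
move=> fd g1; split; apply/cvgrPdist_lt => e e0;
  have [de [de0 H]] := cdiff_cont fd e0; near=> s;
  rewrite -normrN opprB -?ReB -?ImB.
  rewrite (le_lt_trans (Re_le_cabs _))//.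
  have := H (g s - g t).
rewrite (_ : g t + (g s - g t) = g s); last by ring.
apply.
  rewrite (le_lt_trans (g1 s))// distrC; near: s; exact: cvgr_dist_lt.
rewrite (le_lt_trans (Im_le_cabs _))//.
have := H (g s - g t).
rewrite (_ : g t + (g s - g t) = g s); last by ring.
apply.
rewrite (le_lt_trans (g1 s))// distrC; near: s; exact: cvgr_dist_lt.
Unshelve. all: by end_near. Qed.

End ComplexDerivatives.

(** * Goursat's theorem for rectangles in the left half-plane *)

Section Goursat.
Context {R : realType}.
Local Notation C := R[i].
Local Notation mu := (@leb R).
Implicit Types (g : R -> C) (a b : R).

Definition itvint a b (h : R -> R) := Rintegral mu `[a, b]%classic h.
Definition lint a b g : C :=
  Complex (itvint a b (fun t => complex.Re (g t)))
          (itvint a b (fun t => complex.Im (g t))).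
(** Continuity is two-sided even at the end points, so it passes to subintervals without any
    argument. *)
Definition cont_on a b (h : R -> R) :=
  forall t, a <= t <= b -> {for t, continuous h}.
Definition ccont_on a b g := cont_on a b (fun t => complex.Re (g t)) /\
  cont_on a b (fun t => complex.Im (g t)).

Lemma cont_on_integrable a b h : cont_on a b h ->
  mu.-integrable `[a, b]%classic (EFin \o h).
Proof.
move=> ch; apply: continuous_compact_integrable; first exact: segment_compact.
apply: continuous_in_subspaceT => t; rewrite inE /= in_itv /= => tab.
exact: ch.
Qed.

Lemma mu_itv a b : a <= b -> fine (mu `[a, b]%classic) = b - a.
Proof.
move=> ab; rewrite /leb /= lebesgue_measure_itv /= lte_fin.
case: ltP => [//|ba]; have -> : a = b by apply/eqP; rewrite eq_le ab ba.
by rewrite subrr.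
Qed.

Lemma itvint_cst a b (c : R) : a <= b -> itvint a b (fun=> c) = c * (b - a).
Proof. by move=> ab; rewrite /itvint Rintegral_cst ?mu_itv//; exact: measurable_itv. Qed.
Lemma itvintB a b h k : cont_on a b h -> cont_on a b k ->
  itvint a b (fun t => h t - k t) = itvint a b h - itvint a b k.
Proof.
by move=> ch ck; rewrite /itvint RintegralB//; exact: cont_on_integrable.
Qed.
Lemma itvint_bound a b h (M : R) : a <= b -> cont_on a b h ->
  (forall t, a <= t <= b -> `|h t| <= M) -> `|itvint a b h| <= M * (b - a).
Proof.
move=> ab ch hM; have hi := cont_on_integrable ch.
have mI : measurable (`[a, b]%classic : set (measurableTypeR R)).
  exact: measurable_itv.
apply: (le_trans (le_normr_Rintegral mI hi)).
rewrite -(itvint_cst M ab); apply: le_Rintegral => //.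
- exact: (@integrable_abse _ _ _ mu _ (EFin \o h)).
- by apply: (@cont_on_integrable a b (cst M)) => t _; exact: cst_continuous.
Qed.
Lemma itvint_cat a m b h : a <= m <= b -> cont_on a b h ->
  itvint a b h = itvint a m h + itvint m b h.
Proof.
move=> /andP[am mb] ch; have hi := cont_on_integrable ch.
rewrite /itvint; apply/eqP; rewrite addrC -subr_eq; apply/eqP.
rewrite Rintegral_itvB ?bnd_simp//.
apply: Rintegral_itv_obnd_cbnd; apply: integrableS hi => //.
by apply: subset_itvr; rewrite bnd_simp.
Qed.

Lemma ccont_onB a b g k : ccont_on a b g -> ccont_on a b k ->
  ccont_on a b (fun t => g t - k t).
Proof.
move=> [gr gi] [kr ki]; rewrite /ccont_on.
have -> : (fun t => complex.Re (g t - k t)) =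
    (fun t => complex.Re (g t) - complex.Re (k t)).
  by apply/funext => t; rewrite ReB.
have -> : (fun t => complex.Im (g t - k t)) =
    (fun t => complex.Im (g t) - complex.Im (k t)).
  by apply/funext => t; rewrite ImB.
split => t tab; apply: cvgB;
  [exact: gr t tab|exact: kr t tab|exact: gi t tab|exact: ki t tab].
Qed.
Lemma ccont_on_cst a b (c : C) : ccont_on a b (fun=> c).
Proof. by split => t _; exact: cst_continuous. Qed.
Lemma lint_cst a b (c : C) : a <= b -> lint a b (fun=> c) = c * ((b - a)%:C)%C.
Proof.
move=> ab; rewrite /lint !itvint_cst//; case: c => x y.
by apply: complex_ext; rewrite ?ReM ?ImM /=; ring.
Qed.
Lemma lintB a b g k : ccont_on a b g -> ccont_on a b k ->
  lint a b (fun t => g t - k t) = lint a b g - lint a b k.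
Proof.
move=> [gr gi] [kr ki]; rewrite /lint; apply: complex_ext;
  rewrite ?ReB ?ImB /= -itvintB//; congr itvint; apply/funext => t;
  by rewrite ?ReB ?ImB.
Qed.
(** The factor 2 comes from estimating real and imaginary parts separately. *)
Lemma lint_bound a b g (M : R) : a <= b -> ccont_on a b g ->
  (forall t, a <= t <= b -> cabs (g t) <= M) ->
  cabs (lint a b g) <= 2 * M * (b - a).
Proof.
move=> ab [gr gi] gM; apply: (le_trans (cabs_le_ReIm _)) => /=.
rewrite -mulrA mulr_natl mulr2n; apply: lerD; apply: itvint_bound => // t tab;
  apply: (le_trans _ (gM t tab)); [exact: Re_le_cabs|exact: Im_le_cabs].
Qed.
Lemma lint_cat a m b g : a <= m <= b -> ccont_on a b g ->
  lint a b g = lint a m g + lint m b g.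
Proof.
move=> amb [gr gi]; rewrite /lint; apply: complex_ext;
  by rewrite ?ReD ?ImD /= -itvint_cat.
Qed.

Variable F : C -> C.
Hypothesis holF : forall w, complex.Re w < 0 -> cderivable F w.

Let arcH (t s : R) : s < 0 ->
  {for s, continuous (fun s => complex.Re (F (Complex s t)))} /\
  {for s, continuous (fun s => complex.Im (F (Complex s t)))}.
Proof.
move=> s0; have [|d Fd] := @cderivable_cdiff _ F (Complex s t); first exact: holF.
apply: (@cdiff_conv_arc _ F (fun s => Complex s t) s d Fd) => s'.
by rewrite cabsE /= subrr expr0n addr0 sqrtr_sqr.
Qed.
Lemma hol_vertical_continuous (s t : R) : s < 0 ->
  {for t, continuous (fun t => complex.Re (F (Complex s t)))} /\
  {for t, continuous (fun t => complex.Im (F (Complex s t)))}.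
Proof.
move=> s0; have [|d Fd] := @cderivable_cdiff _ F (Complex s t); first exact: holF.
apply: (@cdiff_conv_arc _ F (fun t => Complex s t) t d Fd) => s'.
by rewrite cabsE /= subrr expr0n add0r sqrtr_sqr.
Qed.
Let cH (a b t : R) : b < 0 -> ccont_on a b (fun s => F (Complex s t)).
Proof.
by move=> b0; split => s /andP[_ sb];
  have [] := @arcH t s (le_lt_trans sb b0).
Qed.
Let cV (a b s : R) : s < 0 -> ccont_on a b (fun t => F (Complex s t)).
Proof. by move=> s0; split => t _; have [] := @hol_vertical_continuous s t s0. Qed.

(** The contour integral of [F] along the boundary of [s1, s2] x [t1, t2], positively oriented; the
    vertical sides carry dw = i dt, the horizontal ones dw = ds. *)
Definition rectint (s1 s2 t1 t2 : R) : C :=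
  Complex 0 1 * (lint t1 t2 (fun t => F (Complex s2 t)) -
                 lint t1 t2 (fun t => F (Complex s1 t))) -
  (lint s1 s2 (fun s => F (Complex s t2)) -
   lint s1 s2 (fun s => F (Complex s t1))).

Lemma rectint_splits s1 m s2 t1 t2 : s1 <= m <= s2 -> s2 < 0 ->
  rectint s1 s2 t1 t2 = rectint s1 m t1 t2 + rectint m s2 t1 t2.
Proof.
move=> msm s20; rewrite /rectint.
rewrite (lint_cat msm (@cH s1 s2 t1 s20)) (lint_cat msm (@cH s1 s2 t2 s20)); ring.
Qed.
Lemma rectint_splitt s1 s2 t1 m t2 : t1 <= m <= t2 -> s1 < 0 -> s2 < 0 ->
  rectint s1 s2 t1 t2 = rectint s1 s2 t1 m + rectint s1 s2 m t2.
Proof.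
move=> tmt s10 s20; rewrite /rectint.
rewrite (lint_cat tmt (@cV t1 t2 s1 s10)) (lint_cat tmt (@cV t1 t2 s2 s20)); ring.
Qed.

(* Near a point of differentiability the affine part of F contributes
   nothing, so the contour integral of a small rectangle is [o(diam^2)]. *)
Lemma rectint_local (s0 t0 : R) (e : R) : s0 < 0 -> 0 < e ->
  exists de, 0 < de /\ forall s t A B, 0 <= A -> 0 <= B -> A + B < de ->
    s <= s0 <= s + A -> t <= t0 <= t + B -> s + A < 0 ->
    cabs (rectint s (s + A) t (t + B)) <= 4 * e * (A + B) ^+ 2.
Proof.
move=> s00 e0; have [|d Fd] := @cderivable_cdiff _ F (Complex s0 t0); first exact: holF.
have [de [de0 H]] := Fd _ e0; exists de; split => // s t A B A0 B0 ABde sI tI sA0.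
have near_pt s' t' : s <= s' <= s + A -> t <= t' <= t + B ->
    cabs (F (Complex s' t') - F (Complex s0 t0) - d * (Complex s' t' - Complex s0 t0))
      <= e * (A + B).
  move=> sI' tI'.
  have hb : cabs (Complex s' t' - Complex s0 t0) <= A + B.
    apply: (le_trans (cabs_le_ReIm _)); rewrite ReB ImB /=.
    by apply: lerD; rewrite ler_norml; lra.
  have := H (Complex s' t' - Complex s0 t0) (le_lt_trans hb ABde).
  have -> : Complex s0 t0 + (Complex s' t' - Complex s0 t0) = Complex s' t' by ring.
  by move=> /le_trans; apply; rewrite ler_wpM2l// ltW.
(* Opposite sides are subtracted pointwise: across the rectangle [F] changes by [d] times the
   displacement, which is constant along a side, up to 2 e (A + B). *)
have diff2 s' t' s'' t'' : s <= s' <= s + A -> t <= t' <= t + B ->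
    s <= s'' <= s + A -> t <= t'' <= t + B ->
    cabs (F (Complex s' t') - F (Complex s'' t'') - d * (Complex (s' - s'') (t' - t'')))
      <= 2 * e * (A + B).
  move=> h1 h2 h3 h4.
  have -> : F (Complex s' t') - F (Complex s'' t'') - d * (Complex (s' - s'') (t' - t'')) =
   (F (Complex s' t') - F (Complex s0 t0) - d * (Complex s' t' - Complex s0 t0)) -
   (F (Complex s'' t'') - F (Complex s0 t0) - d * (Complex s'' t'' - Complex s0 t0)).
    have -> : Complex (s' - s'') (t' - t'') = Complex s' t' - Complex s'' t'' by [].
    ring.
  rewrite (le_trans (cabsB _ _))//.
  have := near_pt _ _ h1 h2; have := near_pt _ _ h3 h4; lra.
have sAs : s <= s + A by rewrite lerDl.
have tBt : t <= t + B by rewrite lerDl.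
have s_lt0 : s < 0 by exact: le_lt_trans sA0.
have V1 := @cV t (t + B) _ sA0; have V2 := @cV t (t + B) _ s_lt0.
have H1 := @cH s (s + A) t sA0; have H2 := @cH s (s + A) (t + B) sA0.
have Vb : cabs (lint t (t + B) (fun t' => F (Complex (s + A) t') - F (Complex s t')) -
    d * Complex A 0 * (B%:C)%C) <= 2 * (2 * e * (A + B)) * B.
  have -> : d * Complex A 0 * (B%:C)%C = lint t (t + B) (fun=> d * Complex A 0).
    by rewrite lint_cst// addrAC subrr add0r.
  rewrite -lintB; [|exact: ccont_onB|exact: ccont_on_cst].
  have := @lint_bound t (t + B) (fun t' => F (Complex (s + A) t') - F (Complex s t') - d * Complex A 0) (2 * e * (A + B)) tBt.
  rewrite [t + B - t]addrAC subrr add0r; apply.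
    by apply: ccont_onB; [exact: ccont_onB|exact: ccont_on_cst].
  move=> t' t'I; have := @diff2 (s + A) t' s t'.
  rewrite subrr [s + A - s]addrAC subrr add0r; apply => //; rewrite ?lexx ?sAs//.
have Hb : cabs (lint s (s + A) (fun s' => F (Complex s' (t + B)) - F (Complex s' t)) -
    d * Complex 0 B * (A%:C)%C) <= 2 * (2 * e * (A + B)) * A.
  have -> : d * Complex 0 B * (A%:C)%C = lint s (s + A) (fun=> d * Complex 0 B).
    by rewrite lint_cst// addrAC subrr add0r.
  rewrite -lintB; [|exact: ccont_onB|exact: ccont_on_cst].
  have := @lint_bound s (s + A) (fun s' => F (Complex s' (t + B)) - F (Complex s' t) - d * Complex 0 B) (2 * e * (A + B)) sAs.
  rewrite [s + A - s]addrAC subrr add0r; apply.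
    by apply: ccont_onB; [exact: ccont_onB|exact: ccont_on_cst].
  move=> s' s'I; have := @diff2 s' (t + B) s' t.
  rewrite subrr [t + B - t]addrAC subrr add0r; apply => //; rewrite ?lexx ?tBt//.
have -> : rectint s (s + A) t (t + B) =
  Complex 0 1 * (lint t (t + B) (fun t' => F (Complex (s + A) t') - F (Complex s t')) -
    d * Complex A 0 * (B%:C)%C) -
  (lint s (s + A) (fun s' => F (Complex s' (t + B)) - F (Complex s' t)) -
    d * Complex 0 B * (A%:C)%C).
  rewrite !lintB//.
  (* The two affine contributions cancel: along the horizontal pair d (iB) A, along the vertical
     pair i (d A) B. *)
  have -> : d * Complex 0 B * (A%:C)%C = Complex 0 1 * (d * Complex A 0 * (B%:C)%C).
    have -> : Complex 0 B = Complex 0 1 * (B%:C)%C.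
      by apply: complex_ext; rewrite ?ReM ?ImM /=; ring.
    have -> : Complex A 0 = (A%:C)%C by [].
    ring.
  rewrite /rectint; ring.
rewrite (le_trans (cabsB _ _))// cabsM.
have -> : cabs (Complex 0 1) = 1 :> R by rewrite cabsE /= expr0n expr1n add0r sqrtr1.
rewrite mul1r (le_trans (lerD Vb Hb))//.
by rewrite expr2 le_eqVlt; apply/orP; left; apply/eqP; ring.
Qed.

(** The integrals over the four quarters add up to the whole one, so they cannot all have modulus
    below q / 4. *)
Let dyadic_step (s t A B q : R) : 0 <= A -> 0 <= B -> s + A < 0 ->
  q <= cabs (rectint s (s + A) t (t + B)) ->
  exists st : R * R, [/\ s <= st.1, st.1 + A / 2 <= s + A, t <= st.2,
    st.2 + B / 2 <= t + B &
    q / 4 <= cabs (rectint st.1 (st.1 + A / 2) st.2 (st.2 + B / 2))].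
Proof.
move=> A0 B0 sA0.
have [a1 a2 A2] : [/\ s <= s + A / 2, s + A / 2 <= s + A & s + A / 2 + A / 2 = s + A].
  by split; lra.
have [b1 b2 B2] : [/\ t <= t + B / 2, t + B / 2 <= t + B & t + B / 2 + B / 2 = t + B].
  by split; lra.
have s1 : s + A / 2 < 0 by exact: le_lt_trans sA0.
have s2 : s < 0 by exact: le_lt_trans s1.
have A3 : s + A / 2 + A / 2 <= s + A by rewrite A2.
have B3 : t + B / 2 + B / 2 <= t + B by rewrite B2.
have aI : s <= s + A / 2 <= s + A by rewrite a1.
have bI : t <= t + B / 2 <= t + B by rewrite b1.
move=> qQ; apply: contrapT => nst.
have K s' t' : s <= s' -> s' + A / 2 <= s + A -> t <= t' -> t' + B / 2 <= t + B ->
    cabs (rectint s' (s' + A / 2) t' (t' + B / 2)) < q / 4.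
  by move=> h1 h2 h3 h4; rewrite ltNge; apply/negP => h; apply: nst; exists (s', t').
move: qQ; rewrite (rectint_splits t (t + B) aI sA0) (rectint_splitt bI s2 s1).
rewrite (rectint_splitt bI s1 sA0).
have k1 := K s t (lexx _) a2 (lexx _) b2.
have k2 := K s (t + B / 2) (lexx _) a2 b1 B3.
have k3 := K (s + A / 2) t a1 A3 (lexx _) b2.
have k4 := K (s + A / 2) (t + B / 2) a1 A3 b1 B3.
rewrite leNgt => /negP; apply; rewrite (le_lt_trans (cabsD _ _))//.
apply: (le_lt_trans (lerD (cabsD _ _) (cabsD _ _))).
rewrite A2 B2 in k1 k2 k3 k4 *; lra.
Qed.

(** Bisection: if the integral had modulus q > 0, nested rectangles with integrals at least q / 4^n
    would shrink to a point, where [rectint_local] gives a smaller bound. *)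
Theorem goursat (s1 s2 t1 t2 : R) : s1 <= s2 -> t1 <= t2 -> s2 < 0 ->
  rectint s1 s2 t1 t2 = 0.
Proof.
move=> s12 t12 s20; apply/eqP; rewrite -cabs_eq0; apply/eqP.
apply: contrapT => /eqP Qn0.
pose A := s2 - s1; pose B := t2 - t1; pose q := cabs (rectint s1 s2 t1 t2).
have A0 : 0 <= A by rewrite subr_ge0.
have B0 : 0 <= B by rewrite subr_ge0.
have q0 : 0 < q by rewrite lt_def Qn0 cabs_ge0.
pose good n (st : R * R) := [/\ s1 <= st.1, st.1 + A / 2 ^+ n <= s2 &
  q / 4 ^+ n <= cabs (rectint st.1 (st.1 + A / 2 ^+ n) st.2 (st.2 + B / 2 ^+ n))].
have A2n n : A / 2 ^+ n.+1 = A / 2 ^+ n / 2 by rewrite exprSr invfM mulrA.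
have B2n n : B / 2 ^+ n.+1 = B / 2 ^+ n / 2 by rewrite exprSr invfM mulrA.
have q4n n : q / 4 ^+ n.+1 = q / 4 ^+ n / 4 by rewrite exprSr invfM mulrA.
(* Goodness is a premise inside the existential, so that the successor function obtained by [choice]
   is total. *)
have step n st : exists st', good n st -> [/\ good n.+1 st', st.1 <= st'.1,
    st'.1 + A / 2 ^+ n.+1 <= st.1 + A / 2 ^+ n, st.2 <= st'.2 &
    st'.2 + B / 2 ^+ n.+1 <= st.2 + B / 2 ^+ n].
  have [g|ng] := pselect (good n st); last by exists st.
  have [g1 g2 g3] := g.
  have [||||st' [h1 h2 h3 h4 h5]] := @dyadic_step st.1 st.2 (A / 2 ^+ n) (B / 2 ^+ n) (q / 4 ^+ n).
  - by rewrite divr_ge0// exprn_ge0.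
  - by rewrite divr_ge0// exprn_ge0.
  - exact: le_lt_trans s20.
  - exact: g3.
  exists st' => _; rewrite A2n B2n; split => //; split; rewrite ?A2n ?B2n ?q4n//.
    exact: le_trans h1.
  exact: le_trans g2.
have [nxt nxtP] := choice (fun p : nat * (R * R) => step p.1 p.2).
pose st := fix st n := if n is k.+1 then nxt (k, st k) else (s1, t1).
have stg n : good n (st n).
  elim: n => [|n IH]; last by have [] := nxtP (n, st n) IH.
  rewrite /good /= !expr0 !divr1.
  by split => //; rewrite /A /B ?[_ + (_ - _)]addrC ?subrK.
have stn n := nxtP (n, st n) (stg n).
have ndS : nondecreasing_seq (fun n => (st n).1).
  by apply/nondecreasing_seqP => n; have [] := stn n.
have ndT : nondecreasing_seq (fun n => (st n).2).
  by apply/nondecreasing_seqP => n; have [] := stn n.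
have niS : nonincreasing_seq (fun n => (st n).1 + A / 2 ^+ n).
  by apply/nonincreasing_seqP => n; have [] := stn n.
have niT : nonincreasing_seq (fun n => (st n).2 + B / 2 ^+ n).
  by apply/nonincreasing_seqP => n; have [] := stn n.
have An n : 0 <= A / 2 ^+ n by rewrite divr_ge0// exprn_ge0.
have Bn n : 0 <= B / 2 ^+ n by rewrite divr_ge0// exprn_ge0.
have crossS m n : (st m).1 <= (st n).1 + A / 2 ^+ n.
  have h1 : (st m).1 <= (st (maxn m n)).1 by apply: ndS; exact: leq_maxl.
  have h2 : (st (maxn m n)).1 + A / 2 ^+ (maxn m n) <= (st n).1 + A / 2 ^+ n.
    by apply: niS; exact: leq_maxr.
  have := An (maxn m n); lra.
have crossT m n : (st m).2 <= (st n).2 + B / 2 ^+ n.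
  have h1 : (st m).2 <= (st (maxn m n)).2 by apply: ndT; exact: leq_maxl.
  have h2 : (st (maxn m n)).2 + B / 2 ^+ (maxn m n) <= (st n).2 + B / 2 ^+ n.
    by apply: niT; exact: leq_maxr.
  have := Bn (maxn m n); lra.
pose s0 := sup (range (fun n => (st n).1)).
pose t0 := sup (range (fun n => (st n).2)).
have s0P n : (st n).1 <= s0 <= (st n).1 + A / 2 ^+ n.
  apply/andP; split.
    by apply: ub_le_sup; [exists ((st 0%N).1 + A / 2 ^+ 0) => _ [m _ <-]; exact: crossS|exists n].
  by apply: ge_sup; [exists (st 0%N).1, 0%N|move=> _ [m _ <-]; exact: crossS].
have t0P n : (st n).2 <= t0 <= (st n).2 + B / 2 ^+ n.
  apply/andP; split.
    by apply: ub_le_sup; [exists ((st 0%N).2 + B / 2 ^+ 0) => _ [m _ <-]; exact: crossT|exists n].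
  by apply: ge_sup; [exists (st 0%N).2, 0%N|move=> _ [m _ <-]; exact: crossT].
have s00 : s0 < 0.
  have /andP[_ h] := s0P 0%N; apply: (le_lt_trans h).
  by have [_ g _] := stg 0%N; exact: le_lt_trans s20.
(* With e = q / (8 ((A + B)^2 + 1)) the local bound 4 e (A + B)^2 / 4^n is below q / 4^n; the
   summand 1 keeps the divisor positive for a rectangle reduced to a point. *)
have AB0 : 0 < 8 * ((A + B) ^+ 2 + 1).
  by rewrite mulr_gt0// ltr_wpDl// sqr_ge0.
have [de [de0 H]] := rectint_local t0 s00 (divr_gt0 q0 AB0).
have [n nde] : exists n : nat, (A + B) / 2 ^+ n < de.
  have [n nP] : exists n : nat, (A + B) / de < n%:R.
    by exists (Num.truncn ((A + B) / de)).+1; exact: truncnS_gt.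
  exists n; rewrite ltr_pdivrMr ?exprn_gt0// mulrC -ltr_pdivrMr//.
  rewrite (lt_le_trans nP)// -natrX ler_nat; apply: ltnW; exact: ltn_expl.
have [g1 g2 g3] := stg n.
have := H (st n).1 (st n).2 (A / 2 ^+ n) (B / 2 ^+ n) (An n) (Bn n).
rewrite -mulrDl => /(_ nde (s0P n) (t0P n) (le_lt_trans g2 s20)) => h.
have {h} := le_trans g3 h; rewrite exprMn exprVn -exprM mulnC exprM.
have -> : (2 : R) ^+ 2 = 4 by rewrite expr2; ring.
rewrite mulrA ler_pM2r ?invr_gt0 ?exprn_gt0//.
rewrite leNgt => /negP; apply.
set X := (A + B) ^+ 2 in AB0 *; set u := q / (8 * (X + 1)).
have u0 : 0 < u by rewrite divr_gt0.
have hu : q = u * (8 * (X + 1)) by rewrite divfK// gt_eqF.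
have X0 : 0 <= X by exact: sqr_ge0.
rewrite [ltRHS]hu; have := mulr_ge0 (ltW u0) X0; nra.
Qed.

End Goursat.

(** * Taylor coefficients read off from circles *)

Section TaylorCoefficients.
Context {R : realType}.
Local Notation C := R[i].
Local Notation T := (@Tdom R).
Implicit Types (f g : C -> C) (r : R).

Definition circ f r : R -> C := fun t => f ((r%:C)%C * expi t).

Lemma holo_cont f z e : holo_disc f -> cabs z < 1 -> 0 < e ->
  exists delta, 0 < delta /\
  forall w, cabs (w - z) < delta -> cabs (f w - f z) < e.
Proof.
move=> hf z1 e0; have [d fd] := cderivable_cdiff (hf z z1).
have [de [de0 H]] := cdiff_cont fd e0; exists de; split => // w wz.
by have := H _ wz; rewrite (_ : z + (w - z) = w); last by ring.
Qed.
Lemma cabs_circ r t : 0 <= r -> cabs ((r%:C)%C * expi t) = r.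
Proof. by move=> r0; rewrite cabsM cabs_expi mulr1 cabs_real ger0_norm. Qed.

Lemma cexp_ln r t : 0 < r -> cexp (Complex (ln r) t) = (r%:C)%C * expi t.
Proof. by move=> r0; rewrite /cexp /= lnK. Qed.

Lemma holo_comp_cexp f w : holo_disc f -> complex.Re w < 0 ->
  exists d, cdiff (f \o cexp) w d.
Proof.
move=> hf w0; have [|d fd] := @cderivable_cdiff _ f (cexp w).
  by apply: hf; rewrite cabs_cexp expR_lt1.
by exists (d * cexp w); apply: cdiff_comp fd; exact: cdiff_cexp.
Qed.

Lemma circ_cmeas f r : holo_disc f -> 0 <= r < 1 -> cmeas (circ f r).
Proof.
move=> hf /andP[]; rewrite le_eqVlt => /predU1P[<- _|r0 r1].
  have -> : circ f 0 = fun=> f 0 by apply/funext => t; rewrite /circ mul0r.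
  exact: cmeas_cst.
have hF w : complex.Re w < 0 -> cderivable (f \o cexp) w.
  by move=> w0; have [d /cdiff_cderivable] := holo_comp_cexp hf w0.
have l0 : ln r < 0 by rewrite ln_lt0// r0.
have E t : circ f r t = (f \o cexp) (Complex (ln r) t) by rewrite /= cexp_ln.
split; apply: cmeas_continuous; (under eq_fun do rewrite E) => t;
  by have [] := hol_vertical_continuous hF t l0.
Qed.

Lemma circ_CI f r (M : R) : holo_disc f -> 0 <= r < 1 ->
  (forall t, cabs (circ f r t) <= M) -> CI (circ f r).
Proof. by move=> hf r01 fM; apply: (@CI_bounded _ _ M) => //; exact: circ_cmeas. Qed.

Lemma lint_cint (g : R -> C) :
  lint 0 (pi *+ 2) g = ((pi *+ 2)%:C)%C * cint g.
Proof.
by apply: complex_ext; rewrite ?Re_realcM ?Im_realcM /= mulrC divfK// twopi_neq0.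
Qed.

(** Goursat's theorem for f(e^w) e^(-kw) on [ln r1, ln r2] x [0, 2 pi]. The integrand has period 2
    pi i, so the horizontal sides cancel, and each vertical side is 2 pi r^(-k) times the k-th
    Fourier coefficient on the circle of radius r. *)
Lemma circ_fcoef_indep f (k : int) r1 r2 : holo_disc f -> 0 < r1 < 1 -> 0 < r2 < 1 ->
  CI (circ f r1) -> CI (circ f r2) ->
  ((expR ((- k)%:~R * ln r1))%:C)%C * fcoef (circ f r1) k =
  ((expR ((- k)%:~R * ln r2))%:C)%C * fcoef (circ f r2) k.
Proof.
move=> hf; wlog r12 : r1 r2 / r1 <= r2.
  move=> W h1 h2 c1 c2; have [r12|/ltW r21] := leP r1 r2; first exact: W.
  by apply/esym; exact: W.
move=> /andP[r10 r11] /andP[r20 r21] c1 c2.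
pose c : C := (((- k)%:~R : R)%:C)%C.
pose G w := f (cexp w) * cexp (c * w).
have hG w : complex.Re w < 0 -> cderivable G w.
  move=> w0; have [d fd] := holo_comp_cexp hf w0.
  have h : cdiff (fun w => cexp (c * w)) w (cexp (c * w) * (c * 1)).
    by apply: (cdiff_comp (cdiffZ c (cdiff_id w)) (cdiff_cexp (c * w))).
  exact: cdiff_cderivable (cdiffM fd h).
have GE r t : 0 < r -> G (Complex (ln r) t) =
    ((expR ((- k)%:~R * ln r))%:C)%C * (circ f r t * expi ((- k)%:~R * t)).
  move=> r0; rewrite /G cexp_ln// /cexp /c Re_realcM Im_realcM /=.
  by rewrite mulrCA.
have ln1 : ln r1 <= ln r2 by rewrite ler_ln ?posrE.
have ln2 : ln r2 < 0 by rewrite ln_lt0// r20.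
have := goursat hG ln1 (ltW (@twopi_gt0 R)) ln2.
rewrite /rectint.
have -> : (fun s : R => G (Complex s (pi *+ 2))) = fun s => G (Complex s 0).
  apply/funext => s; rewrite /G /cexp !Re_realcM !Im_realcM /=.
  by rewrite expi_2pi expi0 mulr0 expi0 expi_int2pi.
rewrite subrr subr0 => /eqP; rewrite mulf_eq0 => /orP[/eqP[/eqP]|].
  by rewrite oner_eq0.
rewrite subr_eq0 !lint_cint => /eqP /(mulfI _) H.
have {}H : cint (fun t => G (Complex (ln r2) t)) = cint (fun t => G (Complex (ln r1) t)).
  by apply: H; rewrite -cabs_eq0 cabs_real normr_eq0 twopi_neq0.
rewrite !fcoefE -!cintZ; [|exact: CI_mul_expi..].
transitivity (cint (fun t => G (Complex (ln r1) t))).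
  by apply: cint_eq => t _; rewrite GE.
by rewrite -H; apply: cint_eq => t _; rewrite GE.
Qed.

Lemma circ_near0 f e : holo_disc f -> 0 < e -> exists2 d, 0 < d < 1 &
  forall r t, 0 <= r <= d -> cabs (circ f r t - f 0) < e.
Proof.
move=> hf e0; have [|d [d0 H]] := @holo_cont f 0 e hf _ e0; first by rewrite cabs0.
exists (Num.min (d / 2) (1 / 2)).
  by rewrite lt_min !divr_gt0//= gt_min; apply/orP; right; lra.
move=> r t /andP[r0]; rewrite le_min => /andP[rd _]; apply: H.
by rewrite subr0 cabs_circ//; lra.
Qed.

(** The n-th Taylor coefficient by Cauchy's formula on the circle of radius 1/2; by
    [circ_fcoef_indep] other radii in (0, 1) give the same value. *)
Definition tcoef f (n : nat) : C := (2 ^+ n) * fcoef (circ f (2^-1)) n.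

Lemma expRM_ln (m : nat) r : 0 < r -> expR (m%:R * ln r) = r ^+ m.
Proof. by move=> r0; rewrite expRM_natl lnK. Qed.

Lemma fcoef_circ f (n : nat) r : holo_disc f -> 0 < r < 1 ->
  CI (circ f r) -> CI (circ f 2^-1) ->
  fcoef (circ f r) n = tcoef f n * ((r ^+ n)%:C)%C.
Proof.
move=> hf r01 c1 c2; have /andP[r0 r1] := r01.
have h01 : 0 < (2^-1 : R) < 1 by apply/andP; split; lra.
have /andP[h0 h1] := h01.
have := circ_fcoef_indep n hf r01 h01 c1 c2.
rewrite !mulrNz !mulNr !expRN -!pmulrn !expRM_ln// => H.
rewrite /tcoef [X in X * _]mulrC -mulrA mulrC.
have rn0 : ((r ^+ n)%:C)%C != 0 :> C.
  by rewrite -cabs_eq0 cabs_real normr_eq0 expf_neq0// gt_eqF.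
apply: (mulfI (x := (((r ^+ n)^-1)%:C)%C)).
  by rewrite -cabs_eq0 cabs_real normr_eq0 invr_eq0 expf_neq0// gt_eqF.
rewrite H exprVn invrK.
have -> : ((2 ^+ n)%:C)%C = 2 ^+ n :> C.
  by rewrite realcX; congr (_ ^+ _); apply: complex_ext; rewrite //= ?addr0.
have : ((r ^+ n)%:C)%C * (((r ^+ n)^-1)%:C)%C = 1 :> C.
  by rewrite -realcM divff// expf_neq0// gt_eqF.
move: (((r ^+ n)%:C)%C) (((r ^+ n)^-1)%:C)%C => u v uv.
by rewrite -[LHS]mul1r -uv; ring.
Qed.

(** Compare with a circle of radius s tending to 0: for k = -(m+1), the quantity s^(m+1) times the
    coefficient does not depend on s, while the coefficient stays bounded near the centre. *)
Lemma fcoef_circ_neg f (k : int) r : holo_disc f -> 0 < r < 1 -> k < 0 ->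
  (forall r, 0 < r < 1 -> CI (circ f r)) -> fcoef (circ f r) k = 0.
Proof.
move=> hf r01 k0 cf; have /andP[r0 r1] := r01.
case: k k0 => // m _; set k := Negz m.
have [d d01 dP] := circ_near0 hf ltr01.
have /andP[d0 d1] := d01.
apply/eqP; rewrite -cabs_eq0 eq_le cabs_ge0 andbT.
have K s : 0 < s <= d -> r ^+ m.+1 * cabs (fcoef (circ f r) k) <= s * (cabs (f 0) + 1).
  move=> /andP[s0 sd]; have s01 : 0 < s < 1 by rewrite s0 (le_lt_trans sd).
  have := congr1 (@cabs R) (circ_fcoef_indep k hf r01 s01 (cf _ r01) (cf _ s01)).
  rewrite /k NegzE opprK -!pmulrn !expRM_ln// !cabsM !cabs_real.
  rewrite (ger0_norm (exprn_ge0 _ (ltW r0))) (ger0_norm (exprn_ge0 _ (ltW s0))) => ->.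
  apply: ler_pM; rewrite ?exprn_ge0 ?cabs_ge0 ?(ltW s0)//.
    by rewrite exprS ler_piMr ?(ltW s0)// exprn_ile1 ?(ltW s0)// ltW// (le_lt_trans sd).
  rewrite (le_trans (cabs_fcoef _ (cf _ s01)))//.
  rewrite -[leRHS]avg_cst; apply: avg_le; [exact: CI_abs (cf _ s01)|exact: RI_cst|].
  move=> t _ /=; have -> : circ f s t = (circ f s t - f 0) + f 0 by rewrite subrK.
  rewrite (le_trans (cabsD _ _))// addrC lerD2l ltW// dP//.
  by rewrite (ltW s0).
have M0 : 0 < cabs (f 0) + 1 by rewrite ltr_wpDl ?cabs_ge0.
have rm0 : 0 < r ^+ m.+1 by rewrite exprn_gt0.
rewrite leNgt; apply/negP => c0.
set c := cabs _ in K c0.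
(* Half of the radius at which the bound [K] would be an equality, so that [K] fails at [s]. *)
pose s := Num.min d (r ^+ m.+1 * c / (cabs (f 0) + 1) / 2).
have s0 : 0 < s by rewrite lt_min d0 !divr_gt0// mulr_gt0.
have := K s; rewrite s0 /s ge_min lexx => /(_ isT).
rewrite -/s leNgt => /negP; apply.
rewrite -ltr_pdivlMr//.
rewrite (@le_lt_trans _ _ (r ^+ m.+1 * c / (cabs (f 0) + 1) / 2))//.
  by rewrite /s ge_min lexx orbT.
by rewrite ltr_pdivrMr// ltr_pMr ?ltr1n// divr_gt0// mulr_gt0.
Qed.

(** The mean over a circle is the same for all radii, and on small circles it is close to [f 0] by
    continuity. *)
Lemma tcoef0 f : holo_disc f -> (forall r, 0 < r < 1 -> CI (circ f r)) ->
  tcoef f 0 = f 0.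
Proof.
move=> hf cf; apply/eqP; rewrite -subr_eq0 -cabs_eq0 eq_le cabs_ge0 andbT.
apply/ler_addgt0Pl => e e0; rewrite addr0.
have [d d01 dP] := circ_near0 hf e0; have /andP[d0 d1] := d01.
have h01 : 0 < (2^-1 : R) < 1 by apply/andP; split; lra.
have := fcoef_circ 0 hf d01 (cf _ d01) (cf _ h01).
rewrite expr0 mulr1 => <-.
have -> : f 0 = fcoef (fun _ : R => f 0) 0 by rewrite fcoef_cst.
rewrite -fcoefB; [|exact: cf|exact: CI_cst].
have h : CI (fun t => circ f d t - f 0) by apply: CIB; [exact: cf|exact: CI_cst].
rewrite (le_trans (cabs_fcoef _ h))// -[leRHS]avg_cst.
apply: avg_le; [exact: CI_abs|exact: RI_cst|] => t _; rewrite ltW// dP//.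
by rewrite lexx ltW.
Qed.

End TaylorCoefficients.

(** * Functions with positive real part *)

Section ComplexPower.
Context {R : realType}.
Local Notation C := R[i].
Implicit Types (w z h : C) (p e : R).
Local Notation Re := complex.Re.
Local Notation Im := complex.Im.

(** The principal argument on the right half-plane, the only region where it is used as such. *)
Definition carg w : R := atan (Im w / Re w).
Definition clog w : C := Complex (ln (cabs w)) (carg w).

Lemma cos_carg w : 0 < Re w -> Re w = cabs w * cos (carg w).
Proof.
move=> w0; rewrite /carg cos_atan.
have -> : cabs w = Re w * Num.sqrt (1 + (Im w / Re w) ^+ 2).
  rewrite -[X in X * _](gtr0_norm w0) -sqrtr_sqr -sqrtrM ?sqr_ge0// cabsE.
  by congr Num.sqrt; field; rewrite gt_eqF.
rewrite -mulrA divff ?mulr1// sqrtr_eq0 -ltNge.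
by rewrite ltr_pwDl// sqr_ge0.
Qed.
Lemma carg_itv w : - (pi / 2) < carg w < pi / 2.
Proof. by rewrite atan_gtNpi2 atan_ltpi2. Qed.
Lemma sin_carg w : 0 < Re w -> Im w = cabs w * sin (carg w).
Proof.
move=> w0; have c0 : 0 < cos (carg w) by rewrite cos_gt0_pihalf// carg_itv.
have : tan (carg w) = Im w / Re w by rewrite atanK.
rewrite /tan => /(congr1 (fun x => x * cos (carg w))).
rewrite divfK ?gt_eqF// => ->; rewrite mulrCA -cos_carg// divfK//.
by rewrite gt_eqF.
Qed.
Lemma cabs_gt0_Re w : 0 < Re w -> 0 < cabs w.
Proof. by move=> /lt_le_trans; apply; exact: Re_le_cabs'. Qed.
Lemma cexp_clog w : 0 < Re w -> cexp (clog w) = w.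
Proof.
move=> w0; rewrite /cexp /= lnK ?posrE ?cabs_gt0_Re//.
by apply: complex_ext; rewrite ?Re_realcM ?Im_realcM /= -?cos_carg -?sin_carg.
Qed.

Lemma cvg_eps (f : R -> R) (x : R) : {for x, continuous f} -> forall e, 0 < e ->
  exists2 d, 0 < d & forall y, `|y - x| < d -> `|f y - f x| < e.
Proof.
move=> cf e e0; have /cvgrPdist_lt/(_ e e0) := cf.
move=> /nbhs_ballP[d /= d0 H]; exists d => // y yx.
by rewrite distrC; apply: H; rewrite /ball /= distrC.
Qed.

Lemma clog_cont w : 0 < Re w -> forall e, 0 < e ->
  exists d, 0 < d /\ forall h, cabs h < d -> cabs (clog (w + h) - clog w) < e.
Proof.
move=> w0 e e0; have e20 : 0 < e / 2 by rewrite divr_gt0.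
have [d1 d10 H1] := cvg_eps (continuous_ln (cabs_gt0_Re w0)) e20.
have [d2 d20 H2] := cvg_eps (@continuous_atan R (Im w / Re w)) e20.
set x := Re w in w0 *; set y := Im w.
(* The quotient Im / Re moves by at most (x + |y|) |h| / (x (x + Re h)), and x + Re h > x / 2; [d3]
   is chosen so that this stays below [d2]. *)
pose d3 := d2 * x ^+ 2 / 2 / (x + `|y|) / 2.
have xy0 : 0 < x + `|y| by rewrite ltr_wpDr.
have d30 : 0 < d3 by rewrite !divr_gt0// mulr_gt0// exprn_gt0.
exists (Num.min d1 (Num.min d3 (x / 2))); split.
  by rewrite !lt_min d10 d30 divr_gt0.
move=> h; rewrite !lt_min => /andP[h1 /andP[h3 hx]].
rewrite (le_lt_trans (cabs_le_ReIm _))// ReB ImB /= (splitr e).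
apply: ltrD.
  by apply: H1; rewrite (le_lt_trans (cabs_dist _ _))// addrAC subrr add0r.
apply: H2; rewrite ReD ImD -/x -/y.
have xh : x / 2 < x + Re h.
  have := Re_le_cabs h; rewrite ler_norml => /andP[]; lra.
have x'0 : 0 < x + Re h by apply: lt_trans xh; rewrite divr_gt0.
have -> : (y + Im h) / (x + Re h) - y / x = (x * Im h - y * Re h) / (x * (x + Re h)).
  by field; rewrite !gt_eqF.
rewrite normrM normfV (gtr0_norm (mulr_gt0 w0 x'0)) ltr_pdivrMr ?mulr_gt0//.
rewrite (@le_lt_trans _ _ ((x + `|y|) * cabs h))//.
  rewrite (le_trans (ler_normB _ _))// !normrM (gtr0_norm w0) mulrDl.
  by apply: lerD; apply: ler_wpM2l; rewrite ?(ltW w0)// ?Im_le_cabs ?Re_le_cabs.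
have d3E : (x + `|y|) * d3 = d2 * x ^+ 2 / 4.
  by rewrite /d3; field; rewrite gt_eqF.
have k1 : (x + `|y|) * cabs h < d2 * x ^+ 2 / 4 by rewrite -d3E ltr_pM2l.
have k2 : 0 < d2 * x * (x + Re h - x / 2).
  by rewrite !mulr_gt0// subr_gt0.
have k3 : 0 < d2 * x ^+ 2 by rewrite mulr_gt0// exprn_gt0.
nra.
Qed.

(** Derivative of an inverse function: with k = log(w+h) - log w, the expansion of [cexp] at log w
    reads h - w k = o(k), and |k| <= 2 |h| / |w| turns this into o(h). *)
Lemma cdiff_clog w : 0 < Re w -> cdiff clog w w^-1.
Proof.
move=> w0 e e0; have aw0 := cabs_gt0_Re w0; set a := cabs w in aw0.
have wn0 : w != 0 by rewrite -cabs_gt0.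
(* The bound a / 2 lets the error be absorbed in |k| <= 2 |h| / a; the other one produces [e] after
   substituting that estimate. *)
pose e1 := Num.min (a / 2) (e * a ^+ 2 / 2).
have e10 : 0 < e1 by rewrite lt_min !divr_gt0// mulr_gt0// exprn_gt0.
have [d1 [d10 H1]] := cdiff_cexp (clog w) e10.
have [d2 [d20 H2]] := clog_cont w0 d10.
exists (Num.min d2 (Re w)); split; first by rewrite lt_min d20.
move=> h; rewrite lt_min => /andP[h2 hw].
have wh0 : 0 < Re (w + h).
  by rewrite ReD; have := Re_le_cabs h; rewrite ler_norml => /andP[]; lra.
set k := clog (w + h) - clog w.
have := H1 k (H2 h h2).
have -> : clog w + k = clog (w + h) by rewrite /k; ring.
rewrite !cexp_clog//.
have -> : w + h - w - w * k = - (w * (k - w^-1 * h)).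
  by field.
rewrite cabsN cabsM -/a => hk.
have kh : cabs k <= 2 * cabs h / a.
  have hh : a * cabs k <= cabs h + e1 * cabs k.
    rewrite -cabsM; have -> : w * k = h + w * (k - w^-1 * h).
      by field.
    by rewrite (le_trans (cabsD _ _))// lerD2l cabsM.
  have : e1 * cabs k <= a / 2 * cabs k.
    by rewrite ler_wpM2r ?cabs_ge0// /e1 ge_min lexx.
  rewrite ler_pdivlMr//; lra.
rewrite -(ler_pM2l aw0) (le_trans hk)//.
rewrite (@le_trans _ _ (e * a ^+ 2 / 2 * (2 * cabs h / a)))//.
  by apply: ler_pM => //; rewrite ?(ltW e10) ?cabs_ge0// /e1 ge_min lexx orbT.
by rewrite le_eqVlt; apply/orP; left; apply/eqP; field; rewrite gt_eqF.
Qed.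

Definition cpow p w : C := cexp ((p%:C)%C * clog w).

Lemma cdiff_cpow p w : 0 < Re w -> exists d, cdiff (cpow p) w d.
Proof.
move=> w0; exists (cexp ((p%:C)%C * clog w) * ((p%:C)%C * w^-1)).
apply: (@cdiff_comp _ (fun z => (p%:C)%C * clog z) cexp); last exact: cdiff_cexp.
by apply: cdiffZ; exact: cdiff_clog.
Qed.
Lemma expR_powR p a : 0 < a -> expR (p * ln a) = a `^ p.
Proof. by move=> a0; rewrite /powR gt_eqF. Qed.
Lemma cabs_cpow p w : 0 < Re w -> cabs (cpow p w) = cabs w `^ p.
Proof.
by move=> w0; rewrite /cpow cabs_cexp Re_realcM /= expR_powR// cabs_gt0_Re.
Qed.
Lemma Re_cpow p w : 0 < Re w -> Re (cpow p w) = cabs w `^ p * cos (p * carg w).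
Proof.
by move=> w0; rewrite /cpow /cexp Re_realcM Re_realcM Im_realcM /= expR_powR// cabs_gt0_Re.
Qed.

(* When |arg w| is close to pi/2, p * arg w lies beyond pi/2 and the term
   - B * Re (w^p) dominates; elsewhere Re w is comparable to |w|. *)
Lemma cpow_ineq p : 1 < p -> p <= 2 -> exists A B : R,
  [/\ 0 <= A, 0 < B & forall w, 0 < Re w ->
    cabs w `^ p <= A * (Re w) `^ p - B * Re (cpow p w)].
Proof.
move=> p1 p2; have p0 : 0 < p by exact: lt_trans p1.
have pi0 := pi_gt0 R.
(* Here p th0 = pi (p + 1) / 4 lies strictly between pi / 2 and pi, while th0 < pi / 2 because p >
   1. As p <= 2, p |arg w| stays in [0, pi], where the cosine decreases. *)
pose th0 : R := pi * (p + 1) / (4 * p).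
have th00 : 0 < th0 by rewrite divr_gt0 ?mulr_gt0// addr_gt0.
have pth0 : p * th0 = pi * (p + 1) / 4 by rewrite /th0; field; rewrite gt_eqF.
have th0pi : th0 < pi / 2.
  by rewrite -(ltr_pM2l p0) pth0; nra.
have cth0 : 0 < cos th0 by rewrite cos_gt0_pihalf//; lra.
have cpth0 : cos (p * th0) < 0.
  have -> : 0 = cos (pi / 2) :> R by rewrite cos_pihalf.
  by rewrite ltr_cos ?in_itv/= ?pth0; nra.
pose B := (- cos (p * th0))^-1.
have B0 : 0 < B by rewrite invr_gt0 oppr_gt0.
(* [B] normalizes - B cos(p th0) to 1, which settles angles beyond [th0]. For smaller angles A cos^p
   >= 1 + B, which also pays for the term B cos(p x) <= B. *)
pose A := (1 + B) / (cos th0) `^ p.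
have A0 : 0 < A by rewrite divr_gt0 ?powR_gt0// addr_gt0.
exists A, B; split; [exact: ltW|by []|] => w w0.
rewrite Re_cpow//; have W0 := cabs_gt0_Re w0.
have := cos_carg w0; set th := carg w => cw.
have /andP[thl thr] := carg_itv w; rewrite -/th in thl thr.
have cth : 0 < cos th by rewrite cos_gt0_pihalf// thl.
rewrite cw (powRM _ (ltW W0) (ltW cth)).
have Wp : 0 <= cabs w `^ p by exact: powR_ge0.
rewrite mulrCA -{1}[cabs w `^ p]mulr1 [B * _]mulrCA -mulrBr ler_wpM2l//.
have ath : 0 <= `|th| < pi / 2 by rewrite normr_ge0 ltr_norml thl.
have -> : cos th = cos `|th| by rewrite cos_norm.
have -> : cos (p * th) = cos (p * `|th|).
  by rewrite -[LHS]cos_norm normrM (gtr0_norm p0).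
move: ath; move: `|th| => x /andP[x0 xpi].
have [th0x|xth0] := leP th0 x.
  have h1 : cos (p * x) <= cos (p * th0).
    rewrite leNgt ltr_cos ?in_itv/= ?pth0; [|nra|nra].
    by rewrite -leNgt -pth0 ler_pM2l.
  have h2 : 1 <= B * - cos (p * x).
    by rewrite /B mulrC ler_pdivlMr ?oppr_gt0// mul1r lerN2.
  have : 0 <= A * cos x `^ p by rewrite mulr_ge0 ?powR_ge0// ltW.
  lra.
have h1 : cos th0 `^ p <= cos x `^ p.
  have cc : cos th0 < cos x by rewrite ltr_cos ?in_itv/=; lra.
  by apply: ge0_ler_powR; rewrite ?nnegrE; lra.
have h2 : 1 + B <= A * cos x `^ p.
  rewrite /A mulrAC ler_pdivlMr ?powR_gt0//.
  by rewrite ler_wpM2l// addr_ge0// ltW.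
have := ler_wpM2l (ltW B0) (cos_le1 (p * x)); lra.
Qed.

End ComplexPower.

Section PositiveRealPart.
Context {R : realType}.
Local Notation C := R[i].
Local Notation Re := complex.Re.

Lemma horner_bound (F : {poly C}) (z : C) : cabs z <= 1 ->
  cabs F.[z] <= \sum_(i < size F) cabs F`_i.
Proof.
move=> z1; rewrite horner_coef (le_trans (cabs_sum _ _ _))//.
apply: ler_sum => i _; rewrite cabsM cabsX ler_piMr ?cabs_ge0//.
by rewrite exprn_ile1 ?cabs_ge0.
Qed.

(** F^p is analytic where Re F > 0, so the mean of Re (F^p) over the unit circle is its value at 0,
    namely F(0)^p > 0 since F(0) is real. Thus the negative term of [cpow_ineq] has a sign after
    integration. *)
Lemma positive_Lp_bound (p : R) : 1 < p -> p <= 2 -> exists2 A, 0 <= A &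
  forall (F : {poly C}) (rho : R), 1 < rho ->
    (forall z, cabs z < rho -> 0 < Re F.[z]) -> complex.Im F.[0] = 0 ->
    avg (fun t => cabs F.[expi t] `^ p) <= A * avg (fun t => Re F.[expi t] `^ p) /\
    Re F.[0] `^ p <= A * avg (fun t => Re F.[expi t] `^ p).
Proof.
move=> p1 p2; have p0 : 0 < p by exact: lt_trans p1.
have [A [B [A0 B0 AB]]] := cpow_ineq p1 p2.
(* Integration of [cpow_ineq] gives avg |F|^p + B F(0)^p <= A avg (Re F)^p: the first bound needs
   only [A], the second [A / B]. *)
exists (A + A / B); first by rewrite addr_ge0 ?divr_ge0 ?(ltW B0).
move=> F rho rho1 Fpos F0.
have rho0 : 0 < rho by exact: lt_trans rho1.
(* The dilation by rho > 1 makes the unit circle the circle of radius 1/rho inside the disc, where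
   the coefficient formulas for [holo_disc] apply. *)
pose G (z : C) := cpow p F.[(rho%:C)%C * z].
have inD (z : C) : cabs z < 1 -> cabs ((rho%:C)%C * z) < rho.
  by move=> z1; rewrite cabsM cabs_real gtr0_norm// gtr_pMr.
have hG : holo_disc G.
  move=> z z1; have [d1 h1] := cdiff_horner F ((rho%:C)%C * z).
  have [d2 h2] := cdiff_cpow p (Fpos _ (inD z z1)).
  have h3 := cdiff_comp (cdiffZ (rho%:C)%C (cdiff_id z)) h1.
  exact: cdiff_cderivable (cdiff_comp h3 h2).
pose s := rho^-1.
have s01 : 0 < s < 1 by rewrite invr_gt0 rho0 invf_lt1.
have Gs t : circ G s t = cpow p F.[expi t].
  rewrite /circ /G mulrA -realcM /s divff ?gt_eqF//.
  by have -> : ((1 : R)%:C)%C = 1 :> C by []; rewrite mul1r.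
pose S := \sum_(i < size F) cabs F`_i * rho ^+ i.
have Fb z : cabs z < rho -> cabs F.[z] <= S.
  move=> z1; rewrite horner_coef (le_trans (cabs_sum _ _ _))//.
  apply: ler_sum => i _; rewrite cabsM cabsX ler_wpM2l ?cabs_ge0//.
  by rewrite lerXn2r ?nnegrE ?cabs_ge0// ltW.
have Gb z : cabs z < 1 -> cabs (G z) <= S `^ p.
  move=> z1; rewrite cabs_cpow ?Fpos ?inD//.
  apply: ge0_ler_powR; rewrite ?nnegrE ?cabs_ge0 ?(ltW p0)//.
    by rewrite (le_trans (cabs_ge0 _) (Fb _ (inD _ z1))).
  exact: Fb (inD _ z1).
have cG r : 0 < r < 1 -> CI (circ G r).
  move=> /andP[r0 r1]; apply: (@circ_CI _ _ _ (S `^ p)) => //; first by rewrite r1 ltW.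
  by move=> t; apply: Gb; rewrite cabs_circ// ltW.
have h01 : 0 < (2^-1 : R) < 1 by apply/andP; split; lra.
have := fcoef_circ 0 hG s01 (cG _ s01) (cG _ h01).
rewrite expr0 mulr1 tcoef0// => GE.
have G0E : Re (G 0) = Re F.[0] `^ p.
  have F00 : 0 < Re F.[0] by rewrite Fpos ?cabs0.
  rewrite /G mulr0 Re_cpow// /carg F0 mul0r atan0 mulr0 cos0 mulr1.
  by congr (_ `^ _); rewrite cabsE F0 expr0n addr0 sqrtr_sqr gtr0_norm.
have avgG : avg (fun t => Re (cpow p F.[expi t])) = Re (G 0).
  rewrite -GE fcoefE Re_cint; apply: avg_eq => t _.
  by rewrite Gs oppr0 mul0r expi0 mulr1.
have e1 t : cabs (expi t) < rho by rewrite cabs_expi.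
have mF : cmeas (fun t => F.[expi t]) by exact: cmeas_horner.
have iR : RI (fun t => Re F.[expi t] `^ p).
  apply: (@RI_bounded _ _ (S `^ p)); first by apply: measurable_powR_comp; case: mF.
  move=> t _; rewrite ger0_norm ?powR_ge0//; apply: ge0_ler_powR; rewrite ?nnegrE ?(ltW p0)//.
  - by rewrite ltW// Fpos.
  - by rewrite (le_trans (cabs_ge0 _) (Fb _ (e1 t))).
  - by rewrite (le_trans (Re_le_cabs' _))// Fb.
have iA : RI (fun t => cabs F.[expi t] `^ p).
  apply: (@RI_bounded _ _ (S `^ p)); first by apply: measurable_cabs_powR.
  move=> t _; rewrite ger0_norm ?powR_ge0//; apply: ge0_ler_powR; rewrite ?nnegrE ?(ltW p0) ?cabs_ge0//.
  - by rewrite (le_trans (cabs_ge0 _) (Fb _ (e1 t))).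
  - by rewrite Fb.
have iG : RI (fun t => Re (cpow p F.[expi t])).
  by have [h _] := cG s s01; under eq_fun do rewrite -Gs.
have Rp0 : 0 <= avg (fun t => Re F.[expi t] `^ p).
  by apply: avg_ge0 => t _; exact: powR_ge0.
have Ap0 : 0 <= avg (fun t => cabs F.[expi t] `^ p).
  by apply: avg_ge0 => t _; exact: powR_ge0.
have F0p : 0 <= Re F.[0] `^ p by exact: powR_ge0.
have key : avg (fun t => cabs F.[expi t] `^ p) <=
    A * avg (fun t => Re F.[expi t] `^ p) - B * Re F.[0] `^ p.
  rewrite -G0E -avgG -!avgZ// -avgB; [|exact: RIZ..].
  apply: avg_le => //; first by apply: RIB; exact: RIZ.
  by move=> t _; apply: AB; exact: Fpos.
set X := avg (fun t => Re F.[expi t] `^ p) in key Rp0 *.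
have AB0 : 0 <= A / B by rewrite divr_ge0// ltW.
have AX : 0 <= A * X by rewrite mulr_ge0.
have BF : 0 <= B * Re F.[0] `^ p by rewrite mulr_ge0// ltW.
rewrite mulrDl; split.
  apply: (le_trans key); apply: (@le_trans _ _ (A * X)); first by rewrite gerBl.
  by rewrite lerDl mulr_ge0.
have : 0 <= A * X - B * Re F.[0] `^ p by exact: le_trans Ap0 key.
rewrite subr_ge0 mulrC -ler_pdivlMr// mulrAC => /le_trans; apply.
by rewrite lerDr.
Qed.

End PositiveRealPart.

(** * Poisson integrals *)

Section PoissonKernel.
Context {R : realType}.
Local Notation C := R[i].
Local Notation T := (@Tdom R).
Local Notation Re := complex.Re.
Local Notation Im := complex.Im.
Implicit Types (r x t s e : R).

Definition poisson r x : R := (1 - r ^+ 2) / (1 - 2 * r * cos x + r ^+ 2).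

Lemma poisson_den r x : 1 - 2 * r * cos x + r ^+ 2 = (1 - r) ^+ 2 + 2 * r * (1 - cos x).
Proof. ring. Qed.
Lemma poisson_den_ge r x : 0 <= r -> (1 - r) ^+ 2 <= 1 - 2 * r * cos x + r ^+ 2.
Proof.
by move=> r0; rewrite poisson_den lerDl !mulr_ge0// subr_ge0 cos_le1.
Qed.
Lemma poisson_den_gt0 r x : 0 <= r < 1 -> 0 < 1 - 2 * r * cos x + r ^+ 2.
Proof.
move=> /andP[r0 r1]; apply: lt_le_trans (poisson_den_ge x r0).
by rewrite exprn_gt0// subr_gt0.
Qed.
Lemma poisson_gt0 r x : 0 <= r < 1 -> 0 < poisson r x.
Proof.
move=> r01; rewrite divr_gt0 ?poisson_den_gt0// subr_gt0 expr_lt1//; by case/andP: r01.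
Qed.
Lemma poisson_le r x : 0 <= r < 1 -> poisson r x <= 2 / (1 - r).
Proof.
move=> /[dup] r01 /andP[r0 r1]; have r10 : 0 < 1 - r by rewrite subr_gt0.
rewrite /poisson ler_pdivrMr ?poisson_den_gt0//.
apply: (@le_trans _ _ (2 / (1 - r) * (1 - r) ^+ 2)).
  have -> : 2 / (1 - r) * (1 - r) ^+ 2 = 2 * (1 - r) by field; rewrite gt_eqF.
  nra.
by rewrite ler_wpM2l ?poisson_den_ge// divr_ge0// ltW.
Qed.

(** From 1 - cos x = 2 sin(x/2)^2 and sin y >= y / 2 on [0, 1/2]; the latter is the mean value
    theorem with cos >= 1/2 there. *)
Lemma one_minus_cos x : `|x| <= 1 -> x ^+ 2 / 8 <= 1 - cos x.
Proof.
move=> x1; have -> : cos x = cos `|x| by rewrite cos_norm.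
rewrite -(real_normK (num_real x)); move: x1; have := normr_ge0 x.
move: `|x| => {}x x0 x1.
have pi2 := pi_ge2 R.
have sin_ge (y : R) : 0 <= y -> y <= 1/2 -> y / 2 <= sin y.
  rewrite le_eqVlt => /predU1P[<- _|y0 y1]; first by rewrite mul0r sin0.
  have [|c] := @MVT R sin cos 0 y y0.
    by apply: continuous_subspaceT => z; exact: continuous_sin.
  rewrite in_itv/= sin0 !subr0 => /andP[c0 cy] ->.
  have : 1 / 2 <= cos c.
    have cc : cos c >= 0 by rewrite ltW// cos_gt0_pihalf//; lra.
    have := cos2Dsin2 c.
    have sc : sin c <= c.
      have [|d] := @MVT R sin cos 0 c c0.
        by apply: continuous_subspaceT => z; exact: continuous_sin.
      rewrite sin0 !subr0 => _ ->; rewrite ler_piMl ?cos_le1// ltW//.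
    have s0 : 0 <= sin c by rewrite sin_ge0_pi//; lra.
    nra.
  nra.
have -> : cos x = 1 - 2 * sin (x / 2) ^+ 2.
  have {1}-> : x = (x / 2) *+ 2 by rewrite -mulr_natr divfK.
  by rewrite cos_mulr2n; have := cos2Dsin2 (x / 2); rewrite mulr2n; lra.
have := sin_ge (x / 2); nra.
Qed.

(** The numerator is at most 2 (1 - r), and since 2 r >= 1 the denominator is at least 1 - cos x >=
    x^2 / 8. *)
Lemma poisson_near r x : 1 / 2 <= r < 1 -> `|x| <= 1 -> x != 0 ->
  poisson r x <= 16 * (1 - r) / x ^+ 2.
Proof.
move=> /andP[r2 r1] x1 x0; have r01 : 0 <= r < 1 by lra.
have x20 : 0 < x ^+ 2 by rewrite exprn_even_gt0.
rewrite /poisson ler_pdivrMr ?poisson_den_gt0// mulrAC ler_pdivlMr//.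
rewrite poisson_den.
have := one_minus_cos x1; set c := cos x => h.
have k1 : 1 - r ^+ 2 <= 2 * (1 - r) by nra.
have k2 : 1 / 8 * x ^+ 2 <= (1 - r) ^+ 2 + 2 * r * (1 - c).
  have : 0 <= (1 - r) ^+ 2 by exact: sqr_ge0.
  nra.
have : (1 - r ^+ 2) * x ^+ 2 <= 2 * (1 - r) * x ^+ 2 by rewrite ler_pM2r.
have : 16 * (1 - r) * (1 / 8 * x ^+ 2) <= 16 * (1 - r) * ((1 - r) ^+ 2 + 2 * r * (1 - c)).
  by rewrite ler_wpM2l// mulr_ge0// subr_ge0 ltW.
lra.
Qed.

(** The point [x] stays at distance [d] from 0 modulo 2 pi; values beyond pi occur since [x] will be
    a difference of two angles in [0, 2 pi]. *)
Lemma poisson_far r x d : 1 / 2 <= r < 1 -> 0 < d <= pi -> d <= `|x| <= pi *+ 2 - d ->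
  poisson r x <= 2 * (1 - r) / (1 - cos d).
Proof.
move=> /andP[r2 r1] /andP[d0 dpi] /andP[dx xd]; have r01 : 0 <= r < 1 by lra.
have cd : cos d < 1.
  by rewrite -cos0 ltr_cos// in_itv/= ?lexx ?pi_ge0 ?(ltW d0).
have cx : cos x <= cos d.
  have -> : cos x = cos `|x| by rewrite cos_norm.
  have [xpi|xpi] := leP `|x| pi.
    rewrite leNgt ltr_cos ?in_itv/= ?normr_ge0 ?xpi ?(ltW d0) ?dpi//.
    by rewrite -leNgt.
  have -> : cos `|x| = cos (pi *+ 2 - `|x|).
    by rewrite addrC cosD2pi cosN.
  rewrite leNgt ltr_cos ?in_itv/= ?(ltW d0) ?dpi//; last by rewrite mulr2n in xd *; lra.
  by rewrite -leNgt; lra.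
rewrite /poisson ler_pdivrMr ?poisson_den_gt0// mulrAC ler_pdivlMr ?subr_gt0//.
rewrite poisson_den.
have k1 : 1 - r ^+ 2 <= 2 * (1 - r) by nra.
have k2 : 1 - cos d <= (1 - r) ^+ 2 + 2 * r * (1 - cos x).
  have : 0 <= (1 - r) ^+ 2 by exact: sqr_ge0.
  nra.
have : (1 - r ^+ 2) * (1 - cos d) <= 2 * (1 - r) * (1 - cos d).
  by rewrite ler_pM2r// subr_gt0.
have : 2 * (1 - r) * (1 - cos d) <= 2 * (1 - r) * ((1 - r) ^+ 2 + 2 * r * (1 - cos x)).
  by rewrite ler_wpM2l// mulr_ge0// subr_ge0 ltW.
lra.
Qed.

Lemma poisson_continuous r t : 0 <= r < 1 -> continuous (fun s => poisson r (t - s)).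
Proof.
move=> r01 s; rewrite /poisson; apply: cvgM; first exact: cvg_cst.
apply: cvgV; first by rewrite gt_eqF// poisson_den_gt0.
apply: cvgD; last exact: cvg_cst.
apply: cvgB; first exact: cvg_cst.
apply: cvgM; first exact: cvg_cst.
apply: (@continuous_comp _ _ _ (fun s => t - s) cos); last exact: continuous_cos.
by apply: cvgB; [exact: cvg_cst|exact: cvg_id].
Qed.

(** The truncation at |k| <= M of the Fourier series of the Poisson kernel. *)
Definition pkernel M r x : C :=
  \sum_(k < M.+1) (r%:C ^+ k * expi (k%:R * x))%C +
  \sum_(k < M) (r%:C ^+ k.+1 * expi (- (k.+1%:R * x)))%C.

Lemma sub_geo (q : C) n : q != 1 -> \sum_(k < n) q ^+ k = (1 - q ^+ n) / (1 - q).
Proof.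
move=> q1; have q10 : 1 - q != 0 by rewrite subr_eq0 eq_sym.
apply: (mulIf q10); rewrite divfK// mulrC.
by rewrite -opprB mulNr -subrX1 opprB.
Qed.

(** Both halves are geometric, with ratios r e^(ix) and r e^(-ix); the error consists of two tails,
    each at most r^(M+1) / (1 - r). *)
Lemma poisson_pkernel M r x : 0 <= r < 1 ->
  cabs ((poisson r x)%:C%C - pkernel M r x) <= 2 * r ^+ M.+1 / (1 - r).
Proof.
move=> /[dup] r01 /andP[r0 r1].
pose q : C := (r%:C)%C * expi x; pose q' : C := (r%:C)%C * expi (- x).
have aq : cabs q = r by rewrite cabsM cabs_expi cabs_real ger0_norm ?mulr1.
have aq' : cabs q' = r by rewrite cabsM cabs_expi cabs_real ger0_norm ?mulr1.
have ge1 (z : C) : cabs z = r -> 1 - r <= cabs (1 - z).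
  by move=> zr; have := cabsD (1 - z) z; rewrite subrK cabs1 zr; lra.
have ne1 (z : C) : cabs z = r -> 1 - z != 0.
  move=> zr; rewrite -cabs_gt0 (lt_le_trans _ (ge1 _ zr))// subr_gt0//.
have qn1 (z : C) : cabs z = r -> z != 1.
  by move=> /ne1; rewrite subr_eq0 eq_sym.
have -> : pkernel M r x = (1 - q ^+ M.+1) / (1 - q) + q' * ((1 - q' ^+ M) / (1 - q')).
  rewrite -!sub_geo ?qn1// mulr_sumr; congr (_ + _); apply: eq_bigr => k _.
    by rewrite exprMn expi_nat.
  by rewrite -exprS exprMn -expi_nat mulrN.
have -> : (poisson r x)%:C%C = 1 / (1 - q) + q' / (1 - q').
  have qq' : q * q' = (r ^+ 2)%:C%C.
    by rewrite /q /q' mulrACA -expiD subrr expi0 mulr1 -realcM expr2.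
  have qDq' : q + q' = (2 * r * cos x)%:C%C.
    apply: complex_ext; rewrite !(ReD, ImD, Re_realcM, Im_realcM) /= ?cosN ?sinN; ring.
  have den : (1 - q) * (1 - q') = (1 - 2 * r * cos x + r ^+ 2)%:C%C.
    transitivity (1 - (q + q') + q * q'); first by ring.
    by rewrite qDq' qq' !realcD realcN.
  have den0 : (1 - 2 * r * cos x + r ^+ 2)%:C%C != 0 :> C.
    by rewrite -cabs_eq0 cabs_real normr_eq0 gt_eqF// poisson_den_gt0.
  apply: (mulIf den0); rewrite -realcM divfK ?gt_eqF ?poisson_den_gt0//.
  rewrite -den mulrDl.
  transitivity (1 - q * q'); first by rewrite qq' realcD realcN.
  by field; rewrite !ne1.
have -> : 1 / (1 - q) + q' / (1 - q') -
   ((1 - q ^+ M.+1) / (1 - q) + q' * ((1 - q' ^+ M) / (1 - q'))) =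
   q ^+ M.+1 / (1 - q) + q' ^+ M.+1 / (1 - q').
  by rewrite [q' ^+ M.+1]exprS; field; rewrite !ne1.
rewrite (le_trans (cabsD _ _))// !cabsM !cabsX !cabsV aq aq'.
have b (z : C) : cabs z = r -> r ^+ M.+1 / cabs (1 - z) <= r ^+ M.+1 / (1 - r).
  move=> zr; rewrite ler_wpM2l ?exprn_ge0// lef_pV2 ?posrE ?ge1 ?subr_gt0//.
  by rewrite cabs_gt0 ne1.
by rewrite -mulrA mulr_natl mulr2n lerD// b.
Qed.

Definition pint r (g : R -> C) t : C := cint (fun s => (poisson r (t - s))%:C%C * g s).

(** Truncated Abel mean of the Fourier series, that is the convolution of [g] with [pkernel M r]. It
    is a trigonometric polynomial uniformly close to the Poisson integral. *)
Definition abel_sum M r (g : R -> C) t : C :=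
  \sum_(k < M.+1) (r%:C ^+ k * expi (k%:R * t))%C * fcoef g k +
  \sum_(k < M) (r%:C ^+ k.+1 * expi (- (k.+1%:R * t)))%C * fcoef g (- k.+1%:Z).

Lemma CI_poisson r g t : 0 <= r < 1 -> CI g ->
  CI (fun s => (poisson r (t - s))%:C%C * g s).
Proof.
move=> r01 gi; apply: (@CI_mul _ _ _ (2 / (1 - r))) => //.
  by apply: cmeas_real; apply: cmeas_continuous; exact: poisson_continuous.
by move=> s _; rewrite cabs_real gtr0_norm ?poisson_gt0// poisson_le.
Qed.

Lemma abel_sumE M r g t : CI g ->
  abel_sum M r g t = cint (fun s => pkernel M r (t - s) * g s).
Proof.
move=> gi; rewrite /abel_sum.
have e1 (k : nat) : CI (fun s => (r%:C ^+ k * expi (k%:R * (t - s)))%C * g s).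
  apply: (CI_mul (M := `|r| ^+ k)) => //.
    apply: cmeasZ; have -> : (fun s => expi (k%:R * (t - s))) = (fun s => expi (k%:R * t) * expi ((- k%:R) * s)).
      by apply/funext => s; rewrite -expiD mulrBr mulNr.
    by apply: cmeasZ; exact: cmeas_expi.
  by move=> s _; rewrite cabsM cabs_expi mulr1 cabsX cabs_real.
have e2 (k : nat) : CI (fun s => (r%:C ^+ k * expi (- (k%:R * (t - s))))%C * g s).
  apply: (CI_mul (M := `|r| ^+ k)) => //.
    apply: cmeasZ; have -> : (fun s => expi (- (k%:R * (t - s)))) = (fun s => expi (- (k%:R * t)) * expi (k%:R * s)).
      by apply/funext => s; rewrite -expiD mulrBr opprB addrC.
    by apply: cmeasZ; exact: cmeas_expi.
  by move=> s _; rewrite cabsM cabs_expi mulr1 cabsX cabs_real.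
transitivity (cint (fun s => \sum_(k < M.+1) (r%:C ^+ k * expi (k%:R * (t - s)))%C * g s) +
  cint (fun s => \sum_(k < M) (r%:C ^+ k.+1 * expi (- (k.+1%:R * (t - s))))%C * g s)).
  rewrite !cint_sum//; congr (_ + _); apply: eq_bigr => k _.
    rewrite fcoefE -cintZ; last exact: CI_mul_expi.
    apply: cint_eq => s _; rewrite mulrBr expiD mulrNz mulNr -pmulrn; ring.
  rewrite fcoefE -cintZ; last exact: CI_mul_expi.
  apply: cint_eq => s _; rewrite opprK mulrBr opprB expiD -pmulrn.
  ring.
rewrite -cintD; [|exact: CI_sum..].
by apply: cint_eq => s _; rewrite /pkernel mulrDl !mulr_suml.
Qed.

Lemma pint_abel M r g t : 0 <= r < 1 -> CI g ->
  cabs (pint r g t - abel_sum M r g t) <=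
  2 * r ^+ M.+1 / (1 - r) * avg (fun s => cabs (g s)).
Proof.
move=> r01 gi; rewrite abel_sumE// /pint.
have kb s : cabs (pkernel M r (t - s)) <= 2 / (1 - r) + 2 * r ^+ M.+1 / (1 - r).
  have -> : pkernel M r (t - s) = (poisson r (t - s))%:C%C -
    ((poisson r (t - s))%:C%C - pkernel M r (t - s)) by ring.
  rewrite (le_trans (cabsB _ _))// lerD ?poisson_pkernel//.
  by rewrite cabs_real gtr0_norm ?poisson_gt0// poisson_le.
have mk : cmeas (fun s => pkernel M r (t - s)).
  apply: cmeasD; apply: cmeas_sum => k; apply: cmeasZ.
    have -> : (fun s => expi (k%:R * (t - s))) = (fun s => expi (k%:R * t) * expi ((- k%:R) * s)).
      by apply/funext => s; rewrite -expiD mulrBr mulNr.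
    by apply: cmeasZ; exact: cmeas_expi.
  have -> : (fun s => expi (- (k.+1%:R * (t - s)))) = (fun s => expi (- (k.+1%:R * t)) * expi (k.+1%:R * s)).
    by apply/funext => s; rewrite -expiD mulrBr opprB addrC.
  by apply: cmeasZ; exact: cmeas_expi.
have ki : CI (fun s => pkernel M r (t - s) * g s).
  by apply: (CI_mul mk) gi => s _; exact: kb.
rewrite -cintB//; last exact: CI_poisson.
rewrite (le_trans (cabs_cint _))//; first by apply: CIB => //; exact: CI_poisson.
rewrite -avgZ; last exact: CI_abs.
apply: avg_le.
- by apply: CI_abs; apply: CIB => //; exact: CI_poisson.
- by apply: RIZ; exact: CI_abs.
- by move=> s _; rewrite -mulrBl cabsM ler_wpM2r ?cabs_ge0// poisson_pkernel.
Qed.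

Lemma geometric_small r (A e : R) : 0 <= r < 1 -> 0 < e ->
  exists N : nat, forall n, (N <= n)%N -> r ^+ n * A <= e.
Proof.
move=> /andP[r0 r1] e0.
have : (fun n => r ^+ n * A) @ \oo --> (0 * A : R).
  by apply: cvgMr_tmp; apply: cvg_expr; rewrite ger0_norm.
rewrite mul0r => /cvgrPdist_lt/(_ e e0)[N _ H]; exists N => n Nn.
by have := H n Nn; rewrite /= sub0r normrN => /ltW; apply: le_trans; exact: ler_norm.
Qed.

(** All Abel sums of the constant 1 equal 1, and they approximate its Poisson integral. *)
Lemma avg_poisson r t : 0 <= r < 1 -> avg (fun s => poisson r (t - s)) = 1.
Proof.
move=> /[dup] r01 /andP[r0 r1].
have -> : avg (fun s => poisson r (t - s)) = Re (pint r (fun=> 1) t).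
  by rewrite Re_cint; apply: avg_eq => s _; rewrite mulr1.
apply/eqP; rewrite -subr_eq0 -normr_eq0 eq_le normr_ge0 andbT.
apply/ler_addgt0Pl => e e0; rewrite addr0.
have [N /(_ N.+1 (leqnSn N)) HN] := geometric_small (2 / (1 - r)) r01 e0.
have := pint_abel N t r01 (@CI_cst R 1).
have -> : abel_sum N r (fun=> 1) t = 1.
  rewrite /abel_sum big_ord_recl !big1 ?addr0.
  - by rewrite expr0 mul1r mul0r expi0 mul1r fcoef_cst.
  - by move=> k _; rewrite fcoef_cst mulr0.
  - by move=> k _; rewrite fcoef_cst mulr0.
have -> : avg (fun=> cabs (1 : C)) = 1 by rewrite avg_cst cabs1.
rewrite mulr1 => h; apply: le_trans (_ : _ <= cabs (pint r (fun=> 1) t - 1)) _.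
  by have := Re_le_cabs (pint r (fun=> 1) t - 1); rewrite ReB.
by rewrite (le_trans h)// (le_trans _ HN)// mulrAC mulrC.
Qed.

End PoissonKernel.

(** * Boundary limits of Poisson integrals and uniqueness of Fourier coefficients *)

Section PoissonLimit.
Context {R : realType}.
Local Notation C := R[i].
Local Notation T := (@Tdom R).
Local Notation mu := (@leb R).
Local Notation Re := complex.Re.
Local Notation Im := complex.Im.
Implicit Types (r x t s e : R) (f : R -> R).

(** The Lebesgue point condition multiplied by the length of the ball: the integral of |f - f t|
    over radius [d] is o(d). Small balls stay inside [T] because [t] is interior. *)
Lemma lebesgue_pt_avg f t e : RI f -> 0 < t < pi *+ 2 ->
  lebesgue_pt (f \_ T) t -> 0 < e ->
  exists2 d0, 0 < d0 & forall d, 0 < d < d0 ->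
    [/\ d <= t, d <= pi *+ 2 - t &
     avg (fun s => \1_(ball t d) s * `|f s - f t|) <= e * d].
Proof.
move=> fi /andP[t0 tpi] /fine_cvgP[fin cv] e0.
have e20 : 0 < e / 2 by rewrite divr_gt0.
move/cvgrPdist_lt/(_ _ e20) : cv => cv.
have [d1 /= d10 H] := filterI fin cv.
exists (Num.min d1 (Num.min t (pi *+ 2 - t))).
  by rewrite !lt_min d10 t0 subr_gt0.
move=> d /andP[d0]; rewrite !lt_min => /andP[dd1 /andP[dt dt2]].
split; [exact: ltW|exact: ltW|].
have bd : ball (0:R) d1 d by rewrite /ball /= sub0r normrN gtr0_norm.
have [fin' lt'] := H d bd d0.
have tT : t \in T by apply/mem_set; rewrite /Tdom /= in_itv/= (ltW t0) (ltW tpi).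
have BT s : ball t d s -> T s.
  by rewrite /ball /= ltr_norml => /andP[? ?]; rewrite /Tdom /= in_itv/=; lra.
have mB : measurable (ball t d : set (measurableTypeR R)) by exact: measurable_ball.
have mf := RI_meas fi.
have fT s : T s -> (f \_ T) s = f s by move=> Ts; rewrite /patch mem_set.
have E : (\int[mu]_(s in T) (\1_(ball t d) s * `|f s - f t|)%:E =
   \int[mu]_(s in ball t d) `|((center ((f \_ T) t) \o (f \_ T)) s)%:E|)%E.
  rewrite integral_mkcond [RHS]integral_mkcond; apply: eq_integral => s _.
  rewrite /patch; case: ifPn => [|sT].
    rewrite inE => Ts; rewrite indicE; have [sB|sB] := pselect (ball t d s).
      by rewrite (mem_set sB) mul1r /= tT (mem_set Ts).
    by rewrite (memNset sB) mul0r.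
  case: ifPn => // sB; exfalso; move/negP : sT; apply.
  by apply/mem_set/BT; exact: set_mem.
have h1 : davg (f \_ T) t d = ((2 * d)^-1%:E * \int[mu]_(s in T) (\1_(ball t d) s * `|f s - f t|)%:E)%E.
  rewrite E /davg /iavg /leb /= lebesgue_measure_ball ?ltW//.
  congr (_ * _)%E; rewrite -[d *+ 2]mulr_natl inver gt_eqF// mulr_gt0//.
have gi : RI (fun s => \1_(ball t d) s * `|f s - f t|).
  have hi : RI (fun s => `|f s - f t|) by apply: RI_abs; apply: RIB => //; exact: RI_cst.
  apply: (RI_le _ hi).
    by apply: measurable_funM; [exact: measurable_indic|exact: RI_meas].
  move=> s _; rewrite normrM normr_id ler_piMl//.
  by rewrite indicE; case: (_ \in _); rewrite ?normr1 ?normr0.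
move: lt'; rewrite /= sub0r normrN h1 -avgE// -EFinM /=.
set a := avg _; have a0 : 0 <= a.
  by apply: avg_ge0 => s _; rewrite mulr_ge0// indicE; case: (_ \in _).
rewrite ger0_norm; last first.
  apply: mulr_ge0; first by rewrite invr_ge0 mulr_ge0// ltW.
  by apply: mulr_ge0 => //; exact: ltW (@twopi_gt0 R).
rewrite mulrC ltr_pdivrMr ?mulr_gt0// => h.
(* The average carries the divisor 2 pi >= 1, so omitting it only weakens the estimate. *)
have p1 : 1 <= pi *+ 2 :> R by have := pi_ge2 R; rewrite mulr2n; lra.
have : a <= a * (pi *+ 2) by rewrite ler_peMr.
lra.
Qed.

(* Dyadic majorization of the Poisson kernel at scale [1 - r]. *)
Lemma poisson_dyadic (r : R) (K : nat) x : 1 / 2 <= r < 1 ->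
  2 ^+ K * (1 - r) <= 1 -> `|x| < 2 ^+ K * (1 - r) ->
  poisson r x <= \sum_(k < K.+1) (64 / (1 - r) * 4^-1 ^+ k) *
     (`|x| < 2 ^+ k * (1 - r))%R%:R.
Proof.
move=> /[dup] r12 /andP[r2 r1] K1 xK; set h := 1 - r in K1 xK *.
have h0 : 0 < h by rewrite /h; lra.
(* A single summand suffices, that of the smallest dyadic ball containing [x]. For k >= 1, |x| >=
   2^(k-1) h there, and [poisson_near] gives 16 h / (4^(k-1) h^2) = 64 / (h 4^k). *)
have [|k kP kmin] := @ex_minnP (fun k => `|x| < 2 ^+ k * h); first by exists K.
have kK : (k < K.+1)%N by rewrite ltnS; exact: kmin.
rewrite (bigD1 (Ordinal kK))//= kP mulr1.
rewrite (@le_trans _ _ (64 / h * 4^-1 ^+ k))//; last first.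
  rewrite lerDl; apply: sumr_ge0 => i _.
  by rewrite !mulr_ge0 ?exprn_ge0 ?invr_ge0 ?(ltW h0).
case: k kP kmin kK => [|k] kP kmin kK.
  rewrite expr0 mulr1; apply: (le_trans (@poisson_le _ r x _)); first by lra.
  by rewrite -/h ler_pM2r ?invr_gt0//; lra.
have xk : 2 ^+ k * h <= `|x|.
  by rewrite leNgt; apply/negP => /kmin; rewrite ltnn.
have xk0 : 0 < 2 ^+ k * h by rewrite mulr_gt0 ?exprn_gt0.
have x0 : x != 0 by rewrite -normr_gt0 (lt_le_trans xk0).
have x1 : `|x| <= 1 by rewrite ltW// (lt_le_trans xK).
apply: (le_trans (poisson_near r12 x1 x0)); rewrite -/h.
have x2 : 4 ^+ k * h ^+ 2 <= x ^+ 2.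
  rewrite -(real_normK (num_real x)).
  have -> : (4 : R) ^+ k = (2 ^+ k) ^+ 2 by rewrite -exprM mulnC exprM; congr (_ ^+ _); ring.
  by rewrite -exprMn lerXn2r// nnegrE ltW.
have x20 : 0 < x ^+ 2 by rewrite exprn_even_gt0.
rewrite ler_pdivrMr// exprS exprVn.
have k40 : 0 < (4 : R) ^+ k by rewrite exprn_gt0.
apply: (@le_trans _ _ (64 / h * (4^-1 / 4 ^+ k) * (4 ^+ k * h ^+ 2))).
  by rewrite le_eqVlt; apply/orP; left; apply/eqP; field; rewrite !gt_eqF.
by rewrite ler_wpM2l// mulr_ge0 ?divr_ge0 ?(ltW h0) ?invr_ge0 ?(ltW k40).
Qed.

Lemma dyadic_scale (h d : R) : 0 < h <= d -> exists K : nat,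
  2 ^+ K * h <= d /\ d < 2 ^+ K.+1 * h.
Proof.
move=> /andP[h0 hd].
have [|K KP Kmin] := @ex_minnP (fun k => d < 2 ^+ k * h).
  exists (Num.truncn (d / h)).+1; rewrite -ltr_pdivrMr//.
  rewrite (lt_le_trans (truncnS_gt _))// -natrX ler_nat ltnW//.
  exact: ltn_expl.
case: K KP Kmin => [|K] KP Kmin.
  by move: KP; rewrite expr0 mul1r ltNge hd.
exists K; split => //.
by rewrite leNgt; apply/negP => /Kmin; rewrite ltnn.
Qed.

(** The kernel is dominated by a sum over dyadic balls plus a term O(1 - r). Balls of radius 2^k (1
    - r) carry weight 4^(-k) / (1 - r) and mass o(2^k (1 - r)), so their contributions form a small
    geometric series. *)
Lemma poisson_lebesgue_pt f t : RI f -> 0 < t < pi *+ 2 ->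
  lebesgue_pt (f \_ T) t -> forall e, 0 < e ->
  exists2 r0, 0 <= r0 < 1 & forall r, r0 < r < 1 ->
    `|avg (fun s => poisson r (t - s) * f s) - f t| < e.
Proof.
move=> fi t2 tL e e0; have /andP[t0 tpi] := t2.
(* The deviation from the value at [t]; since the kernel has mean 1, it suffices to make the Poisson
   average of [h] small. The constant 512 below makes the dyadic part at most 64 * 2 * e / 512 = e /
   4. *)
pose h s := `|f s - f t|.
have hi : RI h by apply: RI_abs; apply: RIB => //; exact: RI_cst.
have h0 : 0 <= avg h by apply: avg_ge0 => s _; exact: normr_ge0.
pose e1 := e / 512; have e10 : 0 < e1 by apply: divr_gt0; [exact: e0|rewrite ltr0n].
have [d0 d00 Hd] := lebesgue_pt_avg fi t2 tL e10.
pose d := Num.min (d0 / 2) (1 / 2).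
have d_gt0 : 0 < d by rewrite lt_min !divr_gt0.
have dd0 : d < d0.
  by rewrite (@le_lt_trans _ _ (d0 / 2)) ?ge_min ?lexx// ltr_pdivrMr// ltr_pMr// ltr1n.
have d12 : d <= 1 / 2 by rewrite /d ge_min lexx orbT.
have [dt dt2 _] := Hd d ltac:(by rewrite d_gt0 dd0).
have pi2 := pi_ge2 R.
pose c := 1 - cos (d / 2).
have c0 : 0 < c.
  have d1 : 0 < d / 2 by rewrite divr_gt0.
  have d2 : d / 2 <= pi by lra.
  by rewrite /c subr_gt0 -[X in _ < X](@cos0 R) ltr_cos ?in_itv/= ?lexx ?pi_ge0 ?(ltW d1) ?d2.
(* The three bounds ensure that the dyadic radii start below [d], that r >= 1/2, and that the far
   part (2 rho / c) avg h is below e / 4. *)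
pose eta := Num.min (d / 1) (Num.min (1 / 2) (e * c / (8 * (avg h + 1)))).
have eta0 : 0 < eta.
  by rewrite !lt_min !divr_gt0 ?mulr_gt0//=; lra.
exists (1 - eta).
  have : eta <= 1 / 2 by rewrite !ge_min lexx !orbT.
  lra.
move=> r /andP[r0 r1]; pose rho := 1 - r.
have rho0 : 0 < rho by rewrite subr_gt0.
have rhoeta : rho < eta by rewrite /rho; lra.
have rhod : rho <= d.
  by rewrite ltW// (lt_le_trans rhoeta)// /eta divr1 ge_min lexx.
have rho12 : rho < 1 / 2 by rewrite (lt_le_trans rhoeta)// !ge_min lexx !orbT.
have rhoc : rho * (8 * (avg h + 1)) < e * c.
  have : rho < e * c / (8 * (avg h + 1)) by rewrite (lt_le_trans rhoeta)// !ge_min lexx !orbT.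
  by rewrite ltr_pdivlMr// mulr_gt0// ltr_wpDl.
have r12 : 1 / 2 <= r < 1 by rewrite r1 andbT; rewrite /rho in rho12; lra.
have r01 : 0 <= r < 1 by lra.
have [K [K1 K2]] := @dyadic_scale rho d ltac:(by rewrite rho0 rhod).
pose B k : set R := ball t (2 ^+ k * rho).
pose W s := \sum_(k < K.+1) (64 / rho * 4^-1 ^+ k) * (\1_(B k) s * h s) +
   (2 * rho / c) * h s.
have Bi k : RI (fun s => \1_(B k) s * h s).
  apply: (RI_le _ hi).
    apply: measurable_funM; [|exact: RI_meas].
    by apply: measurable_indic; exact: measurable_ball.
  move=> s _; rewrite normrM [ `|h s| ]ger0_norm ?normr_ge0// ler_piMl ?normr_ge0//.
  by rewrite indicE; case: (_ \in _); rewrite ?normr1 ?normr0.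
have Wi : RI W.
  apply: RID; last exact: RIZ.
  by apply: RI_sum => k; apply: RIZ; exact: Bi.
have mP : measurable_fun T (fun s => poisson r (t - s)).
  by apply: cmeas_continuous; exact: poisson_continuous.
have Pf (g : R -> R) : RI g -> RI (fun s => poisson r (t - s) * g s).
  move=> gi; apply: (RI_le _ (RIZ (2 / rho) (RI_abs gi))).
    by apply: measurable_funM => //; exact: RI_meas.
  move=> s _; rewrite normrM ler_wpM2r//.
  by rewrite gtr0_norm ?poisson_gt0// poisson_le.
have avgW : avg W < e.
  rewrite avgD; [|by apply: RI_sum => k; apply: RIZ; exact: Bi|exact: RIZ].
  rewrite avg_sum; last by move=> k; apply: RIZ; exact: Bi.
  rewrite avgZ// [e in _ < e]splitr; apply: ltrD; last first.
    rewrite mulrAC ltr_pdivrMr//; nra.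
  apply: (@le_lt_trans _ _ (\sum_(k < K.+1) (64 * e1) * 2^-1 ^+ k)).
    apply: ler_sum => k _; rewrite avgZ//.
    have kK : 2 ^+ k * rho <= d.
      rewrite (le_trans _ K1)// ler_pM2r// ler_weXn2l ?ler1n//.
      by rewrite -ltnS.
    have k2 : 0 < 2 ^+ k * rho by rewrite mulr_gt0// exprn_gt0.
    have [_ _ hk] := Hd (2 ^+ k * rho) ltac:(by rewrite k2 (le_lt_trans kK)).
    apply: (@le_trans _ _ (64 / rho * 4^-1 ^+ k * (e1 * (2 ^+ k * rho)))).
      by rewrite ler_wpM2l// mulr_ge0 ?divr_ge0 ?exprn_ge0 ?invr_ge0 ?(ltW rho0).
    have -> : (4^-1 : R) ^+ k = 2^-1 ^+ k * 2^-1 ^+ k.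
      by rewrite -exprMn; congr (_ ^+ _); field.
    have hh : 2^-1 ^+ k * 2 ^+ k = 1 :> R by rewrite -exprMn mulVf// expr1n.
    rewrite le_eqVlt; apply/orP; left; apply/eqP.
    transitivity (64 * e1 * 2^-1 ^+ k * (2^-1 ^+ k * 2 ^+ k)); last by rewrite hh mulr1.
    by field; rewrite gt_eqF.
  rewrite -mulr_sumr.
  have S2 : \sum_(k < K.+1) (2^-1 : R) ^+ k <= 2.
    have H : (2^-1 : R) != 1 by rewrite lt_eqF// invf_lt1// ltr1n.
    have := subrX1 (2^-1 : R) K.+1; set S := \sum_(_ < _) _ => hS.
    have : 0 <= (2^-1 : R) ^+ K.+1 by rewrite exprn_ge0// invr_ge0.
    lra.
  have : 64 * e1 * (\sum_(k < K.+1) (2^-1 : R) ^+ k) <= 64 * e1 * 2.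
    by rewrite ler_wpM2l// mulr_ge0// ltW.
  move=> /le_lt_trans; apply; rewrite /e1; lra.
have PW s : T s -> poisson r (t - s) * h s <= W s.
  rewrite /Tdom /= in_itv/= => /andP[s0 s2].
  have hs0 : 0 <= h s by exact: normr_ge0.
  have [near|far] := ltP `|t - s| (2 ^+ K * rho).
    have K11 : 2 ^+ K * (1 - r) <= 1 by rewrite (le_trans K1)//; lra.
    have := poisson_dyadic r12 K11 near.
    move/(ler_wpM2r hs0)/le_trans; apply.
    rewrite /W mulr_suml; apply: ler_wpDr.
      by rewrite !mulr_ge0 ?invr_ge0 ?(ltW c0) ?(ltW rho0).
    have BE k : (s \in B k) = (`|t - s| < 2 ^+ k * (1 - r)).
      by apply/idP/idP => [/set_mem//|sB]; exact/mem_set.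
    rewrite le_eqVlt; apply/orP; left; apply/eqP; apply: eq_bigr => k _.
    by rewrite indicE BE mulrA.
  (* The next dyadic radius 2^(K+1) rho exceeds [d], so outside the largest ball the distance is at
     least d / 2. The upper bound 2 pi - d / 2 follows from d <= t and d <= 2 pi - t. *)
  have d2 : d / 2 <= `|t - s|.
    by rewrite (le_trans _ far)//; rewrite exprS in K2; lra.
  have := @poisson_far _ r (t - s) (d / 2) r12.
  have -> : 0 < d / 2 <= pi by lra.
  have -> : d / 2 <= `|t - s| <= pi *+ 2 - d / 2.
    by rewrite d2 ler_norml /=; lra.
  move=> /(_ isT isT) /(ler_wpM2r hs0)/le_trans; apply.
  rewrite /W lerDr; apply: sumr_ge0 => k _.
  rewrite !mulr_ge0 ?exprn_ge0 ?invr_ge0 ?(ltW rho0)//.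
apply: le_lt_trans avgW.
have -> : avg (fun s => poisson r (t - s) * f s) - f t =
   avg (fun s => poisson r (t - s) * (f s - f t)).
  transitivity (avg (fun s => poisson r (t - s) * f s - f t * poisson r (t - s))).
    rewrite avgB; [|exact: Pf|apply: RIZ; under eq_fun do rewrite -[poisson _ _]mulr1; exact: Pf (RI_cst 1)].
    rewrite avgZ ?avg_poisson ?mulr1//.
    by under eq_fun do rewrite -[poisson _ _]mulr1; exact: Pf (RI_cst 1).
  by apply: avg_eq => s _; ring.
have fti : RI (fun s => poisson r (t - s) * (f s - f t)).
  by apply: Pf; apply: RIB => //; exact: RI_cst.
apply: (le_trans (avg_abs fti)); apply: avg_le; [exact: RI_abs|exact: Wi|].
by move=> s Ts; rewrite normrM gtr0_norm ?poisson_gt0// PW.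
Qed.

Lemma aeT_neq (a : R) : aeT (fun t => t != a).
Proof.
exists [set a]; split; [exact: measurable_set1|exact: lebesgue_measure_set1|].
by move=> t /= h; apply: contrapT => ta; apply: h => _; apply/eqP.
Qed.

Lemma aeT_lebesgue_pt f : RI f ->
  aeT (fun t => 0 < t < pi *+ 2 /\ lebesgue_pt (f \_ T) t).
Proof.
move=> fi; have li : locally_integrable setT (f \_ T).
  by apply: integrable_locally_restrict; [exact: mT|exact: fi].
have L : aeT (fun t => lebesgue_pt (f \_ T) t).
  by apply: (aeS (lebesgue_differentiation li)) => t h _.
apply: (aeT2 _ L (aeT2 _ (aeT_neq 0) (aeT_neq (pi *+ 2)))); last first.
  by move=> t Tt h1 h2; exact: (conj h1 h2).
move=> t; rewrite /Tdom /= in_itv/= => /andP[t0 t2] tL [n0 n2]; split => //.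
by rewrite !lt_neqAle t0 t2 n2 eq_sym n0.
Qed.

Definition pint_cvg (g : R -> C) t := forall e, 0 < e ->
  exists2 r0, 0 <= r0 < 1 & forall r, r0 < r < 1 -> cabs (pint r g t - g t) < e.

Lemma pint_cvg_lebesgue (g : R -> C) t : CI g -> 0 < t < pi *+ 2 ->
  lebesgue_pt ((fun s => complex.Re (g s)) \_ T) t ->
  lebesgue_pt ((fun s => complex.Im (g s)) \_ T) t -> pint_cvg g t.
Proof.
move=> [gr gi] t2 h1 h2 e e0; have e20 : 0 < e / 2 by rewrite divr_gt0.
have [r1 /andP[r10 r11] H1] := poisson_lebesgue_pt gr t2 h1 e20.
have [r2 /andP[r20 r21] H2] := poisson_lebesgue_pt gi t2 h2 e20.
exists (Num.max r1 r2); first by rewrite le_max r10 gt_max r11 r21.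
move=> r; rewrite gt_max => /andP[/andP[rr1 rr2] rl].
rewrite (le_lt_trans (cabs_le_ReIm _))// ReB ImB (splitr e) /=.
apply: ltrD.
  have := H1 r; rewrite rr1 rl => /(_ isT); congr (`|_ - _| < _).
  by apply: avg_eq => s _; rewrite Re_realcM.
have := H2 r; rewrite rr2 rl => /(_ isT); congr (`|_ - _| < _).
by apply: avg_eq => s _; rewrite Im_realcM.
Qed.

Lemma aeT_pint_cvg (g : R -> C) : CI g ->
  aeT (fun t => 0 < t < pi *+ 2 /\ pint_cvg g t).
Proof.
move=> gi; have [gr gm] := gi.
apply: aeT2 (aeT_lebesgue_pt gr) (aeT_lebesgue_pt gm) => t _ [t2 h1] [_ h2].
by split=> //; exact: pint_cvg_lebesgue.
Qed.

(** Points of continuity are Lebesgue points. This is needed beside the almost everywhere statement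
    for the restrictions to inner circles, at one fixed angle and for every radius. *)
Lemma pint_cvg_continuous (g : R -> C) t : CI g -> 0 < t < pi *+ 2 ->
  {for t, continuous (fun s => complex.Re (g s))} ->
  {for t, continuous (fun s => complex.Im (g s))} -> pint_cvg g t.
Proof.
have H (h : R -> R) : RI h -> 0 < t < pi *+ 2 -> {for t, continuous h} -> lebesgue_pt (h \_ T) t.
  move=> hi t2 ct; apply: (@continuous_lebesgue_pt _ _ _ setT) => //.
  - by split; [exact: openT|].
  - by apply/(measurable_restrictT _ (@mT R)); exact: RI_meas.
  - have E : {near t, h =1 h \_ T}.
      near=> s; rewrite patchE ifT// inE /Tdom /= in_itv /=.
      have : s \in `]0, pi *+ 2[ by near: s; apply: near_in_itvoo; rewrite in_itv.
      by rewrite in_itv => /andP[/ltW -> /ltW].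
    move: ct; rewrite /prop_for /continuous_at (nbhs_singleton E) => ct.
    exact: cvg_trans (near_eq_cvg E) ct.
move=> gi t2 c1 c2; have [gr gm] := gi.
by apply: pint_cvg_lebesgue => //; apply: H.
Unshelve. all: by end_near. Qed.

(** The bound passes from Abel sums to Poisson integrals and then to their boundary limits; [A = 0]
    gives uniqueness of Fourier coefficients. *)
Lemma abel_bound_ae (g : R -> C) (A : R) : CI g ->
  (forall M r t, 0 <= r < 1 -> cabs (abel_sum M r g t) <= A) ->
  aeT (fun t => cabs (g t) <= A).
Proof.
move=> gi gA; apply: aeT1 (aeT_pint_cvg gi) => t _ [_ H].
apply/ler_addgt0Pl => e e0; have e20 : 0 < e / 2 by rewrite divr_gt0.
have [r0 /andP[r00 r01] Hr] := H _ e20.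
pose r := (r0 + 1) / 2; have rr : r0 < r < 1 by rewrite /r; lra.
have r1 : 0 <= r < 1 by lra.
have := Hr r rr.
have [N /(_ N.+1 (leqnSn N)) HN] := geometric_small (2 / (1 - r) * avg (fun s => cabs (g s))) r1 e20.
have := pint_abel N t r1 gi; have := gA N r t r1.
move: (pint r g t) (abel_sum N r g t) => P S h1 h2 h3.
have -> : g t = S + (P - S) - (P - g t) by ring.
rewrite (le_trans (cabsB _ _))// (le_trans (lerD (cabsD _ _) (lexx _)))//.
have : 2 * r ^+ N.+1 / (1 - r) * avg (fun s => cabs (g s)) <= e / 2.
  by rewrite (le_trans _ HN)// le_eqVlt; apply/orP; left; apply/eqP; ring.
lra.
Qed.

Lemma fourier_unique0 (g : R -> C) : CI g -> (forall k : int, fcoef g k = 0) ->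
  aeT (fun t => g t = 0).
Proof.
move=> gi g0; apply: aeT1 (@abel_bound_ae g 0 gi _) => [t _ h|M r t _].
  by apply/eqP; rewrite -cabs_eq0 eq_le h cabs_ge0.
by rewrite /abel_sum !big1 ?addr0 ?cabs0// => k _; rewrite g0 mulr0.
Qed.
Lemma fourier_unique (f g : R -> C) : CI f -> CI g ->
  (forall k : int, fcoef f k = fcoef g k) -> aeT (fun t => f t = g t).
Proof.
move=> fi gi fg; apply: aeT1 (@fourier_unique0 (fun t => f t - g t) _ _).
- by move=> t _ /eqP; rewrite subr_eq0 => /eqP.
- exact: CIB.
- by move=> k; rewrite fcoefB// fg subrr.
Qed.

End PoissonLimit.

(** * The spaces L^p *)

Section LpBasics.
Context {R : realType}.
Local Notation C := R[i].
Local Notation T := (@Tdom R).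
Implicit Types (f g : R -> C) (p e l : R).

(** The p-th power of the L^p norm. Leaving out the root replaces Minkowski's inequality by the
    elementary [Np_add]. *)
Definition Np p f : R := avg (fun t => cabs (f t) `^ p).

Lemma inLpP p f : inLp p f <-> cmeas f /\ RI (fun t => cabs (f t) `^ p).
Proof.
split.
  move=> [mr [mi fi]]; have mf : cmeas f by [].
  split => //; apply/integrableP; split.
    by apply/measurable_EFinP; exact: measurable_cabs_powR.
  apply: le_lt_trans fi; rewrite le_eqVlt; apply/orP; left; apply/eqP.
  by apply: eq_integral => t _ /=; rewrite ger0_norm// powR_ge0.
move=> [[mr mi] /integrableP[_ fi]]; split => //; split => //.
apply: le_lt_trans fi; rewrite le_eqVlt; apply/orP; left; apply/eqP.
by apply: eq_integral => t _ /=; rewrite ger0_norm// powR_ge0.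
Qed.

Lemma Np_ge0 p f : 0 <= Np p f.
Proof. by apply: avg_ge0 => t _; exact: powR_ge0. Qed.

(** The sum is at most twice the larger term. *)
Lemma powR_add p (a b : R) : 0 <= p -> 0 <= a -> 0 <= b ->
  (a + b) `^ p <= 2 `^ p * (a `^ p + b `^ p).
Proof.
move=> p0; wlog ab : a b / a <= b.
  move=> W a0 b0; have [ab|/ltW ba] := leP a b; first exact: W.
  by rewrite addrC [X in _ * X]addrC; exact: W.
move=> a0 b0; apply: (@le_trans _ _ ((2 * b) `^ p)).
  by apply: ge0_ler_powR; rewrite ?nnegrE ?addr_ge0 ?mulr_ge0//; lra.
by rewrite powRM// ler_wpM2l ?powR_ge0// lerDr powR_ge0.
Qed.

Lemma Np_ae_eq p f g : aeT (fun t => f t = g t) -> Np p f = Np p g.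
Proof. by move=> fg; apply: avg_ae_eq; apply: aeT1 fg => t _ ->. Qed.

Section Exponent.
Variable p : R.
Hypothesis p0 : 0 < p.

Lemma inLp_cmeas f : inLp p f -> cmeas f.
Proof. by move/inLpP => []. Qed.
Lemma inLp_RI f : inLp p f -> RI (fun t => cabs (f t) `^ p).
Proof. by move/inLpP => []. Qed.

Lemma inLp_le f g : cmeas f -> inLp p g ->
  (forall t, T t -> cabs (f t) <= cabs (g t)) -> inLp p f.
Proof.
move=> mf gp fg; apply/inLpP; split => //.
apply: (RI_le _ (inLp_RI gp)); first exact: measurable_cabs_powR.
move=> t Tt; rewrite ger0_norm ?powR_ge0//.
by apply: ge0_ler_powR; rewrite ?nnegrE ?cabs_ge0 ?(ltW p0)// fg.
Qed.
Lemma inLp_bounded f (M : R) : cmeas f -> (forall t, T t -> cabs (f t) <= M) ->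
  inLp p f.
Proof.
move=> mf fM; apply/inLpP; split => //.
apply: (@RI_bounded _ _ (`|M| `^ p)); first exact: measurable_cabs_powR.
move=> t Tt; rewrite ger0_norm ?powR_ge0//.
apply: ge0_ler_powR; rewrite ?nnegrE ?cabs_ge0 ?(ltW p0)//.
by rewrite (le_trans (fM t Tt))// ler_norm.
Qed.
Lemma inLpD f g : inLp p f -> inLp p g -> inLp p (fun t => f t + g t).
Proof.
move=> fp gp; apply/inLpP; split; first by apply: cmeasD; exact: inLp_cmeas.
apply: (RI_le _ (RIZ (2 `^ p) (RID (inLp_RI fp) (inLp_RI gp)))).
  by apply: measurable_cabs_powR; apply: cmeasD; exact: inLp_cmeas.
move=> t _; rewrite ger0_norm ?powR_ge0//.
apply: le_trans (powR_add (ltW p0) (cabs_ge0 _) (cabs_ge0 _)).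
by apply: ge0_ler_powR; rewrite ?nnegrE ?cabs_ge0 ?addr_ge0 ?cabs_ge0 ?(ltW p0)// cabsD.
Qed.
Lemma inLpZ (c : C) f : inLp p f -> inLp p (fun t => c * f t).
Proof.
move=> fp; apply/inLpP; split; first by apply: cmeasZ; exact: inLp_cmeas.
under eq_fun do rewrite cabsM powRM ?cabs_ge0//.
exact/RIZ/inLp_RI.
Qed.
Lemma inLpN f : inLp p f -> inLp p (fun t => - f t).
Proof. by move=> fp; under eq_fun do rewrite -mulN1r; exact: inLpZ. Qed.
Lemma inLpB f g : inLp p f -> inLp p g -> inLp p (fun t => f t - g t).
Proof. by move=> fp gp; exact: inLpD fp (inLpN gp). Qed.
Lemma inLpM f (b : R -> C) (M : R) : cmeas b -> (forall t, T t -> cabs (b t) <= M) ->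
  inLp p f -> inLp p (fun t => b t * f t).
Proof.
move=> mb bM fp; apply: (@inLp_le _ (fun t => (M%:C)%C * f t)).
- by apply: cmeasM => //; exact: inLp_cmeas.
- exact: inLpZ.
- move=> t Tt; rewrite !cabsM ler_wpM2r ?cabs_ge0// cabs_real.
  by rewrite (le_trans (bM t Tt))// ler_norm.
Qed.
Lemma Np_le f g : inLp p f -> inLp p g ->
  (forall t, T t -> cabs (f t) <= cabs (g t)) -> Np p f <= Np p g.
Proof.
move=> fp gp fg; apply: avg_le; [exact: inLp_RI..|] => t Tt.
by apply: ge0_ler_powR; rewrite ?nnegrE ?cabs_ge0 ?(ltW p0)// fg.
Qed.
Lemma Np_add f g : inLp p f -> inLp p g ->
  Np p (fun t => f t + g t) <= 2 `^ p * (Np p f + Np p g).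
Proof.
move=> fp gp; rewrite /Np -avgD ?inLp_RI//; [|exact: inLp_RI..].
rewrite -avgZ; last by apply: RID; exact: inLp_RI.
apply: avg_le; [by apply: inLp_RI; exact: inLpD|
  by apply: RIZ; apply: RID; exact: inLp_RI|] => t _.
apply: le_trans (powR_add (ltW p0) (cabs_ge0 _) (cabs_ge0 _)).
by apply: ge0_ler_powR; rewrite ?nnegrE ?cabs_ge0 ?addr_ge0 ?cabs_ge0 ?(ltW p0)// cabsD.
Qed.
Lemma NpZ (c : C) f : inLp p f -> Np p (fun t => c * f t) = cabs c `^ p * Np p f.
Proof.
move=> fp; rewrite /Np -avgZ; last exact: inLp_RI.
by apply: avg_eq => t _; rewrite cabsM powRM ?cabs_ge0.
Qed.
Lemma NpC f g : Np p (fun t => f t - g t) = Np p (fun t => g t - f t).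
Proof. by apply: avg_eq => t _; rewrite cabsC. Qed.
Lemma Np_sub_add f g h : inLp p f -> inLp p g -> inLp p h ->
  Np p (fun t => f t - h t) <=
  2 `^ p * (Np p (fun t => f t - g t) + Np p (fun t => g t - h t)).
Proof.
move=> fp gp hp; apply: le_trans (Np_add (inLpB fp gp) (inLpB gp hp)).
by rewrite le_eqVlt; apply/orP; left; apply/eqP; apply: avg_eq => t _; congr (cabs _ `^ _); ring.
Qed.

Lemma cvg_powR (u : nat -> R) (a : R) : (forall n, 0 <= u n) ->
  u @ \oo --> a -> (fun n => u n `^ p) @ \oo --> a `^ p.
Proof.
move=> u0 ua; have a0 : 0 <= a.
  have h := @ler_cvg_to _ _ _ _ (cst 0) u 0 a (cvg_cst 0) ua.
  by apply: h; apply: nearW => n /=.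
have [a00|an0] := eqVneq a 0.
  rewrite a00 powR0 ?gt_eqF//; apply/cvgrPdist_lt => e e0.
  have ep : 0 < e `^ p^-1 by rewrite powR_gt0.
  move/cvgrPdist_lt/(_ _ ep) : ua; apply: filterS => n.
  rewrite a00 !sub0r !normrN !ger0_norm ?powR_ge0// => un.
  have -> : e = (e `^ p^-1) `^ p by rewrite -powRrM mulVf ?gt_eqF// powRr1// ltW.
  by apply: gt0_ltr_powR; rewrite ?nnegrE ?powR_ge0.
have agt0 : 0 < a by rewrite lt_def an0.
have c : {for a, continuous (fun x : R => x `^ p)}.
  apply: differentiable_continuous.
  by apply/derivable1_diffP; apply: derivable_powR; rewrite in_itv/= agt0.
exact: (cvg_comp _ _ ua c).
Qed.
Lemma ccvg_powR (u : nat -> C) (a : C) : ccvg u a ->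
  (fun n => cabs (u n) `^ p) @ \oo --> cabs a `^ p.
Proof. by move=> ua; apply: cvg_powR; [move=> n; exact: cabs_ge0|exact: ccvg_cabs]. Qed.

Lemma Np_dct (h : nat -> R -> C) f (g : R -> C) :
  (forall n, cmeas (h n)) -> cmeas f -> inLp p g ->
  aeT (fun t => ccvg (h ^~ t) (f t)) ->
  aeT (fun t => forall n, cabs (h n t) <= cabs (g t)) ->
  inLp p f /\ (fun n => Np p (h n)) @ \oo --> Np p f.
Proof.
move=> mh mf gp hf hg.
have [] := @avg_dct R (fun n t => cabs (h n t) `^ p) (fun t => cabs (f t) `^ p)
  (fun t => cabs (g t) `^ p).
- by move=> n; exact: measurable_cabs_powR.
- exact: measurable_cabs_powR.
- exact: inLp_RI.
- by apply: aeT1 hf => t _; exact: ccvg_powR.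
- apply: aeT1 hg => t _ ht n; rewrite ger0_norm ?powR_ge0//.
  by apply: ge0_ler_powR; rewrite ?nnegrE ?cabs_ge0 ?(ltW p0).
by move=> fi fc; split; [apply/inLpP|exact: fc].
Qed.

End Exponent.

Section ExponentGt1.
Variable p : R.
Hypothesis p1 : 1 < p.
Let p0 : 0 < p := lt_trans ltr01 p1.

(** Replaces Hölder's inequality when comparing first and p-th powers: either x <= l, or x / l >= 1
    is at most its p-th power. The scale [l] remains free. *)
Lemma le_powR_scaled (x l : R) : 0 <= x -> 0 < l -> x <= l + l * (l^-1 `^ p * x `^ p).
Proof.
move=> x0 l0; have [xl|lx] := leP x l.
  by rewrite (le_trans xl)// lerDl !mulr_ge0 ?powR_ge0// ltW.
rewrite -powRM ?invr_ge0 ?(ltW l0)//; set y := l^-1 * x.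
have yx : x = l * y by rewrite /y mulrA divff ?mul1r// gt_eqF.
have y1 : 1 <= y by rewrite /y mulrC ler_pdivlMr// mul1r ltW.
rewrite {1}yx; have := ler_wpM2l (ltW l0) (le1r_powR y1 (ltW p1)); lra.
Qed.
Lemma inLp_CI f : inLp p f -> CI f.
Proof.
move=> fp; apply: (CI_le (inLp_cmeas fp) (RID (RI_cst 1) (inLp_RI fp))).
move=> t _ /=; have := le_powR_scaled (cabs_ge0 (f t)) ltr01.
by rewrite invr1 powR1 !mul1r.
Qed.
Lemma avg_le_Np f l : inLp p f -> 0 < l ->
  avg (fun t => cabs (f t)) <= l + l * (l^-1 `^ p * Np p f).
Proof.
move=> fp l0; have hi := inLp_RI fp.
rewrite /Np -!avgZ//; last exact: RIZ.
rewrite -{1}[l]avg_cst -avgD; [|exact: RI_cst|by apply: RIZ; exact: RIZ].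
apply: avg_le; [by apply: CI_abs; exact: inLp_CI|
  by apply: RID; [exact: RI_cst|apply: RIZ; exact: RIZ]|].
by move=> t _ /=; exact: le_powR_scaled (cabs_ge0 _) l0.
Qed.
Lemma avg_le_fast f (j : nat) : inLp p f -> Np p f <= (2^-1 ^+ j) `^ p ->
  avg (fun t => cabs (f t)) <= 2 * 2^-1 ^+ j.
Proof.
move=> fp fj; have l0 : 0 < (2^-1 : R) ^+ j by rewrite exprn_gt0.
apply: (le_trans (avg_le_Np fp l0)); rewrite mulr_natl mulr2n lerD2l.
rewrite -[leRHS]mulr1 ler_pM2l//.
apply: (@le_trans _ _ ((2^-1 ^+ j)^-1 `^ p * (2^-1 ^+ j) `^ p)).
  by rewrite ler_wpM2l ?powR_ge0.
by rewrite -powRM ?invr_ge0 ?(ltW l0)// mulVf ?gt_eqF// powR1.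
Qed.

(** The increments have averages at most 2 * 2^(-n), with sum at most 4, so the telescoping series
    converges absolutely almost everywhere. Fatou's lemma in [m] carries the bounds over to the
    limit. *)
Lemma Lp_complete (g : nat -> R -> C) : (forall j, inLp p (g j)) ->
  (forall j m, (j <= m)%N -> Np p (fun t => g m t - g j t) <= (2^-1 ^+ j) `^ p) ->
  exists f, [/\ inLp p f, (forall j, Np p (fun t => f t - g j t) <= (2^-1 ^+ j) `^ p) &
    aeT (fun t => ccvg (g ^~ t) (f t))].
Proof.
move=> gp gm; pose u n t := cabs (g n.+1 t - g n t).
have dp n m : inLp p (fun t => g m t - g n t) by exact: inLpB.
have uS : aeT (fun t => cvgn (series (u ^~ t))).
  apply: (@avg_series_ae _ u 4) => [n|n t _|N].
  - by apply: CI_abs; exact: inLp_CI.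
  - exact: cabs_ge0.
  - apply: (@le_trans _ _ (\sum_(0 <= n < N) 2 * 2^-1 ^+ n)).
      by apply: ler_sum => n _; apply: avg_le_fast => //; exact: gm.
    rewrite -mulr_sumr big_mkord.
    have := subrX1 (2^-1 : R) N; set S := \sum_(_ < _) _ => hS.
    have : 0 <= (2^-1 : R) ^+ N by rewrite exprn_ge0// invr_ge0.
    lra.
have [|f [mf gf]] := @aeT_ccvg_meas R g (fun j => inLp_cmeas (gp j)).
  apply: aeT1 uS => t _ ut.
  have conv (h : C -> R) : (forall x y, h (x - y) = h x - h y) ->
      (forall x, `|h x| <= cabs x) -> exists l, (fun n => h (g n t)) @ \oo --> l.
    move=> hB hle; pose v n := h (g n t).
    have : cvgn (series (telescope v)).
      apply: normed_cvg; apply: series_le_cvg ut => n //=.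
        exact: cabs_ge0.
      by rewrite /telescope /= /v -hB hle.
    move=> /cvg_ex[l hl]; exists (v 0%N + l).
    have H : (fun n => v 0%N + series (telescope v) n) @ \oo --> v 0%N + l.
      by apply: cvgD; [exact: cvg_cst|exact: hl].
    rewrite (_ : (fun n => h (g n t)) = fun n => v 0%N + series (telescope v) n)//.
    by apply/funext => n; rewrite -eq_sum_telescope.
  have [lr hr] := conv (@complex.Re R) (@ReB R) (@Re_le_cabs R).
  have [li hi] := conv (@complex.Im R) (@ImB R) (@Im_le_cabs R).
  by exists (Complex lr li); apply: ccvg_ReIm.
have key j : RI (fun t => cabs (f t - g j t) `^ p) /\
    Np p (fun t => f t - g j t) <= (2^-1 ^+ j) `^ p.
  apply: (@avg_fatou R (fun m t => cabs (g (m + j)%N t - g j t) `^ p)).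
  - by move=> m; exact: inLp_RI.
  - by apply: measurable_cabs_powR; apply: cmeasB => //; exact: inLp_cmeas.
  - by move=> n t _; exact: powR_ge0.
  - by move=> t _; exact: powR_ge0.
  - apply: aeT1 gf => t _ gft; apply: ccvg_powR => //.
    apply: (@ccvgD _ (fun m => g (m + j)%N t) (fun=> - g j t)); last exact: ccvg_cst.
    by rewrite /ccvg (cvg_shiftn j (fun n => cabs (g n t - f t))).
  - by move=> m; apply: gm; exact: leq_addl.
exists f; split => // [|j]; last by have [] := key j.
have -> : f = fun t => (f t - g 0%N t) + g 0%N t.
  by apply/funext => t; rewrite subrK.
apply: inLpD => //; apply/inLpP; split; last by have [] := key 0%N.
by apply: cmeasB => //; exact: inLp_cmeas.
Qed.

End ExponentGt1.
End LpBasics.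

(** * Abel means and density of trigonometric polynomials *)

Section Approximation.
Context {R : realType}.
Local Notation C := R[i].
Local Notation T := (@Tdom R).
Local Notation Re := complex.Re.
Local Notation Im := complex.Im.
Implicit Types (f g : R -> C) (p e : R).

Definition rad (n : nat) : R := 1 - 2^-1 / n.+1%:R.
(** Halfway between [rad n] and 1. Control up to this radius gives estimates on a disc of radius
    [rad2 n / rad n] > 1 after scaling by [rad n], as [positive_Lp_bound] demands. *)
Definition rad2 (n : nat) : R := (1 + rad n) / 2.
Definition eps (n : nat) : R := n.+1%:R^-1.

Lemma rad_itv n : 0 < rad n < 1.
Proof.
have n0 : 0 < n.+1%:R :> R by rewrite ltr0n.
have h : 0 < (2^-1 : R) / n.+1%:R by rewrite divr_gt0.
have h2 : (2^-1 : R) / n.+1%:R <= 2^-1.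
  by rewrite ler_pdivrMr// ler_peMr// ler1n.
by rewrite /rad; move: h h2; set x := _ / _ => h h2; lra.
Qed.
Lemma eps_gt0 n : 0 < eps n. Proof. by rewrite invr_gt0 ltr0n. Qed.
Lemma eps_le1 n : eps n <= 1. Proof. by rewrite invf_le1 ?ltr0n// ler1n. Qed.
Lemma eps_cvg0 : eps @ \oo --> 0.
Proof. exact: cvg_harmonic. Qed.
Lemma rad_cvg1 : rad @ \oo --> (1 : R).
Proof.
rewrite -[X in _ --> X]subr0 -[X in _ --> _ - X](mulr0 (2^-1 : R)).
by apply: cvgB; [exact: cvg_cst|apply: cvgMl_tmp; exact: cvg_harmonic].
Qed.
Lemma rad2_itv n : rad n < rad2 n < 1.
Proof. by have := rad_itv n; rewrite /rad2; lra. Qed.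
Lemma rad_ge (r0 : R) : r0 < 1 -> exists N, forall n, (N <= n)%N -> r0 < rad n :> R.
Proof.
move=> r1; have /cvgrPdist_lt/(_ (1 - r0)) := rad_cvg1.
rewrite subr_gt0 => /(_ r1)[N _ H]; exists N => m Nm.
by have := H m Nm; rewrite /= ltr_norml => /andP[_]; lra.
Qed.

(* Truncation orders making Abel sums uniformly [eps n]-close to Poisson
   integrals for all radii up to [rad2 n]. *)
Lemma orders_exist (A : R) (d : nat) : 0 <= A -> exists M : nat -> nat, forall n,
  (d <= M n)%N /\ forall r, 0 <= r <= rad2 n ->
    2 * r ^+ (M n).+1 / (1 - r) * A <= eps n.
Proof.
move=> A0; have H n : exists M : nat, (d <= M)%N /\ forall r, 0 <= r <= rad2 n ->
    2 * r ^+ M.+1 / (1 - r) * A <= eps n.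
  have /andP[h1 h2] := rad2_itv n; have /andP[h3 h4] := rad_itv n.
  have s01 : 0 <= rad2 n < 1 by lra.
  have [N HN] := geometric_small (2 / (1 - rad2 n) * A) s01 (eps_gt0 n).
  exists (maxn d N); split; first exact: leq_maxl.
  move=> r /andP[r0 rs]; apply: le_trans (HN (maxn d N).+1 _); last first.
    by rewrite ltnW// ltnS leq_maxr.
  rewrite [X in _ <= X]mulrA ler_wpM2r//.
  apply: (@le_trans _ _ (rad2 n ^+ (maxn d N).+1 * (2 / (1 - r)))).
    rewrite mulrAC [_ * _ ^+ _]mulrC ler_wpM2r//.
      by rewrite divr_ge0// subr_ge0; lra.
    by rewrite lerXn2r ?nnegrE//; lra.
  rewrite ler_wpM2l ?exprn_ge0//; first by lra.
  by rewrite ler_wpM2l// lef_pV2 ?posrE; lra.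
by have [M HM] := choice H; exists M => n; have [h1 h2] := HM n; split.
Qed.

Lemma abel_ccvg_ae g (A : R) (M : nat -> nat) : CI g ->
  avg (fun t => cabs (g t)) <= A ->
  (forall n r, 0 <= r <= rad2 n -> 2 * r ^+ (M n).+1 / (1 - r) * A <= eps n) ->
  aeT (fun t => ccvg (fun n => abel_sum (M n) (rad n) g t) (g t)).
Proof.
move=> gi gA HM; apply: aeT1 (aeT_pint_cvg gi) => t _ [_ H].
apply/cvgrPdist_lt => e e0; have e20 : 0 < e / 2 by rewrite divr_gt0.
have [r0 /andP[r00 r01] Hr] := H _ e20.
have [N1 HN1] := rad_ge r01.
have /cvgrPdist_lt/(_ _ e20)[N2 _ HN2] := eps_cvg0.
exists (maxn N1 N2) => // n /=; rewrite geq_max => /andP[n1 n2].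
have /andP[rn0 rn1] := rad_itv n.
have := Hr (rad n); rewrite HN1// rn1 => /(_ isT) h1.
have := HN2 n n2; rewrite /= sub0r normrN ger0_norm ?(ltW (eps_gt0 n))// => h2.
have rn01 : 0 <= rad n < 1 by lra.
have h3 := pint_abel (M n) t rn01 gi.
have h4 : 2 * rad n ^+ (M n).+1 / (1 - rad n) * avg (fun s => cabs (g s)) <= eps n.
  apply: le_trans (HM n (rad n) _); last by have /andP[] := rad2_itv n; lra.
  rewrite ler_wpM2l// divr_ge0 ?mulr_ge0 ?exprn_ge0//; lra.
rewrite sub0r normrN ger0_norm ?cabs_ge0//.
have -> : abel_sum (M n) (rad n) g t - g t =
  (pint (rad n) g t - g t) - (pint (rad n) g t - abel_sum (M n) (rad n) g t) by ring.
rewrite (le_lt_trans (cabsB _ _))//; lra.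
Qed.

Lemma cabs_pint r g t (B : R) : 0 <= r < 1 -> CI g ->
  (forall t, T t -> cabs (g t) <= B) -> cabs (pint r g t) <= B.
Proof.
move=> r01 gi gB; have ci := CI_poisson t r01 gi.
apply: (le_trans (cabs_cint ci)).
have mP : RI (fun s => poisson r (t - s)).
  apply: (@RI_bounded _ _ (2 / (1 - r))).
    by apply: cmeas_continuous; exact: poisson_continuous.
  by move=> s _; rewrite gtr0_norm ?poisson_gt0// poisson_le.
rewrite -[B]mulr1 -(avg_poisson t r01) -avgZ//.
apply: avg_le; [exact: CI_abs|exact: RIZ|] => s Ts.
by rewrite cabsM cabs_real gtr0_norm ?poisson_gt0// mulrC ler_pM2r ?poisson_gt0// gB.
Qed.

Lemma abel_bound g (A B : R) (M : nat -> nat) n t : CI g ->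
  avg (fun t => cabs (g t)) <= A ->
  (forall n r, 0 <= r <= rad2 n -> 2 * r ^+ (M n).+1 / (1 - r) * A <= eps n) ->
  (forall t, T t -> cabs (g t) <= B) ->
  cabs (abel_sum (M n) (rad n) g t) <= B + 1.
Proof.
move=> gi gA HM gB; have /andP[rn0 rn1] := rad_itv n.
have rn01 : 0 <= rad n < 1 by lra.
have h3 := pint_abel (M n) t rn01 gi.
have h4 : 2 * rad n ^+ (M n).+1 / (1 - rad n) * avg (fun s => cabs (g s)) <= 1.
  apply: le_trans (eps_le1 n); apply: le_trans (HM n (rad n) _); last by have /andP[] := rad2_itv n; lra.
  rewrite ler_wpM2l// divr_ge0 ?mulr_ge0 ?exprn_ge0//; lra.
have h5 := cabs_pint t rn01 gi gB.
have -> : abel_sum (M n) (rad n) g t =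
  pint (rad n) g t - (pint (rad n) g t - abel_sum (M n) (rad n) g t) by ring.
rewrite (le_trans (cabsB _ _))//; lra.
Qed.

(** A trigonometric polynomial encoded by a shift and an ordinary polynomial: its modulus is that of
    [q] on the circle, and its analytic half is [drop_poly N q]. *)
Definition trig (N : nat) (q : {poly C}) : R -> C :=
  fun t => expi ((- N%:Z)%:~R * t) * q.[expi t].

Lemma cabs_trig N q t : cabs (trig N q t) = cabs q.[expi t].
Proof. by rewrite cabsM cabs_expi mul1r. Qed.
Lemma cmeas_trig N q : cmeas (trig N q).
Proof. by apply: cmeasM; [exact: cmeas_expi|exact: cmeas_horner]. Qed.
Lemma trig_bounded N q : exists S, forall t, cabs (trig N q t) <= S.
Proof.
exists (\sum_(i < size q) cabs q`_i) => t.
by rewrite cabs_trig horner_bound ?cabs_expi.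
Qed.
Lemma CI_trig N q : CI (trig N q).
Proof.
have [S HS] := trig_bounded N q.
by apply: (@CI_bounded _ _ S) => //; exact: cmeas_trig.
Qed.
Lemma inLp_trig p N q : 0 < p -> inLp p (trig N q).
Proof.
move=> p0; have [S HS] := trig_bounded N q.
by apply: (@inLp_bounded _ _ p0 _ S) => //; exact: cmeas_trig.
Qed.
Lemma trig0 (q : {poly C}) : trig 0 q = fun t => q.[expi t].
Proof. by apply/funext => t; rewrite /trig mul0r expi0 mul1r. Qed.
Lemma trig_shift N K (q : {poly C}) : trig (N + K) (q * 'X^K) = trig N q.
Proof.
apply/funext => t; rewrite /trig hornerM hornerXn -expi_nat.
rewrite [q.[_] * _]mulrC mulrA -expiD; congr (expi _ * _).
by rewrite !mulrNz -!pmulrn natrD; ring.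
Qed.
Lemma trigB N (q q' : {poly C}) t : trig N (q - q') t = trig N q t - trig N q' t.
Proof. by rewrite /trig hornerD hornerN mulrBr. Qed.
Lemma drop_shift N K (q : {poly C}) : drop_poly (N + K) (q * 'X^K) = drop_poly N q.
Proof. by apply/polyP => i; rewrite !coef_drop_poly coefMXn addnA ltnNge leq_addl addnK. Qed.

Lemma fcoef_horner (q : {poly C}) (k : int) :
  fcoef (fun t : R => q.[expi t]) k = if k is Posz n then q`_n else 0.
Proof.
under eq_fun do rewrite horner_coef.
rewrite fcoef_sum; last first.
  move=> i; apply: CIZ; under eq_fun do rewrite -expi_nat; exact: CI_expi.
under eq_bigr => i _.
  rewrite fcoefZ; last by under eq_fun do rewrite -expi_nat; exact: CI_expi.
  rewrite (_ : (fun t : R => expi t ^+ i) = fun t => expi ((i%:Z)%:~R * t)); last first.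
    by apply/funext => t; rewrite -expi_nat.
  rewrite fcoef_expi; over.
case: k => [n|n]; last by rewrite big1// => i _; rewrite mulr0.
have [nq|qn] := ltnP n (size q).
  rewrite (bigD1 (Ordinal nq))//= eqxx mulr1 big1 ?addr0// => i ni.
  rewrite (_ : (Posz n == Posz i) = false) ?mulr0//.
  by apply/eqP => -[ni']; move/negP : ni; apply; apply/eqP/val_inj.
rewrite nth_default// big1// => i _.
rewrite (_ : (Posz n == Posz i) = false) ?mulr0//.
by apply/eqP => -[ni]; move: (ltn_ord i); rewrite -ni ltnNge qn.
Qed.
Lemma fcoef_trig N q (k : nat) : fcoef (trig N q) k = (drop_poly N q)`_k.
Proof.
rewrite /trig fcoef_expiM opprK -PoszD fcoef_horner coef_drop_poly//.
Qed.

Lemma abel_sum_trig M r g : exists q, abel_sum M r g = trig M q.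
Proof.
pose q : {poly C} := \sum_(k < M.+1) ((r%:C)%C ^+ k * fcoef g k) *: 'X^(M + k) +
  \sum_(k < M) ((r%:C)%C ^+ k.+1 * fcoef g (- k.+1%:Z)) *: 'X^(M - k.+1).
exists q; apply/funext => t; rewrite /abel_sum /trig /q hornerD mulrDr !horner_sum !mulr_sumr.
congr (_ + _); apply: eq_bigr => k _; rewrite hornerZ hornerXn -expi_nat.
  rewrite natrD mulrDl expiD.
  have -> : expi ((- M%:Z)%:~R * t) = (expi (M%:R * t))^-1.
    by rewrite mulrNz mulNr expiNV.
  by field; exact: expi_neq0.
rewrite natrB ?ltn_ord// mulrBl expiD mulrNz mulNr !expiNV.
by field; rewrite !expi_neq0.
Qed.

Lemma cmeas_trunc f (c : R) : cmeas f ->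
  cmeas (fun t => if cabs (f t) <= c then f t else 0).
Proof.
move=> mf; have [mr mi] := mf.
have mb : measurable_fun T (fun t => cabs (f t) <= c).
  by apply: measurable_fun_ler; [exact: cmeas_cabs|exact: measurable_cst].
have mTT := @mT R.
split.
  rewrite (_ : (fun t => _) = fun t => if cabs (f t) <= c then Re (f t) else 0); last first.
    by apply/funext => t; case: ifP.
  by apply: measurable_fun_if => //; apply: measurable_funS mr => // t [].
rewrite (_ : (fun t => _) = fun t => if cabs (f t) <= c then Im (f t) else 0); last first.
  by apply/funext => t; case: ifP.
by apply: measurable_fun_if => //; apply: measurable_funS mi => // t [].
Qed.

(** Two dominated convergences: [f] is first cut off to a bounded function, whose Abel sums then
    converge boundedly almost everywhere. *)
Lemma trig_dense p f e : 0 < p -> CI f -> inLp p f -> 0 < e ->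
  exists N q, Np p (fun t => f t - trig N q t) < e.
Proof.
move=> p0 fi fp e0.
pose K : R := 2 `^ p; have K0 : 0 < K by rewrite powR_gt0.
have e1 : 0 < e / (2 * K) by rewrite divr_gt0 // mulr_gt0.
pose fn (n : nat) t := if cabs (f t) <= n%:R then f t else 0.
have mfn n : cmeas (fn n) by apply: cmeas_trunc; exact: CI_cmeas.
have fnb n t : cabs (fn n t) <= n%:R by rewrite /fn; case: ifPn => // _; rewrite cabs0.
have fnp n : inLp p (fn n) by apply: (@inLp_bounded _ _ p0 _ n%:R) => // t _.
have Np0 : Np p (fun _ : R => 0) = 0 by rewrite /Np cabs0 powR0 ?gt_eqF// avg_cst.
have [|||||_] := @Np_dct R p p0 (fun n t => f t - fn n t) (fun=> 0) f.
- by move=> n; apply: cmeasB => //; exact: CI_cmeas.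
- exact: cmeas_cst.
- exact: fp.
- apply: aeT_all => t _; have [N fN] : exists N : nat, cabs (f t) <= N%:R.
    by exists (Num.truncn (cabs (f t))).+1; rewrite ltW// truncnS_gt.
  apply/cvgrPdist_lt => d d0; exists N => // n Nn /=.
  rewrite /fn (le_trans fN) ?ler_nat// !subrr cabs0 subrr normr0//.
- apply: aeT_all => t _ n; rewrite /fn; case: ifP => _; first by rewrite subrr cabs0 cabs_ge0.
  by rewrite subr0.
rewrite Np0 => /cvgrPdist_lt/(_ _ e1)[n _ /(_ n (leqnn n))].
rewrite /= sub0r normrN ger0_norm ?Np_ge0// => h1.
pose g := fn n; have gi : CI g by apply: (@CI_bounded _ _ n%:R); [exact: mfn|move=> t _; exact: fnb].
have [M HM] := orders_exist 0 (@avg_ge0 R (fun t => cabs (g t)) (fun t _ => cabs_ge0 _)).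
have HM2 := fun n => (HM n).2.
have cv := abel_ccvg_ae gi (lexx _) HM2.
have bd m t : cabs (abel_sum (M m) (rad m) g t) <= n%:R + 1.
  by apply: (abel_bound m t gi (lexx _) HM2) => s _; exact: fnb.
have [q qE] := choice (fun m => abel_sum_trig (M m) (rad m) g).
have n20 : 0 <= n%:R + (n%:R + 1) :> R by rewrite !addr_ge0.
have [|||||_] := @Np_dct R p p0 (fun m t => g t - trig (M m) (q m) t) (fun=> 0)
   (fun=> ((n%:R + (n%:R + 1))%:C)%C).
- by move=> m; apply: cmeasB; [exact: mfn|exact: cmeas_trig].
- exact: cmeas_cst.
- apply: (@inLp_bounded _ _ p0 _ (n%:R + (n%:R + 1))); first exact: cmeas_cst.
  by move=> t _; rewrite cabs_real ger0_norm.
- apply: aeT1 cv => t _ ct; rewrite -[X in ccvg _ X](subrr (g t)).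
  apply: ccvgD; first exact: ccvg_cst.
  have := ccvgZ (-1) ct; rewrite mulN1r; under eq_fun do rewrite mulN1r.
  by under eq_fun do rewrite qE.
- apply: aeT_all => t _ m; rewrite -qE cabs_real ger0_norm//.
  by apply: (le_trans (cabsB _ _)); apply: lerD; [exact: fnb|exact: bd].
rewrite Np0 => /cvgrPdist_lt/(_ _ e1)[m _ /(_ m (leqnn m))].
rewrite /= sub0r normrN ger0_norm ?Np_ge0// => h2.
exists (M m), (q m).
apply: (le_lt_trans (@Np_sub_add _ _ p0 f g _ fp (fnp n) (inLp_trig _ _ p0))).
rewrite -/K mulrC -ltr_pdivlMr// (splitr (e / K)).
have -> : e / K / 2 = e / (2 * K) by rewrite -mulrA -invfM mulrC [K * 2]mulrC mulrC.
exact: ltrD.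
Qed.

End Approximation.

(** * M. Riesz' theorem *)

Section Riesz.
Context {R : realType}.
Local Notation C := R[i].
Local Notation T := (@Tdom R).
Local Notation Re := complex.Re.
Local Notation Im := complex.Im.
Implicit Types (f g : R -> C) (p e r : R).

(* The analytic half of [abel_sum]. *)
Definition asum M r f t : C :=
  \sum_(k < M.+1) (r%:C ^+ k * expi (k%:R * t))%C * fcoef f k.

Definition herglotz M r e f : {poly C} :=
  \poly_(k < M.+1) (if k == 0%N then fcoef f 0 + (2 * e)%:C%C
                    else 2 * ((r%:C)%C ^+ k * fcoef f k)).

Lemma herglotz0 M r e f : (herglotz M r e f).[0] = fcoef f 0 + (2 * e)%:C%C.
Proof. by rewrite horner_coef0 coef_poly. Qed.

(* [herglotz M r e f] approximates the Herglotz integral of [f + 2 e]; the shift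
   by [e] makes up for the truncation and keeps the real part positive. *)
Lemma herglotz_circ M r e f s t :
  (herglotz M r e f).[(s%:C)%C * expi t] + (herglotz M r e f).[0] =
  2 * (asum M (r * s) f t + (2 * e)%:C%C).
Proof.
rewrite herglotz0 horner_poly /asum !big_ord_recl /= !expr0 mul0r expi0 !mulr1 mul1r.
rewrite (eq_bigr (fun k : 'I_M => 2 * ((r * s)%:C%C ^+ k.+1 * expi (k.+1%:R * t) * fcoef f k.+1))).
  by rewrite -mulr_sumr; set X := \sum_(_ < _) _; ring.
by move=> k _; rewrite /= /bump /= add1n realcM !exprMn expi_nat; ring.
Qed.

Lemma fcoef_realJ (h : R -> R) k : RI h ->
  fcoef (fun t => (h t)%:C%C) (- k) = conjc (fcoef (fun t => (h t)%:C%C) k).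
Proof.
move=> hi; have ci : CI (fun t => (h t)%:C%C : C) by split => //; exact: RI_cst.
have := fcoef_J (- k) ci; rewrite opprK => <-.
by congr fcoef; apply/funext => t; apply: complex_ext; rewrite ?ReJ ?ImJ /= ?oppr0.
Qed.
Lemma Im_fcoef_real (h : R -> R) : RI h -> Im (fcoef (fun t => (h t)%:C%C) 0) = 0.
Proof.
move=> hi; have := fcoef_realJ 0 hi; rewrite oppr0 => /(congr1 (@complex.Im R)).
rewrite ImJ; lra.
Qed.

(** For a real function negative coefficients are conjugates of positive ones, so doubling the
    positive frequencies but not the constant one yields the full Abel sum as real part. *)
Lemma Re_herglotz M r e (h : R -> R) s t : RI h ->
  Re (herglotz M r e (fun t => (h t)%:C%C)).[(s%:C)%C * expi t] =
  Re (abel_sum M (r * s) (fun t => (h t)%:C%C) t) + 2 * e.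
Proof.
move=> hi; set f := fun t => _.
have H := congr1 (@complex.Re R) (herglotz_circ M r e f s t).
have R2 : Re 2 = 2 :> R by rewrite -[2]/(1 + 1) ReD.
have I2 : Im (2 : C) = 0 :> R by rewrite -[2]/(1 + 1) ImD /= addr0.
rewrite herglotz0 ReD ReM R2 I2 mul0r subr0 !ReD -[Re (2 * e)%:C%C]/(2 * e) in H.
have -> : Re (abel_sum M (r * s) f t) = 2 * Re (asum M (r * s) f t) - Re (fcoef f 0).
  rewrite /abel_sum -/(asum _ _ _ _) ReD.
  have -> : asum M (r * s) f t = fcoef f 0 +
      \sum_(k < M) (((r * s)%:C)%C ^+ k.+1 * expi (k.+1%:R * t)) * fcoef f k.+1.
    by rewrite /asum big_ord_recl expr0 mul0r expi0 !mul1r.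
  have -> : Re (\sum_(k < M) (((r * s)%:C)%C ^+ k.+1 * expi (- (k.+1%:R * t))) * fcoef f (- k.+1%:Z)) =
     Re (\sum_(k < M) (((r * s)%:C)%C ^+ k.+1 * expi (k.+1%:R * t)) * fcoef f k.+1).
    rewrite !complex_Re_sum; apply: eq_bigr => k _.
    rewrite fcoef_realJ// expiN -realcX.
    by rewrite !(ReM, ImM, ReJ, ImJ) /=; ring.
  by rewrite ReD; ring.
lra.
Qed.

(** M. Riesz' inequality for bounded nonnegative functions, by [positive_Lp_bound] for the Herglotz
    polynomials. [Y n] is the average of the p-th power of their real parts. *)
Lemma positive_approx p : 1 < p -> p <= 2 -> exists2 A, 0 <= A &
  forall (h : R -> R) (S : R) (M : nat -> nat), measurable_fun T h ->
    (forall t, T t -> 0 <= h t <= S) ->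
    (forall n r, 0 <= r <= rad2 n -> 2 * r ^+ (M n).+1 / (1 - r) * S <= eps n) ->
    exists Y : nat -> R, Y @ \oo --> avg (fun t => h t `^ p) /\
      forall n, Np p (fun t => asum (M n) (rad n) (fun t => (h t)%:C%C) t + (2 * eps n)%:C%C)
        <= A * Y n.
Proof.
move=> p1 p2; have p0 : 0 < p by exact: lt_trans p1.
have [A A0 HA] := @positive_Lp_bound R p p1 p2.
exists (2 `^ p * (2 * A)); first by rewrite mulr_ge0 ?powR_ge0 ?mulr_ge0.
move=> h S M mh hS HM; set f := fun t => (h t)%:C%C : C.
have hi : RI h.
  by apply: (@RI_bounded _ _ S) => // t Tt; have /andP[h0 h1] := hS t Tt; rewrite ger0_norm.
have fi : CI f by split => //; exact: RI_cst.
have fS t : T t -> cabs (f t) <= S.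
  by move=> Tt; have /andP[h0 h1] := hS t Tt; rewrite cabs_real ger0_norm.
have avgS : avg (fun t => cabs (f t)) <= S.
  by rewrite -[S]avg_cst; apply: avg_le; [exact: CI_abs|exact: RI_cst|exact: fS].
pose F n := herglotz (M n) (rad n) (eps n) f.
(* The Poisson integral of [h] is nonnegative and the truncation error at most [eps n], so the shift
   by 2 [eps n] leaves at least [eps n]. *)
have Fpos n z : cabs z < rad2 n / rad n -> eps n <= Re (F n).[z].
  have /andP[rn0 rn1] := @rad_itv R n; have /andP[rr r2] := @rad2_itv R n; move=> zr.
  have [t zE] := polar z.
  rewrite zE Re_herglotz//.
  have az := cabs_ge0 z.
  have rz : 0 <= rad n * cabs z <= rad2 n.
    by rewrite mulr_ge0 ?(ltW rn0)//= mulrC -ler_pdivlMr// ltW.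
  have rz1 : 0 <= rad n * cabs z < 1 by lra.
  have := pint_abel (M n) t rz1 fi.
  have h1 := HM n _ rz.
  have h2 : 2 * (rad n * cabs z) ^+ (M n).+1 / (1 - rad n * cabs z) * avg (fun s => cabs (f s)) <= eps n.
    apply: le_trans h1; rewrite ler_wpM2l// divr_ge0 ?mulr_ge0 ?exprn_ge0//; lra.
  set P := pint _ _ _; set Ab := abel_sum _ _ _ _ => h3.
  have P0 : 0 <= Re P.
    apply: avg_ge0 => s Ts; rewrite Re_realcM mulr_ge0 ?(ltW (poisson_gt0 _ rz1))//.
    by have /andP[] := hS s Ts.
  have : Re P - Re Ab <= eps n by rewrite -ReB (le_trans (Re_le_cabs' _))// (le_trans h3).
  lra.
pose Y n := avg (fun t => Re (F n).[expi t] `^ p).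
have FE n t : Re (F n).[expi t] = Re (abel_sum (M n) (rad n) f t) + 2 * eps n.
  have := @Re_herglotz (M n) (rad n) (eps n) h 1 t hi.
  by rewrite mulr1 (_ : ((1 : R)%:C)%C = 1 :> C)// mul1r.
have rho1 n : (1 : R) < rad2 n / rad n.
  have /andP[rn0 rn1] := @rad_itv R n; have /andP[rr r2] := @rad2_itv R n.
  by rewrite ltr_pdivlMr// mul1r.
have F1 n t : 0 < Re (F n).[expi t].
  by apply: lt_le_trans (eps_gt0 n) (Fpos n _ _); rewrite cabs_expi rho1.
exists Y; split.
  have [|||||_] := @avg_dct R (fun n t => Re (F n).[expi t] `^ p) (fun t => h t `^ p)
     (fun=> (S + 3) `^ p).
  - move=> n; apply: measurable_powR_comp; have [] := @cmeas_horner R (F n) => //.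
  - exact: measurable_powR_comp.
  - exact: RI_cst.
  - apply: aeT1 (abel_ccvg_ae fi avgS HM) => t Tt ct.
    apply: cvg_powR => // [n|]; first exact: ltW.
    under eq_fun do rewrite FE.
    have -> : h t = Re (f t) + 2 * 0 by rewrite mulr0 addr0.
    by apply: cvgD; [exact: ccvg_Re|apply: cvgMl_tmp; exact: eps_cvg0].
  - apply: aeT_all => t Tt n; rewrite ger0_norm ?powR_ge0//.
    have b := abel_bound n t fi avgS HM fS.
    have := Re_le_cabs' (abel_sum (M n) (rad n) f t).
    have := @eps_le1 R n.
    have S0 : 0 <= S by have /andP[/le_trans h0 /h0] := hS t Tt.
    move=> e1 ra; apply: ge0_ler_powR; rewrite ?nnegrE ?(ltW p0) ?(ltW (F1 n t))//; first lra.
    by rewrite FE; lra.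
  by [].
move=> n; have F0 : Im (F n).[0] = 0.
  by rewrite herglotz0 ImD Im_fcoef_real// /= addr0.
have [H1 H2] := HA (F n) (rad2 n / rad n) (rho1 n)
  (fun z zr => lt_le_trans (eps_gt0 n) (Fpos n z zr)) F0.
have mF : cmeas (fun t => (F n).[expi t]) by exact: cmeas_horner.
have pF : inLp p (fun t => (F n).[expi t]).
  by have := @inLp_trig R p 0 (F n) p0; rewrite trig0.
have pF0 : inLp p (fun _ : R => (F n).[0]).
  by apply: (@inLp_bounded _ _ p0 _ (cabs (F n).[0])) => //; exact: cmeas_cst.
(* The analytic half is the mean of F and F(0); [positive_Lp_bound] controls both, which explains
   its second conclusion and the constant 2^p * 2A. *)
have -> : (fun t => asum (M n) (rad n) f t + (2 * eps n)%:C%C) =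
    (fun t => 2^-1 * ((F n).[expi t] + (F n).[0])).
  apply/funext => t; have := herglotz_circ (M n) (rad n) (eps n) f 1 t.
  rewrite mulr1 (_ : ((1 : R)%:C)%C = 1 :> C)// mul1r -/(F n) => ->.
  by rewrite mulrA mulVf ?mul1r// pnatr_eq0.
rewrite (NpZ _ (inLpD p0 pF pF0)).
apply: (@le_trans _ _ (1 * Np p (fun t => (F n).[expi t] + (F n).[0]))).
  rewrite ler_wpM2r ?Np_ge0//; apply: le_trans (_ : _ <= 1 `^ p) _; last by rewrite powR1.
  apply: ge0_ler_powR; rewrite ?nnegrE ?cabs_ge0 ?(ltW p0)//.
  rewrite cabsV invf_le1; last by rewrite cabs_gt0 pnatr_eq0.
  have := Re_le_cabs' (2 : C); have -> : Re 2 = 2 :> R by rewrite -[2]/(1 + 1) ReD.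
  by apply: le_trans; rewrite ler1n.
rewrite mul1r; apply: (le_trans (Np_add p0 pF pF0)).
rewrite -mulrA; apply: ler_wpM2l; first exact: powR_ge0.
have -> : Np p (fun _ : R => (F n).[0]) = Re (F n).[0] `^ p.
  rewrite /Np avg_cst; congr (_ `^ _); rewrite cabsE F0 expr0n addr0 sqrtr_sqr.
  rewrite ger0_norm// ltW// (lt_le_trans (eps_gt0 n))// Fpos// cabs0.
  by rewrite (lt_trans _ (rho1 n)).
by rewrite /Np -mulrA mulr_natl mulr2n lerD.
Qed.

Lemma asum_trig M r N q t : (size (drop_poly N q) <= M)%N ->
  asum M r (trig N q) t = (drop_poly N q).[(r%:C)%C * expi t].
Proof.
move=> dM; rewrite (@horner_coef_wide _ M.+1); last exact: leqW.
by apply: eq_bigr => k _; rewrite fcoef_trig exprMn expi_nat mulrC.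
Qed.

(** Boundedness of the projection on trigonometric polynomials [trig N q]; the factor e^(-iNt) is
    unimodular and is left out of the right-hand side. *)
Definition riesz_bound p := exists2 A, 0 <= A & forall N (q : {poly C}),
  Np p (fun t => (drop_poly N q).[expi t]) <= A * Np p (fun t => q.[expi t]).

Lemma Np_trig p N q : Np p (trig N q) = Np p (fun t => q.[expi t]).
Proof. by apply: avg_eq => t _; rewrite cabs_trig. Qed.
Lemma inLp_horner p (q : {poly C}) : 0 < p -> inLp p (fun t => q.[expi t]).
Proof. by move=> p0; have := @inLp_trig R p 0 q p0; rewrite trig0. Qed.

Lemma sum4 (V : nmodType) (a : 'I_4 -> V) :
  \sum_i a i = a 0 + a 1 + (a 2%:R + a 3%:R).
Proof.
rewrite !big_ord_recl big_ord0 addr0 addrA; congr (_ + _ + (_ + _)); congr a; exact: val_inj.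
Qed.
Lemma inLp_cst p (c : C) : 0 < p -> inLp p (fun _ : R => c).
Proof. by move=> p0; apply: (@inLp_bounded _ _ p0 _ (cabs c)) => //; exact: cmeas_cst. Qed.
Lemma inLp_asum p M r f : 0 < p -> inLp p (asum M r f).
Proof.
move=> p0; have -> : asum M r f =
    fun t => (\poly_(k < M.+1) ((r%:C)%C ^+ k * fcoef f k)).[expi t].
  apply/funext => t; rewrite horner_poly; apply: eq_bigr => k _.
  by rewrite expi_nat mulrAC.
exact: inLp_horner.
Qed.
Lemma ccvg_horner_rad (q : {poly C}) (t : R) :
  ccvg (fun n => q.[((rad n)%:C)%C * expi t]) q.[expi t].
Proof.
under eq_fun do rewrite horner_coef.
rewrite horner_coef; apply: ccvg_sum => i; apply: ccvgZ.
rewrite (_ : (fun n => _) = fun n => expi t ^+ i * (rad n ^+ i)%:C%C); last first.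
  by apply/funext => n; rewrite exprMn realcX mulrC.
rewrite -[X in ccvg _ X]mulr1; apply: ccvgZ.
apply: ccvg_ReIm => /=; last exact: cvg_cst.
rewrite -[X in _ --> X](expr1n R i).
by apply: (@continuous_cvg _ _ _ _ _ _ (fun x : R => x ^+ i)); [exact: exprn_continuous|exact: rad_cvg1].
Qed.

(** A trigonometric polynomial is a combination of the positive and negative parts of its real and
    imaginary parts, to each of which [positive_approx] applies. These parts are no longer
    trigonometric polynomials, hence the passage through Abel sums. *)
Lemma riesz_base p : 1 < p -> p <= 2 -> riesz_bound p.
Proof.
move=> p1 p2; have p0 : 0 < p by exact: lt_trans p1.
have [A A0 HA] := positive_approx p1 p2.
pose K : R := 2 `^ p; have K0 : 0 <= K by exact: powR_ge0.
exists (K * (K * (4 * A))); first by rewrite !mulr_ge0.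
move=> N q; set f := trig N q; rewrite -(Np_trig p N q) -/f.
have [S fS] := trig_bounded N q; rewrite -/f in fS.
have mf : cmeas f by exact: cmeas_trig.
have fi : CI f by exact: CI_trig.
have S0 : 0 <= S by exact: le_trans (cabs_ge0 _) (fS 0).
have [M HM] := orders_exist (size (drop_poly N q)) S0.
pose u (i : 'I_4) t := if i == 0 then Re (f t) else if i == 1 then - Re (f t)
  else if i == 2%:R then Im (f t) else - Im (f t).
pose c (i : 'I_4) : C := if i == 0 then 1 else if i == 1 then -1
  else if i == 2%:R then Complex 0 1 else - Complex 0 1.
pose h i t := Num.max (u i t) 0.
have mu' i : measurable_fun T (u i).
  have [mr mi] := mf; rewrite /u; case: (i == 0) => //; case: (i == 1); first exact: measurable_funN.
  by case: (i == 2%:R) => //; exact: measurable_funN.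
have mh i : measurable_fun T (h i).
  by apply: measurable_maxr => //; exact: measurable_cst.
have ub i t : u i t <= cabs (f t).
  have := Re_le_cabs (f t); have := Im_le_cabs (f t); rewrite !ler_norml.
  by move=> /andP[a1 a2] /andP[b1 b2]; rewrite /u; case: (i == 0); [|case: (i == 1); [|case: (i == 2%:R)]]; lra.
have h_ge0 i t : 0 <= h i t by rewrite le_max lexx orbT.
have hle i t : h i t <= cabs (f t) by rewrite ge_max ub cabs_ge0.
have hS i t : T t -> 0 <= h i t <= S by move=> _; rewrite h_ge0 (le_trans (hle i t)).
have fE t : f t = \sum_i c i * (h i t)%:C%C.
  rewrite !big_ord_recl big_ord0 /c /h /u /=.
  have mx (x : R) : Num.max x 0 - Num.max (- x) 0 = x.
    by rewrite /Num.max; do 2 case: ltP => ?; lra.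
  apply: complex_ext; rewrite !(ReD, ImD, ReM, ImM, ReN, ImN) /=.
    by rewrite -[LHS]mx; ring.
  by rewrite -[LHS]mx; ring.
have hi i : CI (fun t => (h i t)%:C%C : C).
  apply: (@CI_bounded _ _ S); first exact: cmeas_real.
  by move=> t Tt; have /andP[a b] := hS i t Tt; rewrite cabs_real ger0_norm.
have [Y HY] := choice (fun i => HA (h i) S M (mh i) (hS i) (fun n => (HM n).2)).
pose G n t := \sum_i c i * (asum (M n) (rad n) (fun t => (h i t)%:C%C) t + (2 * eps n)%:C%C).
have GE n t : G n t = (drop_poly N q).[((rad n)%:C)%C * expi t].
  rewrite -(asum_trig (rad n) t (HM n).1) -/f.
  have -> : f = fun t => \sum_i c i * (h i t)%:C%C by apply/funext.
  transitivity (\sum_i c i * asum (M n) (rad n) (fun t => (h i t)%:C%C) t).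
    rewrite /G (eq_bigr (fun i => c i * asum (M n) (rad n) (fun t => (h i t)%:C%C) t +
        c i * (2 * eps n)%:C%C)); last first.
      by move=> i _; rewrite mulrDr.
    (* The coefficients 1, -1, i, -i have sum zero, so the shifts by 2 [eps n] cancel. *)
    rewrite big_split /= -mulr_suml [X in _ + X * _](_ : _ = 0) ?mul0r ?addr0//.
    by rewrite !big_ord_recl big_ord0 /c /=; ring.
  rewrite /asum.
  under eq_bigr do rewrite mulr_sumr.
  rewrite exchange_big /=; apply: eq_bigr => k _.
  rewrite fcoef_sum; last by move=> i; exact: CIZ.
  rewrite mulr_sumr; apply: eq_bigr => i _; rewrite fcoefZ//; ring.
have pa i n : inLp p (fun t => c i * (asum (M n) (rad n) (fun t => (h i t)%:C%C) t + (2 * eps n)%:C%C)).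
  by apply: inLpZ => //; apply: inLpD => //; [exact: inLp_asum|exact: inLp_cst].
have c1 i : cabs (c i) = 1.
  have cI : cabs (Complex 0 1 : C) = 1 by rewrite cabsE /= expr0n expr1n add0r sqrtr1.
  by rewrite /c; case: (i == 0); [|case: (i == 1); [|case: (i == 2%:R)]]; rewrite ?cabsN ?cabs1.
have Gb n : Np p (G n) <= K * (K * (A * \sum_i Y i n)).
  have b i : Np p (fun t => c i * (asum (M n) (rad n) (fun t => (h i t)%:C%C) t + (2 * eps n)%:C%C)) <= A * Y i n.
    rewrite NpZ ?c1 ?powR1 ?mul1r; first exact: (HY i).2.
    by apply: inLpD => //; [exact: inLp_asum|exact: inLp_cst].
  rewrite (_ : G n = fun t => (c 0 * (asum (M n) (rad n) (fun t => (h 0 t)%:C%C) t + (2 * eps n)%:C%C)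
      + c 1 * (asum (M n) (rad n) (fun t => (h 1 t)%:C%C) t + (2 * eps n)%:C%C))
      + (c 2%:R * (asum (M n) (rad n) (fun t => (h 2%:R t)%:C%C) t + (2 * eps n)%:C%C)
      + c 3%:R * (asum (M n) (rad n) (fun t => (h 3%:R t)%:C%C) t + (2 * eps n)%:C%C))); last first.
    by apply/funext => t; rewrite /G sum4.
  apply: (le_trans (Np_add p0 (inLpD p0 (pa _ _) (pa _ _)) (inLpD p0 (pa _ _) (pa _ _)))).
  rewrite -/K ler_wpM2l// sum4.
  apply: (le_trans (lerD (Np_add p0 (pa _ _) (pa _ _)) (Np_add p0 (pa _ _) (pa _ _)))).
  by rewrite -/K -mulrDr ler_wpM2l// !mulrDr !lerD.
have Gcv : Np p (G n) @[n --> \oo] --> Np p (fun t => (drop_poly N q).[expi t]).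
  pose d := drop_poly N q.
  have [|||||_] := @Np_dct R p p0 G (fun t => d.[expi t]) (fun=> ((\sum_(i < size d) cabs d`_i)%:C)%C).
  - move=> n; rewrite (_ : G n = fun t => \sum_i c i *
        (asum (M n) (rad n) (fun t => (h i t)%:C%C) t + (2 * eps n)%:C%C))//.
    by apply: cmeas_sum => i; exact: inLp_cmeas (pa i n).
  - exact: cmeas_horner.
  - exact: inLp_cst.
  - apply: aeT_all => t _; under eq_fun do rewrite GE.
    exact: ccvg_horner_rad.
  - apply: aeT_all => t _ n; rewrite GE -/d cabs_real ger0_norm ?sumr_ge0// => [|i _]; last exact: cabs_ge0.
    apply: horner_bound; rewrite cabsM cabs_expi mulr1 cabs_real.
    by have /andP[a b] := @rad_itv R n; rewrite ger0_norm ltW.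
  by [].
have avh i : avg (fun t => h i t `^ p) <= Np p f.
  apply: avg_le.
  - apply: (@RI_bounded _ _ (S `^ p)); first exact: measurable_powR_comp.
    move=> t Tt; rewrite ger0_norm ?powR_ge0//; have /andP[a b] := hS i t Tt.
    by apply: ge0_ler_powR; rewrite ?nnegrE// ltW.
  - by apply: inLp_RI; exact: inLp_trig.
  - move=> t _; apply: ge0_ler_powR; rewrite ?nnegrE ?cabs_ge0 ?h_ge0 ?hle//; exact: ltW.
apply: (@le_trans _ _ (K * (K * (A * \sum_i avg (fun t => h i t `^ p))))).
  apply: (ler_cvg_to Gcv); last by apply: nearW; exact: Gb.
  apply: cvgMl_tmp; apply: cvgMl_tmp; apply: cvgMl_tmp; rewrite sum4.
  rewrite (_ : (fun n => \sum_i Y i n) = fun n => Y 0 n + Y 1 n + (Y 2%:R n + Y 3%:R n)); last first.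
    by apply/funext => n; rewrite sum4.
  by apply: cvgD; apply: cvgD; exact: (HY _).1.
rewrite -!mulrA !ler_wpM2l// [4 * _]mulrCA ler_wpM2l//.
apply: (le_trans (ler_sum _ (fun i _ => avh i))).
by rewrite sumr_const card_ord -[X in X <= _]mulr_natl.
Qed.
End Riesz.

(** * M. Riesz' theorem for all exponents and on the whole of L^p *)

Section RieszProjection.
Context {R : realType}.
Local Notation C := R[i].
Local Notation T := (@Tdom R).
Implicit Types (f g : R -> C) (p e r : R).

Lemma Np_sqr p f : Np (2 * p) f = Np p (fun t => f t * f t).
Proof.
by apply: avg_eq => t _; rewrite cabsM -expr2 -powR_mulrn ?cabs_ge0// powRrM.
Qed.

(* The squares of the two halves of [q] have disjoint spectra. *)
Lemma drop_poly_sqr N (q : {poly C}) (d := drop_poly N q) :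
  drop_poly (N + N) ((2 *: (d * 'X^N) - q) * q) = d * d.
Proof.
have := poly_take_drop N q; rewrite -/d; set s := take_poly N q => <-.
have -> : (2 *: (d * 'X^N) - (s + d * 'X^N)) * (s + d * 'X^N) =
    - (s * s) + d * d * 'X^(N + N) by rewrite exprD -mul_polyC polyC_natr; ring.
rewrite drop_polyDMXn// size_polyN (leq_trans (size_polyMleq _ _))//.
by apply: (leq_trans (leq_pred _)); rewrite leq_add// size_take_poly.
Qed.

(** By [drop_poly_sqr] the p-average of |d|^2 is at most A times that of W = (2d - q) q, up to a
    unimodular factor in [d]. As |W| <= l |d|^2 + (1 + 1/l) |q|^2, a small [l] lets the term in [d]
    be absorbed on the left. *)
Lemma riesz_double p : 1 < p -> riesz_bound p -> @riesz_bound R (2 * p).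
Proof.
move=> p1 [A A0 HA]; have p0 : 0 < p by exact: lt_trans p1.
have p20 : 0 < 2 * p by rewrite mulr_gt0.
pose K : R := 2 `^ p; have K0 : 0 < K by exact: powR_gt0.
(* Chosen so that A K l^p <= 1/2; the A + 1 avoids division by zero. *)
pose l : R := (2 * (A + 1) * K)^-1 `^ p^-1.
have a0 : 0 < 2 * (A + 1) * K by rewrite !mulr_gt0// ltr_wpDl.
have l0 : 0 < l by rewrite powR_gt0// invr_gt0.
have lp : l `^ p = (2 * (A + 1) * K)^-1.
  by rewrite /l -powRrM mulVf ?gt_eqF// powRr1// invr_ge0 ltW.
have AKl : A * (K * l `^ p) <= 2^-1.
  have A1 : 0 < A + 1 by rewrite ltr_wpDl.
  have -> : A * (K * l `^ p) = A / (2 * (A + 1)).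
    by rewrite lp; field; rewrite !gt_eqF.
  by rewrite ler_pdivrMr ?mulr_gt0//; lra.
have K1 : 0 <= (1 + l^-1) `^ p by exact: powR_ge0.
exists (2 * (A * K * (1 + l^-1) `^ p)).
  by rewrite !mulr_ge0// ltW.
move=> N q; set d := drop_poly N q; set W := (2 *: (d * 'X^N) - q) * q.
have ip0 (r : {poly C}) : RI (fun t => (cabs r.[expi t] ^+ 2) `^ p).
  under eq_fun do rewrite -powR_mulrn ?cabs_ge0// -powRrM.
  by apply: inLp_RI; exact: inLp_horner.
have ip (r : {poly C}) c := RIZ c (ip0 r).
have NE (r : {poly C}) : Np (2 * p) (fun t => r.[expi t]) = avg (fun t => (cabs r.[expi t] ^+ 2) `^ p).
  by apply: avg_eq => t _; rewrite -powR_mulrn ?cabs_ge0// -powRrM.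
have Wb : Np p (fun t => W.[expi t]) <= K * (l `^ p * Np (2 * p) (fun t => d.[expi t]) +
    (1 + l^-1) `^ p * Np (2 * p) (fun t => q.[expi t])).
  rewrite !NE -!avgZ; [|exact: ip0..].
  rewrite -avgD ?ip// -avgZ; last by apply: RID; exact: ip.
  apply: avg_le; [by apply: inLp_RI; exact: inLp_horner|by apply: RIZ; apply: RID; exact: ip|] => t _.
  rewrite /W hornerM hornerD hornerN hornerZ hornerM hornerXn cabsM.
  set D := d.[_]; set Q := q.[_]; set E := _ ^+ N.
  have E1 : cabs E = 1 by rewrite /E cabsX cabs_expi expr1n.
  have hb : cabs (2 * (D * E) - Q) <= 2 * cabs D + cabs Q.
    apply: (le_trans (cabsB _ _)); rewrite !cabsM E1 mulr1.
    rewrite (_ : cabs 2 = 2)//; have := @cabs_real R 2; rewrite ger0_norm// => <-.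
    by congr cabs; apply: complex_ext; rewrite -[2]/(1 + 1) ?ReD ?ImD//= addr0.
  rewrite -!powRM ?exprn_ge0 ?cabs_ge0 ?addr_ge0 ?invr_ge0 ?(ltW l0)//.
  apply: le_trans (powR_add (ltW p0) _ _); rewrite ?mulr_ge0 ?exprn_ge0 ?cabs_ge0 ?addr_ge0 ?invr_ge0 ?(ltW l0)//.
  move: (cabs_ge0 D) (cabs_ge0 Q) (cabs_ge0 (2 * (D * E) - Q)) hb.
  set x := cabs D; set y := cabs Q; set w := cabs _ => x0 y0 w0 hb.
  have h : l * x ^+ 2 + l^-1 * y ^+ 2 - 2 * (x * y) = l^-1 * (l * x - y) ^+ 2.
    by field; rewrite gt_eqF.
  have h2 : 0 <= l^-1 * (l * x - y) ^+ 2 by rewrite mulr_ge0 ?sqr_ge0// invr_ge0 ltW.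
  apply: ge0_ler_powR; rewrite ?nnegrE ?(ltW p0) ?mulr_ge0//.
    by rewrite addr_ge0 ?mulr_ge0 ?exprn_ge0 ?addr_ge0 ?invr_ge0 ?(ltW l0).
  have : w * y <= (2 * x + y) * y by rewrite ler_wpM2r.
  move: h2; rewrite -h; rewrite !expr2; lra.
have := HA (N + N)%N W; rewrite drop_poly_sqr.
have -> : Np p (fun t => (drop_poly N q * drop_poly N q).[expi t]) = Np (2 * p) (fun t => d.[expi t]).
  by rewrite Np_sqr; apply: avg_eq => t _; rewrite hornerM.
move: Wb; set X := Np (2 * p) _; set Y := Np (2 * p) _; set Z := Np p _ => Wb XZ.
have X0 : 0 <= X by exact: Np_ge0.
have : A * Z <= A * (K * (l `^ p * X + (1 + l^-1) `^ p * Y)) by rewrite ler_wpM2l.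
have : A * (K * l `^ p) * X <= 2^-1 * X by rewrite ler_wpM2r.
move: XZ; clear; lra.
Qed.

(** An exponent in (2, 2^(n+2)] is twice one in (1, 2^(n+1)]. *)
Lemma riesz p : 1 < p -> @riesz_bound R p.
Proof.
have H n : forall p, 1 < p -> p <= 2 ^+ n.+1 -> @riesz_bound R p.
  elim: n => [|n IH] q q1 q2; first exact: riesz_base.
  have [q3|q3] := leP q 2; first exact: riesz_base.
  have -> : q = 2 * (q / 2) by rewrite mulrC divfK.
  by apply: riesz_double; [lra|apply: IH; [lra|move: q2; rewrite exprS; lra]].
move=> p1; apply: (H (Num.truncn p)) => //.
apply: ltW; apply: lt_trans (truncnS_gt p) _.
by rewrite -natrX ltr_nat ltn_expl.
Qed.

Lemma cvg_fast p : 0 < p -> (fun j => (2^-1 ^+ j) `^ p : R) @ \oo --> (0 : R).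
Proof.
move=> p0; have pn : p != 0 by rewrite gt_eqF.
rewrite -(powR0 pn); apply: cvg_powR => //.
by apply: cvg_expr; rewrite gtr0_norm ?invr_gt0// invf_lt1// ltr1n.
Qed.

Lemma fcoef_near (g : nat -> R -> C) f (k : int) (p : R) : 1 < p ->
  inLp p f -> (forall j, inLp p (g j)) ->
  (forall j, Np p (fun t => f t - g j t) <= (2^-1 ^+ j) `^ p) ->
  ccvg (fun j => fcoef (g j) k) (fcoef f k).
Proof.
move=> p1 fp gp fg; apply: (@ccvg_le R (fun j => 2 * 2^-1 ^+ j)) => [j|].
  rewrite cabsC -fcoefB; [|exact: (inLp_CI p1)..].
  have dp := inLpB (lt_trans ltr01 p1) fp (gp j).
  by rewrite (le_trans (cabs_fcoef _ (inLp_CI p1 dp)))// (avg_le_fast p1).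
rewrite -[X in _ --> X](mulr0 2); apply: cvgMl_tmp; apply: cvg_expr.
by rewrite gtr0_norm ?invr_gt0// invf_lt1// ltr1n.
Qed.

(** Rapidly converging trigonometric approximations have analytic halves that converge by
    [Lp_complete]; coefficients and the norm bound pass to the limit. *)
Lemma riesz_Lp p : 1 < p -> exists2 A : R, 0 <= A & forall f, inLp p f ->
  exists g, [/\ inHp p g, forall k : int, 0 <= k -> fcoef g k = fcoef f k &
    Np p g <= A * Np p f].
Proof.
move=> p1; have p0 : 0 < p by exact: lt_trans p1.
have [A A0 HA] := riesz p1; pose K : R := 2 `^ p.
have K1 : 1 <= K by rewrite /K -[leLHS](powRr0 (2 : R)) ler_powR ?ler1n// ltW.
have K0 : 0 < K by exact: lt_le_trans K1.
exists (K * (A * K)); first by rewrite !mulr_ge0// ltW.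
move=> f fp; have fi := inLp_CI p1 fp.
have A1 : 1 <= A + 1 by rewrite lerDr.
(* Makes A * K * 2 [e j] at most (2^-j)^p, the rate that [Lp_complete] asks of the analytic
   halves. *)
pose e j : R := (2^-1 ^+ j) `^ p / (2 * K * (A + 1)).
have e0 j : 0 < e j.
  by rewrite divr_gt0 ?powR_gt0 ?exprn_gt0// ?mulr_gt0// (lt_le_trans ltr01).
have pw j m : (j <= m)%N -> (2^-1 ^+ m) `^ p <= (2^-1 ^+ j) `^ p :> R.
  move=> jm; apply: ge0_ler_powR; rewrite ?nnegrE ?exprn_ge0 ?(ltW p0)//.
  by apply: ler_wiXn2l; rewrite // invf_le1// ler1n.
have e_le j m : (j <= m)%N -> e m <= e j.
  move=> jm; rewrite ler_wpM2r ?pw// invr_ge0 !mulr_ge0// ?(ltW K0)//.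
  exact: le_trans A1.
have e_fast j : e j <= (2^-1 ^+ j) `^ p.
  rewrite ler_pdivrMr; last by rewrite !mulr_gt0// (lt_le_trans ltr01).
  rewrite ler_peMr ?powR_ge0// -mulrA.
  have := mulr_ege1 K1 A1; lra.
have [N HN] := choice (fun j => trig_dense p0 fi fp (e0 j)).
have [q Hq] := choice HN.
pose s j := trig (N j) (q j); pose g j t := (drop_poly (N j) (q j)).[expi t].
have sp j : inLp p (s j) by exact: inLp_trig.
have gp j : inLp p (g j) by exact: inLp_horner.
have gB m j : Np p (fun t => g m t - g j t) <= A * Np p (fun t => s m t - s j t).
  (* Both trigonometric polynomials are rewritten with the common shift N m + N j, so that their
     difference is again of the form [trig]. *)
  pose Q := q m * 'X^(N j) - q j * 'X^(N m).
  have := HA (N m + N j)%N Q; rewrite -(Np_trig p (N m + N j) Q) /Q.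
  rewrite (_ : trig _ _ = fun t => s m t - s j t); last first.
    by apply/funext => t; rewrite trigB trig_shift addnC trig_shift.
  rewrite (_ : (fun t => _.[_]) = fun t => g m t - g j t)//.
  apply/funext => t; rewrite raddfB /= drop_shift addnC drop_shift.
  by rewrite hornerD hornerN.
have gm j m : (j <= m)%N -> Np p (fun t => g m t - g j t) <= (2^-1 ^+ j) `^ p.
  move=> jm; apply: (le_trans (gB _ _)).
  have h : Np p (fun t => s m t - s j t) <= K * (2 * e j).
    apply: (le_trans (Np_sub_add p0 (sp m) fp (sp j))); rewrite ler_wpM2l ?(ltW K0)//.
    rewrite NpC mulr_natl mulr2n lerD// ?ltW//; first exact: lt_le_trans (Hq m) (e_le _ _ jm).
    exact: Hq.
  apply: (@le_trans _ _ (A * (K * (2 * e j)))); first by rewrite ler_wpM2l.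
  rewrite /e; set P := _ `^ p.
  have -> : A * (K * (2 * (P / (2 * K * (A + 1))))) = A / (A + 1) * P.
    by field; rewrite !gt_eqF// (lt_le_trans ltr01).
  by rewrite ler_piMl ?powR_ge0// ler_pdivrMr ?(lt_le_trans ltr01)// mul1r lerDl.
have [h [hp hg _]] := Lp_complete p1 gp gm; exists h.
have gc (k : int) := fcoef_near k p1 hp gp hg.
split.
- split => // k k0; have := gc k.
  rewrite (_ : (fun j => fcoef (g j) k) = fun=> 0); last first.
    by apply/funext => j; rewrite fcoef_horner; case: k k0.
  by move=> c0; rewrite (ccvg_unique c0 (ccvg_cst _)).
- case=> [k|//] _; have sc := fcoef_near k p1 fp sp (fun j => le_trans (ltW (Hq j)) (e_fast j)).
  apply: ccvg_unique (gc k) _; move: sc.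
  rewrite (_ : (fun j => fcoef (s j) k) = fun j => fcoef (g j) k)//.
  by apply/funext => j; rewrite fcoef_trig fcoef_horner.
- pose w j := K * ((2^-1 ^+ j) `^ p + A * (K * (Np p f + (2^-1 ^+ j) `^ p))).
  have wb j : Np p h <= w j.
    have := Np_sub_add p0 hp (gp j) (inLp_cst 0 p0).
    under [X in Np p X <= _]eq_fun do rewrite subr0.
    under [X in _ + Np p X]eq_fun do rewrite subr0.
    move=> /le_trans; apply; rewrite ler_wpM2l ?(ltW K0)// lerD//.
    apply: (le_trans (HA _ _)); rewrite -(Np_trig p (N j)) ler_wpM2l//.
    have := Np_sub_add p0 (sp j) fp (inLp_cst 0 p0).
    under [X in Np p X <= _]eq_fun do rewrite subr0.
    under [X in _ + Np p X]eq_fun do rewrite subr0.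
    move=> /le_trans; apply; rewrite ler_wpM2l ?(ltW K0)// addrC lerD// NpC.
    exact: le_trans (ltW (Hq j)) (e_fast j).
  have pc := cvg_fast p0.
  have wc : w @ \oo --> K * (0 + A * (K * (Np p f + 0))).
    apply: cvgMl_tmp; apply: cvgD => //; apply: cvgMl_tmp; apply: cvgMl_tmp.
    by apply: cvgD => //; exact: cvg_cst.
  have := @ler_cvg_to _ _ _ _ (cst (Np p h)) w _ _ (cvg_cst _) wc.
  rewrite add0r addr0 -!mulrA; apply; exact: nearW.
Qed.
End RieszProjection.

(** * Boundary values of bounded analytic functions *)

Section BoundaryValues.
Context {R : realType}.
Local Notation C := R[i].
Local Notation T := (@Tdom R).
Local Notation Re := complex.Re.
Local Notation Im := complex.Im.
Implicit Types (f g h : R -> C) (b : C -> C) (e r t : R).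

Let p0 : 0 < (2 : R). Proof. by []. Qed.
Let p1 : 1 < (2 : R). Proof. by rewrite ltr1n. Qed.

Lemma Np2E f : Np 2 f = avg (fun t => cabs (f t) ^+ 2).
Proof. by apply: avg_eq => t _; rewrite powR_mulrn// cabs_ge0. Qed.
Lemma RI_sqr f : inLp 2 f -> RI (fun t => cabs (f t) ^+ 2).
Proof.
move=> fp; have := inLp_RI fp; congr RI; apply/funext => t.
by rewrite powR_mulrn// cabs_ge0.
Qed.

Lemma Np2_sub f c (n : int) : inLp 2 f ->
  Np 2 (fun t => f t - c * expi (n%:~R * t)) =
  Np 2 f - 2 * Re (conjc c * fcoef f n) + cabs c ^+ 2.
Proof.
move=> fp; have fi := inLp_CI p1 fp.
have wi : CI (fun t => conjc c * (f t * expi ((- n)%:~R * t))).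
  by apply: CIZ; exact: CI_mul_expi.
have -> : Re (conjc c * fcoef f n) = avg (fun t => Re (conjc c * (f t * expi ((- n)%:~R * t)))).
  rewrite fcoefE -cintZ//; exact: CI_mul_expi.
rewrite !Np2E -[cabs c ^+ 2]avg_cst -mulNr -avgZ; last exact: wi.1.
rewrite -avgD; [|exact: RI_sqr|by apply: RIZ; exact: wi.1].
rewrite -avgD; [|by apply: RID; [exact: RI_sqr|apply: RIZ; exact: wi.1]|exact: RI_cst].
apply: avg_eq => t _ /=.
have -> : (- n)%:~R * t = - (n%:~R * t) :> R by rewrite mulrNz mulNr.
rewrite expiN; have := cos2Dsin2 (n%:~R * t); rewrite /expi.
move: (cos _) (sin _) (f t) => x y [u v] xy; clear wi.
case: c => a b; rewrite !cabs_sqr !(ReB, ImB, ReM, ImM, ReJ, ImJ) /=.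
(* Inserting cos^2 + sin^2 = 1 makes the expansion of the square a polynomial identity. *)
have -> : a ^+ 2 + b ^+ 2 = (x ^+ 2 + y ^+ 2) * (a ^+ 2 + b ^+ 2) by rewrite xy mul1r.
ring.
Qed.

Definition fsum (a : nat -> C) n t : C := \sum_(k < n) a k * expi (k%:R * t).

Lemma fsumS a n t : fsum a n.+1 t = fsum a n t + a n * expi (n%:R * t).
Proof. by rewrite /fsum big_ord_recr. Qed.
Lemma inLp_fsum p a n : 0 < p -> inLp p (fsum a n).
Proof.
move=> q0; elim: n => [|n IH].
  by rewrite (_ : fsum a 0 = fun=> 0); [exact: inLp_cst|apply/funext => t; rewrite /fsum big_ord0].
rewrite (_ : fsum a n.+1 = fun t => fsum a n t + a n * expi (n%:R * t)); last first.
  by apply/funext => t; rewrite fsumS.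
apply: (inLpD q0 IH); apply: inLpZ.
apply: (@inLp_bounded _ _ q0 _ 1); first exact: cmeas_expi.
by move=> t _; rewrite cabs_expi.
Qed.
Lemma fcoef_fsum a n (k : int) :
  fcoef (fsum a n) k = if k is Posz j then (if (j < n)%N then a j else 0) else 0.
Proof.
rewrite fcoef_sum; last by move=> i; apply: CIZ; exact: CI_expi.
rewrite (eq_bigr (fun i : 'I_n => a i * (k == i%:Z)%:R)); last first.
  by move=> i _; rewrite fcoefZ ?(fcoef_expi i%:Z)//; exact: CI_expi.
case: k => [j|j]; last by rewrite big1// => i _; rewrite mulr0.
case: ltnP => [jn|nj].
  rewrite (bigD1 (Ordinal jn))//= eqxx mulr1 big1 ?addr0// => i ij.
  by rewrite eqz_nat eq_sym (_ : (_ == j) = false) ?mulr0//; apply/negbTE.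
rewrite big1// => i _; rewrite eqz_nat.
by rewrite gtn_eqF ?mulr0// (leq_trans (ltn_ord i)).
Qed.

(** One frequency is removed at a time: the n-th coefficient of the remainder is still that of [f],
    and [Np2_sub] with this coefficient lowers the average by its square. *)
Lemma bessel f n : inLp 2 f ->
  Np 2 (fun t => f t - fsum (fun k => fcoef f k) n t) =
  Np 2 f - \sum_(k < n) cabs (fcoef f k) ^+ 2.
Proof.
move=> fp; have fi := inLp_CI p1 fp.
elim: n => [|n IH].
  rewrite big_ord0 subr0; congr Np; apply/funext => t.
  by rewrite /fsum big_ord0 subr0.
rewrite big_ord_recr /= opprD addrA -IH.
set h := fun t => f t - fsum _ n t in IH *.
have hp : inLp 2 h := inLpB p0 fp (inLp_fsum _ n p0).
rewrite (_ : (fun t => _) = fun t => h t - fcoef f n * expi ((n%:Z)%:~R * t)); last first.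
  by apply/funext => t; rewrite fsumS /h opprD addrA.
rewrite Np2_sub// fcoefB//; last by apply: (inLp_CI p1); exact: inLp_fsum.
rewrite fcoef_fsum ltnn subr0 cabs_sqr ReM ReJ ImJ; ring.
Qed.
Lemma bessel_le f n : inLp 2 f -> \sum_(k < n) cabs (fcoef f k) ^+ 2 <= Np 2 f.
Proof. by move=> fp; rewrite -subr_ge0 -bessel// Np_ge0. Qed.

(** Apply [bessel] to [fsum a m] itself; at order [m] the remainder vanishes, which identifies its
    own average as the full sum of squares. *)
Lemma Np2_fsum a n m : (n <= m)%N -> Np 2 (fun t => fsum a m t - fsum a n t) =
  \sum_(k < m) cabs (a k) ^+ 2 - \sum_(k < n) cabs (a k) ^+ 2.
Proof.
have H k : (k <= m)%N -> Np 2 (fun t => fsum a m t - fsum a k t) =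
    Np 2 (fsum a m) - \sum_(j < k) cabs (a j) ^+ 2.
  move=> km; have e (j : 'I_k) : fcoef (fsum a m) j = a j.
    by rewrite fcoef_fsum (leq_trans (ltn_ord j)).
  have -> : \sum_(j < k) cabs (a j) ^+ 2 = \sum_(j < k) cabs (fcoef (fsum a m) j) ^+ 2.
    by apply: eq_bigr => j _; rewrite e.
  rewrite -(bessel k (inLp_fsum a m p0)); congr Np; apply/funext => t; congr (_ - _).
  by apply: eq_bigr => j _; rewrite e.
move=> nm; rewrite H//.
have := H m (leqnn m); under [X in Np 2 X = _]eq_fun do rewrite subrr.
rewrite {1}/Np cabs0 powR0 ?gt_eqF// avg_cst => /eqP.
by rewrite eq_sym subr_eq0 => /eqP ->.
Qed.

Lemma ccvg_eventually (u v : nat -> C) l N : (forall n, (N <= n)%N -> u n = v n) ->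
  ccvg u l -> ccvg v l.
Proof.
move=> uv; apply: cvg_trans; apply: near_eq_cvg.
by exists N => // n /= Nn; rewrite uv.
Qed.

(** Partial sums along indices with rapidly decreasing tails converge by [Lp_complete]. The 4 is the
    factor 2^2 of [Np_add]. *)
Lemma riesz_fischer (a : nat -> C) (E : R) : (forall n, \sum_(k < n) cabs (a k) ^+ 2 <= E) ->
  exists g, [/\ inLp 2 g, forall k : nat, fcoef g k = a k,
    forall k : int, k < 0 -> fcoef g k = 0 & Np 2 g <= 4 * E].
Proof.
move=> aE; pose A n := \sum_(k < n) cabs (a k) ^+ 2.
have A_mono m n : (m <= n)%N -> A m <= A n.
  move=> mn; rewrite -subr_ge0 -Np2_fsum//; exact: Np_ge0.
have A_cvg : cvgn A.
  apply: nondecreasing_is_cvgn; first by move=> m n; exact: A_mono.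
  by exists E => _ [n _ <-]; exact: aE.
have AL n : A n <= limn A by exact: nondecreasing_cvgn_le.
have tail (j : nat) : exists N : nat, (j <= N)%N /\ limn A - A N <= (2^-1 ^+ j) `^ 2.
  have e0 : 0 < (2^-1 ^+ j) `^ 2 :> R by rewrite powR_gt0// exprn_gt0.
  have /cvgrPdist_le/(_ _ e0)[N _ HN] := A_cvg.
  exists (maxn j N); split; first exact: leq_maxl.
  by apply: (le_trans (ler_norm _)); apply: HN => /=; exact: leq_maxr.
have [s0 Hs0] := choice tail.
(* A running maximum makes the index sequence monotone without losing the tail bounds. *)
pose s j := (\max_(i < j.+1) s0 i)%N.
have s_ge j : (s0 j <= s j)%N by rewrite /s (leq_bigmax (Ordinal (ltnSn j))).
have s_mono i j : (i <= j)%N -> (s i <= s j)%N.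
  move=> ij; apply/bigmax_leqP => k _.
  by rewrite /s (leq_bigmax (Ordinal (leq_trans (ltn_ord k) (ij : (i.+1 <= j.+1)%N)))).
have gp j : inLp 2 (fsum a (s j)) by exact: inLp_fsum.
have [j m jm|g [gi gg _]] := Lp_complete p1 gp.
  rewrite Np2_fsum ?s_mono//; apply: le_trans (Hs0 j).2.
  by apply: lerB; [exact: AL|exact: A_mono].
have gc (k : int) := fcoef_near k p1 gi gp gg.
exists g; split => //.
- move=> k; apply: ccvg_unique (gc k) _; apply: (ccvg_eventually (N := k.+1)) (ccvg_cst (a k)).
  move=> n kn; rewrite fcoef_fsum ifT//; apply: leq_trans (s_ge n).
  exact: leq_trans kn (Hs0 n).1.
- move=> k k0; apply: ccvg_unique (gc k) _; apply: (ccvg_eventually (N := 0%N)) (ccvg_cst 0).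
  by move=> n _; rewrite fcoef_fsum; case: k k0.
- have H j : Np 2 g <= 4 * ((2^-1 ^+ j) `^ 2 + E).
    have := Np_add p0 (inLpB p0 gi (gp j)) (gp j).
    under [X in Np 2 X <= _]eq_fun do rewrite subrK.
    rewrite powR_mulrn// -natrX => /le_trans; apply.
    rewrite ler_wpM2l// lerD//.
    have := @Np2_fsum a 0 (s j) (leq0n _); rewrite big_ord0 subr0.
    by rewrite (_ : (fun t => _) = fsum a (s j)) => [->//|]; apply/funext => t; rewrite [fsum a 0 t]big_ord0 subr0.
  have c : (fun j => 4 * ((2^-1 ^+ j) `^ 2 + E)) @ \oo --> 4 * (0 + E).
    by apply: cvgMl_tmp; apply: cvgD; [exact: (cvg_fast p0)|exact: cvg_cst].
  have := @ler_cvg_to _ _ _ _ (cst (Np 2 g)) _ _ _ (cvg_cst _) c.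
  by rewrite add0r; apply; exact: nearW.
Qed.
End BoundaryValues.

(** * Fatou's theorem on radial limits *)

Section Fatou.
Context {R : realType}.
Local Notation C := R[i].
Local Notation T := (@Tdom R).
Local Notation Re := complex.Re.
Local Notation Im := complex.Im.
Implicit Types (f g h : R -> C) (b : C -> C) (e r t : R).

Definition radial b t (l : C) := forall e, 0 < e ->
  exists2 r0, 0 <= r0 < 1 & forall r, r0 < r < 1 -> cabs (circ b r t - l) < e.

Lemma eq_pint r1 r2 g h t : 0 <= r1 < 1 -> 0 <= r2 < 1 -> CI g -> CI h ->
  (forall M, abel_sum M r1 g t = abel_sum M r2 h t) -> pint r1 g t = pint r2 h t.
Proof.
move=> r1i r2i gi hi E; apply/eqP; rewrite -subr_eq0 -cabs_eq0 eq_le cabs_ge0 andbT.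
apply/ler_addgt0Pl => e e0; rewrite addr0; have e20 : 0 < e / 2 by rewrite divr_gt0.
have [N1 H1] := geometric_small (2 / (1 - r1) * avg (fun s => cabs (g s))) r1i e20.
have [N2 H2] := geometric_small (2 / (1 - r2) * avg (fun s => cabs (h s))) r2i e20.
pose M := maxn N1 N2.
have a1 := pint_abel M t r1i gi; have a2 := pint_abel M t r2i hi.
have -> : pint r1 g t - pint r2 h t = (pint r1 g t - abel_sum M r1 g t) -
    (pint r2 h t - abel_sum M r2 h t) by rewrite E; ring.
rewrite (le_trans (cabsB _ _))// (splitr e) lerD//.
  apply: (le_trans a1); have := H1 M.+1 (leqW (leq_maxl _ _)).
  by congr (_ <= _); ring.
apply: (le_trans a2); have := H2 M.+1 (leqW (leq_maxr _ _)).
by congr (_ <= _); ring.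
Qed.

Lemma circ_continuous b r t : holo_disc b -> 0 <= r < 1 ->
  {for t, continuous (fun s => Re (circ b r s))} /\
  {for t, continuous (fun s => Im (circ b r s))}.
Proof.
move=> hb /andP[r0 r1].
have H e : 0 < e -> \forall s \near t, cabs (circ b r s - circ b r t) < e.
  move=> e0; have [|d [d0 Hd]] := holo_cont (z := (r%:C)%C * expi t) hb _ e0.
    by rewrite cabs_circ.
  have d20 : 0 < d / 2 by rewrite divr_gt0.
  have /cvgrPdist_lt/(_ _ d20) ncos := @continuous_cos R t.
  have /cvgrPdist_lt/(_ _ d20) nsin := @continuous_sin R t.
  near=> s; apply: Hd; rewrite -mulrBr cabsM cabs_real ger0_norm//.
  apply: (@le_lt_trans _ _ (cabs (expi s - expi t))); first by rewrite ler_piMl ?cabs_ge0// ltW.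
  rewrite (le_lt_trans (cabs_le_ReIm _))// ReB ImB /= (splitr d) ltrD// distrC.
    by near: s.
  by near: s.
split; apply/cvgrPdist_lt => e e0; near=> s.
  have : cabs (circ b r s - circ b r t) < e by near: s; exact: H.
  by apply: le_lt_trans; rewrite distrC -ReB Re_le_cabs.
have : cabs (circ b r s - circ b r t) < e by near: s; exact: H.
by apply: le_lt_trans; rewrite distrC -ImB Im_le_cabs.
Unshelve. all: by end_near. Qed.

(** Comparing Abel sums gives P_(sr) g = P_s (b on the circle of radius r). For s close to 1 the
    right side is near b(r e^(it)) by continuity, and the left side is near g(t) when sr is close to
    1. *)
Lemma radial_pint_cvg b g t (M : R) : holo_disc b ->
  (forall z, cabs z < 1 -> cabs (b z) <= M) -> CI g ->
  (forall k : nat, fcoef g k = tcoef b k) -> (forall k : int, k < 0 -> fcoef g k = 0) ->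
  0 < t < pi *+ 2 -> pint_cvg g t -> radial b t (g t).
Proof.
move=> hb bM gi gk gneg t2 gt e e0.
have cf r : 0 < r < 1 -> CI (circ b r).
  move=> /andP[r0 r1]; apply: (@circ_CI _ _ _ M) => //; first by rewrite ltW.
  by move=> s; apply: bM; rewrite cabs_circ// ltW.
have h01 : 0 < (2^-1 : R) < 1 by apply/andP; split; lra.
have e20 : 0 < e / 2 by rewrite divr_gt0.
have [r0 /andP[r00 r01] Hr] := gt _ e20.
exists r0; first by rewrite r00.
move=> r /andP[rr0 r1]; have rp : 0 < r by exact: le_lt_trans rr0.
have ri : 0 < r < 1 by rewrite rp.
have ri' : 0 <= r < 1 by rewrite ltW.
have [cr ci] := circ_continuous t hb ri'.
have [s0 /andP[s00 s01] Hs] := pint_cvg_continuous (cf r ri) t2 cr ci e20.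
(* Beyond [s0] for the inner circle, and beyond r0 / r so that s * r > r0. *)
pose s := (Num.max s0 (r0 / r) + 1) / 2.
have q1 : r0 / r < 1 by rewrite ltr_pdivrMr// mul1r.
have [ss0 sr s1] : [/\ s0 < s, r0 / r < s & s < 1].
  have m1 : Num.max s0 (r0 / r) < 1 by rewrite gt_max s01.
  have : s0 <= Num.max s0 (r0 / r) by rewrite le_max lexx.
  have : r0 / r <= Num.max s0 (r0 / r) by rewrite le_max lexx orbT.
  by rewrite /s; move: m1; set m := Num.max _ _; set q := r0 / r => *; split; lra.
have sp : 0 <= s by rewrite ltW// (le_lt_trans s00).
have srlt : s * r < 1 by rewrite (le_lt_trans _ s1)// ler_piMr// ltW.
have E : pint (s * r) g t = pint s (circ b r) t.
  have si : 0 <= s < 1 by rewrite sp s1.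
  have sri : 0 <= s * r < 1 by rewrite mulr_ge0 ?(ltW rp).
  apply: (eq_pint sri si gi (cf r ri)) => N.
  rewrite /abel_sum; congr (_ + _); apply: eq_bigr => k _.
    by rewrite gk (fcoef_circ k hb ri (cf _ ri) (cf _ h01)) realcM exprMn realcX; ring.
  have kn : - k.+1%:Z < 0 :> int by [].
  by rewrite gneg// (fcoef_circ_neg hb ri kn cf) !mulr0.
have h1 := Hs s; rewrite ss0 s1 in h1; have {}h1 := h1 isT.
have h2 := Hr (s * r); rewrite srlt -ltr_pdivrMr// sr in h2; have {}h2 := h2 isT.
have -> : circ b r t - g t = (pint (s * r) g t - g t) - (pint s (circ b r) t - circ b r t).
  by rewrite E; ring.
by rewrite (le_lt_trans (cabsB _ _))// (splitr e) ltrD.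
Qed.

(** Bessel's inequality on circles with radii tending to 1 bounds the sum of squares of the Taylor
    coefficients by M^2. Riesz-Fischer then supplies a boundary function, whose Poisson integrals
    converge almost everywhere. *)
Lemma fatou b (M : R) : holo_disc b -> (forall z, cabs z < 1 -> cabs (b z) <= M) ->
  exists g, [/\ cmeas g, forall t, cabs (g t) <= M, forall k : nat, fcoef g k = tcoef b k,
    forall k : int, k < 0 -> fcoef g k = 0 & aeT (fun t => radial b t (g t))].
Proof.
move=> hb bM; have M0 : 0 <= M by rewrite (le_trans (cabs_ge0 (b 0)))// bM// cabs0.
have p0 : 0 < (2 : R) by [].
have p1 : 1 < (2 : R) by rewrite ltr1n.
have cb r t : 0 < r < 1 -> cabs (circ b r t) <= M.
  by move=> /andP[r0 r1]; apply: bM; rewrite cabs_circ// ltW.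
have cf r : 0 < r < 1 -> CI (circ b r).
  by move=> ri; apply: (@circ_CI _ _ _ M) => // [|t]; [have /andP[/ltW -> ->] := ri|exact: cb].
have cp r : 0 < r < 1 -> inLp 2 (circ b r).
  move=> ri; apply: (@inLp_bounded _ _ p0 _ M) => [|t _]; last exact: cb.
  exact: CI_cmeas (cf r ri).
have h01 : 0 < (2^-1 : R) < 1 by apply/andP; split; lra.
have B n : \sum_(k < n) cabs (tcoef b k) ^+ 2 <= M ^+ 2.
  have H j : \sum_(k < n) (cabs (tcoef b k) * rad j ^+ k) ^+ 2 <= M ^+ 2.
    have ri := rad_itv j : 0 < (rad j : R) < 1.
    apply: le_trans (_ : Np 2 (circ b (rad j)) <= _).
      apply: le_trans (bessel_le n (cp _ ri)); apply: ler_sum => k _.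
      by rewrite (fcoef_circ k hb ri (cf _ ri) (cf _ h01)) cabsM cabs_real ger0_norm// exprn_ge0// ltW//; case/andP: ri.
    rewrite Np2E -[leRHS]avg_cst; apply: avg_le; [exact: RI_sqr (cp _ ri)|exact: RI_cst|].
    by move=> t _; rewrite lerXn2r ?nnegrE ?cabs_ge0// cb.
  have c : (fun j => \sum_(k < n) (cabs (tcoef b k) * rad j ^+ k) ^+ 2) @ \oo -->
      \sum_(k < n) cabs (tcoef b k) ^+ 2.
    elim: n {H} => [|n IH].
      by rewrite (_ : (fun j => _) = fun=> 0) ?big_ord0; [exact: cvg_cst|apply/funext => j; rewrite big_ord0].
    rewrite (_ : (fun j => _) = fun j => \sum_(k < n) (cabs (tcoef b k) * rad j ^+ k) ^+ 2 +
        (cabs (tcoef b n) * rad j ^+ n) ^+ 2); last by apply/funext => j; rewrite big_ord_recr.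
    rewrite big_ord_recr /=; apply: cvgD => //.
    apply: (@continuous_cvg _ _ _ _ _ _ (fun x : R => x ^+ 2)); first exact: exprn_continuous.
    rewrite -[X in _ --> X]mulr1 -(expr1n R n); apply: cvgMl_tmp.
    by apply: (@continuous_cvg _ _ _ _ _ _ (fun x : R => x ^+ n)); [exact: exprn_continuous|exact: rad_cvg1].
  by apply: (ler_cvg_to c (cvg_cst _)); exact: nearW.
have [g0 [g0p g0k g0neg _]] := riesz_fischer B; have g0i := inLp_CI p1 g0p.
have rg : aeT (fun t => radial b t (g0 t)).
  apply: aeT1 (aeT_pint_cvg g0i) => t _ [t2 pt].
  exact: (radial_pint_cvg hb bM).
have gM : aeT (fun t => cabs (g0 t) <= M).
  apply: aeT1 rg => t _ rt; apply/ler_addgt0Pl => e e0.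
  have [r0 /andP[r00 r01] Hr] := rt e e0.
  have ri : 0 < (r0 + 1) / 2 < 1 by apply/andP; split; lra.
  have /Hr h : r0 < (r0 + 1) / 2 < 1 by apply/andP; split; lra.
  have -> : g0 t = circ b ((r0 + 1) / 2) t - (circ b ((r0 + 1) / 2) t - g0 t) by ring.
  by rewrite (le_trans (cabsB _ _))// addrC lerD ?cb// ltW.
(* Changing [g0] on a null set makes the bound hold at every [t]. *)
pose g t := if cabs (g0 t) <= M then g0 t else 0.
have gg : aeT (fun t => g t = g0 t) by apply: aeT1 gM => t _; rewrite /g => ->.
exists g; split.
- by apply: cmeas_trunc; exact: CI_cmeas.
- by move=> t; rewrite /g; case: ifP => //; rewrite cabs0.
- by move=> k; rewrite (fcoef_ae_eq _ gg).
- by move=> k k0; rewrite (fcoef_ae_eq _ gg) g0neg.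
- by apply: aeT2 gg rg => t _ ->.
Qed.

(** Where a radial limit exists, the [lim] in [bdry] is an actual limit and not a default value. *)
Lemma radial_bdry b t l : radial b t l -> bdry b t = l.
Proof.
move=> rb; have H e : 0 < e -> \forall r \near (1 : R)^'-, cabs (circ b r t - l) < e.
  move=> e0; have [r0 /andP[_ r01] Hr] := rb e e0.
  near=> r; apply: Hr; apply/andP; split; near: r; [exact: nbhs_left_gt|exact: nbhs_left_lt].
apply: complex_ext => /=; apply: cvg_lim => //; apply/cvgrPdist_lt => e e0; near=> r.
  have : cabs (circ b r t - l) < e by near: r; exact: H.
  by apply: le_lt_trans; rewrite distrC -ReB Re_le_cabs.
have : cabs (circ b r t - l) < e by near: r; exact: H.
by apply: le_lt_trans; rewrite distrC -ImB Im_le_cabs.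
Unshelve. all: by end_near. Qed.

Lemma radialM b c t l m : radial b t l -> radial c t m ->
  radial (fun z => b z * c z) t (l * m).
Proof.
move=> rb rc e e0; have l0 := cabs_ge0 l; have m0 := cabs_ge0 m.
pose K : R := cabs l + cabs m + 2; have K0 : 0 < K by rewrite /K; lra.
pose d := Num.min 1 (e / K); have d0 : 0 < d by rewrite lt_min ltr01 divr_gt0.
have d1 : d <= 1 by rewrite ge_min lexx.
have dK : d * K <= e by rewrite -ler_pdivlMr// ge_min lexx orbT.
have [r1 /andP[r10 r11] H1] := rb d d0; have [r2 /andP[r20 r21] H2] := rc d d0.
exists (Num.max r1 r2); first by rewrite le_max r10 gt_max r11 r21.
move=> r; rewrite gt_max => /andP[/andP[rr1 rr2] rl].
have h1 := H1 r; rewrite rr1 rl in h1; have {}h1 := h1 isT.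
have h2 := H2 r; rewrite rr2 rl in h2; have {}h2 := h2 isT.
have -> : circ (fun z => b z * c z) r t - l * m =
    (circ b r t - l) * (circ c r t - m) + ((circ b r t - l) * m + l * (circ c r t - m)).
  by rewrite /circ; ring.
rewrite (le_lt_trans (cabsD _ _))// (le_lt_trans (lerD (lexx _) (cabsD _ _)))// !cabsM.
move: (cabs_ge0 (circ b r t - l)) (cabs_ge0 (circ c r t - m)) h1 h2.
set x := cabs (_ - l); set y := cabs (_ - m) => x0 y0 xd yd.
apply: lt_le_trans dK; rewrite /K !mulrDr.
have : x * y <= d * 1 by apply: ler_pM => //; [exact: ltW|exact: le_trans (ltW yd) d1].
have : x * cabs m <= d * cabs m by rewrite ler_wpM2r// ltW.
have : cabs l * y <= d * cabs l by rewrite mulrC ler_wpM2r// ltW.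
clear -d0; lra.
Qed.
End Fatou.

(** * Toeplitz operators and partial products *)

Section BoundedMultipliers.
Context {R : realType}.
Local Notation C := R[i].
Local Notation T := (@Tdom R).
Local Notation Re := complex.Re.
Local Notation Im := complex.Im.
Implicit Types (f g h u w : R -> C) (p e r t : R).

(** Boundary functions of bounded analytic functions, with the bound at every point rather than
    almost everywhere; [fatou] provides such representatives. *)
Definition hardy_bdd (M : R) g :=
  [/\ cmeas g, forall t, cabs (g t) <= M & forall k : int, k < 0 -> fcoef g k = 0].

Lemma CIJ f : CI f -> CI (fun t => conjc (f t)).
Proof.
move=> [fr fi]; split.
  by rewrite (_ : (fun t => _) = fun t => Re (f t))//; apply/funext => t; rewrite ReJ.
rewrite (_ : (fun t => _) = fun t => - Im (f t)); first exact: RIN.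
by apply/funext => t; rewrite ImJ.
Qed.

Lemma hardy_bdd_CI M g : hardy_bdd M g -> CI g.
Proof. by move=> [mg gM _]; apply: (@CI_bounded _ _ M). Qed.

(** Abel sums of [g] are combinations of e^(ijt) with j >= 0, and multiplication by these only
    raises frequencies. They converge boundedly to [g], so dominated convergence concludes. *)
Lemma fcoef_mul_lt M g h (d : int) : hardy_bdd M g -> CI h ->
  (forall k, k < d -> fcoef h k = 0) ->
  forall k, k < d -> fcoef (fun t => g t * h t) k = 0.
Proof.
move=> gb hi hd k kd; have gi := hardy_bdd_CI gb; have [mg gM gneg] := gb.
have [N HN] := orders_exist 0 (@avg_ge0 R (fun t => cabs (g t)) (fun t _ => cabs_ge0 _)).
have HN2 := fun n => (HN n).2.
pose v n t := abel_sum (N n) (rad n) g t.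
have vE n t : v n t = \sum_(j < (N n).+1) (((rad n)%:C)%C ^+ j * fcoef g j) * expi ((j%:Z)%:~R * t).
  rewrite /v /abel_sum [X in _ + X]big1 ?addr0 => [|j _]; last by rewrite gneg ?mulr0.
  by apply: eq_bigr => j _; rewrite mulrAC.
have mv n : cmeas (v n).
  rewrite (_ : v n = fun t => \sum_(j < (N n).+1)
      (((rad n)%:C)%C ^+ j * fcoef g j) * expi ((j%:Z)%:~R * t)); last exact/funext.
  by apply: cmeas_sum => j; apply: cmeasZ; exact: cmeas_expi.
have vb n t : cabs (v n t) <= M + 1 by apply: (abel_bound n t gi (lexx _) HN2) => s _; exact: gM.
have c : ccvg (fun n => fcoef (fun t => v n t * h t) k) (fcoef (fun t => g t * h t) k).
  apply: (@fcoef_dct _ _ _ (fun t => (M + 1) * cabs (h t))).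
  - by move=> n; apply: cmeasM => //; exact: CI_cmeas.
  - by apply: cmeasM => //; exact: CI_cmeas.
  - by apply: RIZ; exact: CI_abs.
  - apply: aeT1 (abel_ccvg_ae gi (lexx _) HN2) => t _ ct.
    by apply: ccvgM => //; exact: ccvg_cst.
  - by apply: aeT_all => t _ n; rewrite cabsM ler_wpM2r ?cabs_ge0.
apply: ccvg_unique c _; rewrite (_ : (fun n => _) = fun=> 0); first exact: ccvg_cst.
apply/funext => n; rewrite (_ : (fun t => _) =
  fun t => \sum_(j < (N n).+1) (((rad n)%:C)%C ^+ j * fcoef g j) * (expi ((j%:Z)%:~R * t) * h t)).
  have ei (j : nat) : CI (fun t => expi ((j%:Z)%:~R * t) * h t).
    apply: (@CI_mul _ _ _ 1) => //; first exact: cmeas_expi.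
    by move=> t _; rewrite cabs_expi.
  rewrite fcoef_sum => [|j]; last exact: CIZ.
  rewrite big1// => j _; rewrite fcoefZ// fcoef_expiM hd ?mulr0//.
  by rewrite (le_lt_trans _ kd)// lerBlDr lerDl.
apply/funext => t; rewrite vE mulr_suml; apply: eq_bigr => j _; by rewrite mulrA.
Qed.

(** This is the invariance of the kernel of P_+. It follows from [fcoef_mul_lt] for the conjugate of
    [h]; the bound is [d = 1] because coefficient 0 vanishes too. *)
Lemma fcoef_conj_mul M g h : hardy_bdd M g -> CI h ->
  (forall k : int, 0 <= k -> fcoef h k = 0) ->
  forall k : int, 0 <= k -> fcoef (fun t => conjc (g t) * h t) k = 0.
Proof.
move=> gb hi h0 k k0; have [mg gM _] := gb.
rewrite (_ : (fun t => _) = fun t => conjc (g t * conjc (h t))); last first.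
  by apply/funext => t; rewrite conjcM conjcK.
rewrite fcoef_J; last by apply: (@CI_mul _ _ _ M) => //; exact: CIJ.
rewrite (@fcoef_mul_lt M g _ 1) ?conjc0//; first exact: CIJ.
  by move=> j j1; rewrite fcoef_J// h0 ?conjc0// oppr_ge0 -ltzD1 add0r.
by rewrite (le_lt_trans _ ltr01)// oppr_le0.
Qed.

(** Split off the Taylor section of [g] up to order [m]: the rest has only frequencies above [m],
    and by [fcoef_mul_lt] so has its product with [h]. *)
Lemma fcoef_cauchy M M' g h (m : nat) : hardy_bdd M g -> hardy_bdd M' h ->
  fcoef (fun t => g t * h t) m = \sum_(j < m.+1) fcoef g j * fcoef h (m%:Z - j%:Z).
Proof.
move=> gb hb; have gi := hardy_bdd_CI gb; have hi := hardy_bdd_CI hb.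
have [mh hM hneg] := hb; have [mg gM gneg] := gb.
pose s := fsum (fun k => fcoef g k) m.+1.
have si : CI s by apply: (@inLp_CI _ 2); rewrite ?ltr1n//; exact: inLp_fsum.
pose r t := g t - s t; have ri : CI r by exact: CIB.
have r0 k : k < m.+1%:Z -> fcoef r k = 0.
  move=> km; rewrite fcoefB// fcoef_fsum; case: k km => [j|j] jm.
    by rewrite ifT ?subrr.
  by rewrite gneg ?subr0.
have ei (j : nat) : CI (fun t => expi ((j%:Z)%:~R * t) * h t).
  apply: (@CI_mul _ _ _ 1) => //; first exact: cmeas_expi.
  by move=> t _; rewrite cabs_expi.
rewrite (_ : (fun t => _) =
  fun t => \sum_(j < m.+1) fcoef g j * (expi ((j%:Z)%:~R * t) * h t) + h t * r t); last first.
  apply/funext => t; rewrite /r mulrBr [h t * g t]mulrC addrC -addrA.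
  rewrite [X in _ + X](_ : _ = 0) ?addr0//.
  rewrite /s /fsum mulr_sumr -sumrN -big_split big1//= => j _.
  by rewrite mulrCA [h t * _]mulrC addrC subrr.
rewrite fcoefD; first last.
- exact: (CI_mul mh (fun t _ => hM t)).
- by apply: CI_sum => j; exact: CIZ.
rewrite (fcoef_mul_lt hb ri r0) ?addr0//; last by rewrite ltz_nat.
rewrite fcoef_sum => [|j]; last exact: CIZ.
by apply: eq_bigr => j _; rewrite fcoefZ// fcoef_expiM.
Qed.

Lemma cabs_fcoef_le M g (k : int) : hardy_bdd M g -> cabs (fcoef g k) <= M.
Proof.
move=> gb; have gi := hardy_bdd_CI gb; have [_ gM _] := gb.
rewrite (le_trans (cabs_fcoef _ gi))// -[leRHS]avg_cst.
by apply: avg_le; [exact: CI_abs|exact: RI_cst|].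
Qed.

(** * L^2 convergence of the partial products when the limit is not zero *)

Section StrongConvergence.
Variables (G : nat -> R -> C) (H : R -> C).
Hypothesis Gb : forall n, hardy_bdd 1 (G n).
Hypothesis Hb : hardy_bdd 1 H.
Hypothesis GH : forall k : nat, ccvg (fun n => fcoef (G n) k) (fcoef H k).
Hypothesis Gfactor : forall N M, (N <= M)%N ->
  exists2 q, hardy_bdd 1 q & aeT (fun t => G M t = G N t * q t).

Let p0 : 0 < (2 : R). Proof. by []. Qed.
Let p1 : 1 < (2 : R). Proof. by rewrite ltr1n. Qed.

Lemma hardy_bdd_Lp M g p : 0 < p -> hardy_bdd M g -> inLp p g.
Proof. by move=> q0 [mg gM _]; apply: (@inLp_bounded _ _ q0 _ M). Qed.

(** With G M = G N q, the L^2 distance is at most 2 |1 - q(0)|, where q(0) is the mean of [q]. The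
    coefficient [m] of G M equals that of G N times q(0) plus terms in the lower coefficients, which
    estimates the product of 1 - q(0) with that coefficient. *)
Lemma Np2_factor N M (m : nat) : (N <= M)%N ->
  Np 2 (fun t => G M t - G N t) * cabs (fcoef (G N) m) <=
  2 * (cabs (fcoef (G N) m - fcoef (G M) m) + \sum_(j < m) cabs (fcoef (G N) j)).
Proof.
move=> NM; have [q qb qE] := Gfactor NM; have [mq q1 qneg] := qb.
have qp := hardy_bdd_Lp p0 qb; have [mG G1 _] := Gb N.
have cE : fcoef (G M) m = \sum_(j < m.+1) fcoef (G N) j * fcoef q (m%:Z - j%:Z).
  by rewrite -(fcoef_cauchy m (Gb N) qb); exact: fcoef_ae_eq.
have h1 : Np 2 (fun t => G M t - G N t) <= 2 * cabs (1 - fcoef q 0).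
  have -> : Np 2 (fun t => G M t - G N t) = Np 2 (fun t => G N t * (q t - 1)).
    by apply: Np_ae_eq; apply: aeT1 qE => t _ ->; ring.
  apply: (@le_trans _ _ (Np 2 (fun t => q t - 1 * expi ((0%:Z)%:~R * t)))).
    have i1 : inLp 2 (fun t => q t - 1 * expi ((0%:Z)%:~R * t)).
      apply: (inLpB p0 qp); apply: inLpZ.
      by apply: (@inLp_bounded _ _ p0 _ 1); [exact: cmeas_expi|move=> t _; rewrite cabs_expi].
    have e1 : (fun t : R => q t - 1 * expi ((0%:Z)%:~R * t)) = fun t => q t - 1.
      by apply/funext => t; rewrite mul0r expi0 mulr1.
    rewrite e1 in i1 *; apply: (Np_le p0 (inLpM p0 mG (fun t _ => G1 t) i1) i1) => t _.
    by rewrite cabsM ler_piMl ?cabs_ge0.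
  rewrite Np2_sub//.
  have : Np 2 q <= 1.
    rewrite Np2E -[leRHS]avg_cst; apply: avg_le; [exact: RI_sqr|exact: RI_cst|].
    by move=> t _; rewrite exprn_ile1 ?cabs_ge0.
  have := Re_le_cabs' (1 - fcoef q 0); rewrite ReB.
  rewrite cabs1 expr1n conjc1 mul1r -[Re 1]/1; lra.
have h2 : cabs (fcoef (G N) m) * cabs (1 - fcoef q 0) <=
    cabs (fcoef (G N) m - fcoef (G M) m) + \sum_(j < m) cabs (fcoef (G N) j).
  rewrite -cabsM mulrBr mulr1.
  have -> : fcoef (G N) m - fcoef (G N) m * fcoef q 0 =
     (fcoef (G N) m - fcoef (G M) m) + \sum_(j < m) fcoef (G N) j * fcoef q (m%:Z - j%:Z).
    by rewrite cE big_ord_recr /= subrr; ring.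
  rewrite (le_trans (cabsD _ _))// lerD2l (le_trans (cabs_sum _ _ _))//.
  apply: ler_sum => j _; rewrite cabsM ler_piMr ?cabs_ge0//; exact: cabs_fcoef_le.
apply: (@le_trans _ _ (2 * cabs (1 - fcoef q 0) * cabs (fcoef (G N) m))).
  by rewrite ler_wpM2r ?cabs_ge0.
by rewrite -mulrA ler_wpM2l// mulrC.
Qed.

Lemma strong_cvg (m0 : nat) : fcoef H m0 != 0 ->
  Np 2 (fun t => G n t - H t) @[n --> \oo] --> (0 : R).
Proof.
move=> Hm0; have [m Hm mmin] := ex_minnP (ex_intro (fun m : nat => fcoef H m != 0) m0 Hm0).
have {mmin} Hj (j : nat) : (j < m)%N -> fcoef H j = 0.
  by move=> jm; apply/eqP; apply/negPn/negP => /mmin; rewrite leqNgt jm.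
pose c := cabs (fcoef H m); have c0 : 0 < c by rewrite cabs_gt0.
have near_small (d : R) : 0 < d -> exists N0, forall N, (N0 <= N)%N ->
    cabs (fcoef (G N) m - fcoef H m) <= d /\ \sum_(j < m) cabs (fcoef (G N) j) <= d.
  move=> d0; have /cvgrPdist_le/(_ _ d0)[N1 _ H1] := GH m.
  have s0 : (fun N => \sum_(j < m) cabs (fcoef (G N) j)) @ \oo --> (0 : R).
    have L k : (k <= m)%N -> (fun N => \sum_(j < k) cabs (fcoef (G N) j)) @ \oo --> (0 : R).
      elim: k => [|k IH] km.
        by rewrite (_ : (fun N => _) = fun=> 0); [exact: cvg_cst|apply/funext => N; rewrite big_ord0].
      rewrite (_ : (fun N => _) = fun N => \sum_(j < k) cabs (fcoef (G N) j) + cabs (fcoef (G N) k)); last first.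
        by apply/funext => N; rewrite big_ord_recr.
      rewrite -[X in _ --> X]addr0; apply: cvgD; first by apply: IH; exact: ltnW.
      by have := ccvg_cabs (GH k); rewrite Hj// cabs0.
    exact: L.
  have /cvgrPdist_le/(_ _ d0)[N2 _ H2] := s0.
  exists (maxn N1 N2) => N; rewrite geq_max => /andP[n1 n2]; split.
    by have := H1 N n1; rewrite /= sub0r normrN ger0_norm ?cabs_ge0.
  by have := H2 N n2; rewrite /= sub0r normrN ger0_norm ?sumr_ge0// => i _; exact: cabs_ge0.
apply/cvgrPdist_le => e e0.
(* With |coefficient m| >= c / 2 and right-hand side at most 2 (2d + d), the distance is at most 12
   d / c < e / 4. *)
pose d := Num.min (c / 2) (e * c / 64).
have d0 : 0 < d by rewrite lt_min !divr_gt0// mulr_gt0.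
have dc : d <= c / 2 by rewrite ge_min lexx.
have de : d <= e * c / 64 by rewrite ge_min lexx orbT.
have [N0 HN0] := near_small d d0; exists N0 => // N /= NN.
rewrite sub0r normrN ger0_norm ?Np_ge0//.
have bd M : (N <= M)%N -> Np 2 (fun t => G M t - G N t) <= e / 4.
  move=> NM; have := Np2_factor m NM; have [a1 a2] := HN0 N NN.
  have [b1 _] := HN0 M (leq_trans NN NM).
  have : cabs (fcoef (G N) m - fcoef (G M) m) <= d + d.
    have -> : fcoef (G N) m - fcoef (G M) m =
      (fcoef (G N) m - fcoef H m) - (fcoef (G M) m - fcoef H m) by ring.
    by rewrite (le_trans (cabsB _ _))// lerD.
  have : c / 2 <= cabs (fcoef (G N) m).
    have : c <= cabs (fcoef (G N) m) + cabs (fcoef (G N) m - fcoef H m).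
      rewrite /c {1}(_ : fcoef H m = fcoef (G N) m - (fcoef (G N) m - fcoef H m)); last by ring.
      exact: cabsB.
    lra.
  set X := Np _ _; set Y := cabs (fcoef (G N) m); set Z := cabs _; set S := \sum_(_ < _) _ in a2 *.
  move=> Yc Zd XY; have X0 : 0 <= X by exact: Np_ge0.
  have : X * (c / 2) <= X * Y by rewrite ler_wpM2l.
  clearbody X Y Z S d => h.
  have h3 : X * (c / 2) <= e / 4 * (c / 2) by lra.
  by rewrite ler_pM2r ?divr_gt0 in h3.
have GNi := hardy_bdd_CI (Gb N); have Hi := hardy_bdd_CI Hb.
have cn (k : nat) : ccvg (fun M => fcoef (fun t => G N t - G M t) k) (fcoef (fun t => G N t - H t) k).
  rewrite fcoefB// (_ : (fun M => _) = fun M => fcoef (G N) k + - 1 * fcoef (G M) k); last first.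
    by apply/funext => M; rewrite fcoefB ?mulN1r//; exact: hardy_bdd_CI (Gb M).
  by rewrite -[- fcoef H k]mulN1r; apply: ccvgD; [exact: ccvg_cst|exact: ccvgZ].
(* Bessel's inequality for G N - G M bounds finitely many coefficients at a time; then [M] tends to
   infinity. *)
have ps n : \sum_(k < n) cabs (fcoef (fun t => G N t - H t) k) ^+ 2 <= e / 4.
  have cv : (fun M => \sum_(k < n) cabs (fcoef (fun t => G N t - G M t) k) ^+ 2) @ \oo -->
      \sum_(k < n) cabs (fcoef (fun t => G N t - H t) k) ^+ 2.
    elim: n => [|n IH].
      by rewrite (_ : (fun j => _) = fun=> 0) ?big_ord0; [exact: cvg_cst|apply/funext => j; rewrite big_ord0].
    rewrite (_ : (fun M => _) = fun M => \sum_(k < n) cabs (fcoef (fun t => G N t - G M t) k) ^+ 2 +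
        cabs (fcoef (fun t => G N t - G M t) n) ^+ 2); last by apply/funext => j; rewrite big_ord_recr.
    rewrite big_ord_recr /=; apply: cvgD => //.
    apply: (@continuous_cvg _ _ _ _ _ _ (fun x : R => x ^+ 2)); first exact: exprn_continuous.
    exact: ccvg_cabs (cn n).
  apply: (ler_cvg_to cv (cvg_cst (e / 4))); exists N => // M /= NM.
  apply: (le_trans (bessel_le _ _)); first by apply: inLpB => //; exact: hardy_bdd_Lp.
  by rewrite NpC bd.
(* Instead of Parseval's identity: a function with the same coefficients and norm bound 4 (e / 4)
   exists, and it agrees with G N - H by uniqueness. *)
have [g [gp gk gneg gE]] :=
  @riesz_fischer R (fun k => fcoef (fun t => G N t - H t) k) _ ps.
have -> : Np 2 (fun t => G N t - H t) = Np 2 g.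
  apply: Np_ae_eq; apply: fourier_unique; [exact: CIB|exact: (inLp_CI p1)|].
  case=> [k|k]; first by rewrite gk.
  rewrite gneg// fcoefB//; have [_ _ ->//] := Gb N; have [_ _ ->//] := Hb; by rewrite subr0.
by apply: (le_trans gE); lra.
Qed.
End StrongConvergence.

End BoundedMultipliers.

(** * Toeplitz operators with bounded symbols *)

Section Toeplitz.
Context {R : realType}.
Local Notation C := R[i].
Local Notation T := (@Tdom R).
Implicit Types (f g h u w : R -> C) (e r t : R).
Variable p : R.
Hypothesis p1 : 1 < p.
Let p0 : 0 < p. Proof. exact: lt_trans p1. Qed.

Lemma inHp_unique f h : inHp p f -> inHp p h ->
  (forall k : int, 0 <= k -> fcoef f k = fcoef h k) -> aeT (fun t => f t = h t).
Proof.
move=> [fp fneg] [hp hneg] fh; apply: fourier_unique; [exact: (inLp_CI p1)..|] => k.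
by have [k0|k0] := ltP k 0; [rewrite fneg ?hneg|exact: fh].
Qed.
Lemma inHpB f h : inHp p f -> inHp p h -> inHp p (fun t => f t - h t).
Proof.
move=> [fp fneg] [hp hneg]; split; first exact: inLpB.
by move=> k k0; rewrite fcoefB ?fneg ?hneg ?subrr//; exact: (inLp_CI p1).
Qed.
Lemma inHp_horner (q : {poly C}) : inHp p (fun t => q.[expi t]).
Proof. by split; [exact: inLp_horner|case=> // k _; rewrite fcoef_horner]. Qed.
Lemma inHp_hardy_mul (M : R) g f : hardy_bdd M g -> inHp p f -> inHp p (fun t => g t * f t).
Proof.
move=> gb [fp fneg]; have [mg gM _] := gb; split; first exact: (inLpM p0 mg (fun t _ => gM t)).
by apply: (fcoef_mul_lt gb) => //; exact: (inLp_CI p1).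
Qed.

(* [w] represents [P_+ (g f)]. *)
Definition is_toep g f w :=
  inHp p w /\ forall k : int, 0 <= k -> fcoef w k = fcoef (fun t => g t * f t) k.

(** The [epsilon] in [Pplus] obeys its specification once a witness exists, and [riesz_Lp] supplies
    one. The symbol may be exchanged for a bounded representative since only its coefficients after
    multiplication matter. *)
Lemma Toep_is_toep (M : R) phi g f : cmeas g -> (forall t, cabs (g t) <= M) ->
  aeT (fun t => phi t = g t) -> inLp p f -> is_toep g f (Toep p phi f).
Proof.
move=> mg gM phig fp.
have E (k : int) : fcoef (fun t => phi t * f t) k = fcoef (fun t => g t * f t) k.
  by apply: fcoef_ae_eq; apply: aeT1 phig => t _ ->.
have [A _ HA] := riesz_Lp p1.
have [w [wp wk _]] := HA _ (inLpM p0 mg (fun t _ => gM t) fp).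
have /(ClassicalEpsilon.epsilon_spec (inhabits (fun _ : R => 0 : C))) [h1 h2] :
    exists w, inHp p w /\ forall k : int, 0 <= k -> fcoef w k = fcoef (fun t => phi t * f t) k.
  by exists w; split => // k k0; rewrite wk// E.
by split => // k k0; rewrite h2.
Qed.

Lemma is_toep_bound : exists2 A : R, 0 <= A & forall g f w, cmeas g ->
  (forall t, cabs (g t) <= 1) -> inLp p f -> is_toep g f w -> Np p w <= A * Np p f.
Proof.
have [A A0 HA] := riesz_Lp p1; exists A => // g f w mg g1 fp [wp wk].
have gfp := inLpM p0 mg (fun t _ => g1 t) fp.
have [v [vp vk vA]] := HA _ gfp.
rewrite (_ : Np p w = Np p v); last first.
  by apply: Np_ae_eq; apply: inHp_unique => // k k0; rewrite wk// vk.
apply: (le_trans vA); rewrite ler_wpM2l//; apply: Np_le => // t _.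
by rewrite cabsM ler_piMl ?cabs_ge0.
Qed.

Lemma is_toepB g f1 f2 w1 w2 : cmeas g -> (forall t, cabs (g t) <= 1) ->
  inLp p f1 -> inLp p f2 -> is_toep g f1 w1 -> is_toep g f2 w2 ->
  is_toep g (fun t => f1 t - f2 t) (fun t => w1 t - w2 t).
Proof.
move=> mg g1 f1p f2p [w1p w1k] [w2p w2k]; split; first exact: inHpB.
have gi f : inLp p f -> CI (fun t => g t * f t).
  by move=> fp; apply: (inLp_CI p1); exact: (inLpM p0 mg (fun t _ => g1 t)).
move=> k k0; rewrite fcoefB ?w1k ?w2k//; [|by apply: (inLp_CI p1); case: w1p|by apply: (inLp_CI p1); case: w2p].
rewrite (_ : (fun t => g t * (f1 t - f2 t)) = fun t => g t * f1 t - g t * f2 t).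
  by rewrite fcoefB//; exact: gi.
by apply/funext => t; rewrite mulrBr.
Qed.

(** The image of an analytic polynomial under the Toeplitz operator with symbol conj g: frequencies
    can only drop, so it depends on finitely many coefficients of [g]. *)
Definition toep_poly g (d : {poly C}) : {poly C} :=
  \poly_(k < size d) \sum_(m < size d) d`_m * conjc (fcoef g (m%:Z - k%:Z)).

Lemma is_toep_poly g d : hardy_bdd 1 g ->
  is_toep (fun t => conjc (g t)) (fun t => d.[expi t]) (fun t => (toep_poly g d).[expi t]).
Proof.
move=> gb; have gi := hardy_bdd_CI gb; have [_ _ gneg] := gb.
split; first exact: inHp_horner.
case=> // k _; rewrite fcoef_horner coef_poly.
have ei (j : nat) : CI (fun t => expi ((j%:Z)%:~R * t) * conjc (g t)).
  apply: (@CI_mul _ _ _ 1); [exact: cmeas_expi|by move=> t _; rewrite cabs_expi|exact: CIJ].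
have -> : fcoef (fun t => conjc (g t) * d.[expi t]) k =
    \sum_(m < size d) d`_m * conjc (fcoef g (m%:Z - k%:Z)).
  rewrite (_ : (fun t => _) = fun t => \sum_(m < size d) d`_m * (expi ((m%:Z)%:~R * t) * conjc (g t))).
    rewrite fcoef_sum => [|m]; last exact: CIZ.
    apply: eq_bigr => m _; rewrite fcoefZ// fcoef_expiM fcoef_J//.
    by rewrite opprB.
  apply/funext => t; rewrite horner_coef mulr_sumr; apply: eq_bigr => m _.
  by rewrite -expi_nat; ring.
case: ifPn => //; rewrite -leqNgt => dk; rewrite big1// => m _.
by rewrite gneg ?conjc0 ?mulr0// subr_lt0 ltz_nat (leq_trans (ltn_ord m)).
Qed.

(** Uniform boundedness plus convergence on the dense set of analytic polynomials. *)
Lemma toep_cvg (G : nat -> R -> C) H f (u : nat -> R -> C) w :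
  (forall n, hardy_bdd 1 (G n)) -> hardy_bdd 1 H ->
  (forall k : nat, ccvg (fun n => fcoef (G n) k) (fcoef H k)) -> inHp p f ->
  (forall n, is_toep (fun t => conjc (G n t)) f (u n)) ->
  is_toep (fun t => conjc (H t)) f w ->
  Np p (fun t => u n t - w t) @[n --> \oo] --> (0 : R).
Proof.
move=> Gb Hb GH fH uT wT; have [fp fneg] := fH.
have cm g : hardy_bdd 1 g -> cmeas (fun t => conjc (g t)).
  by move=> [mg _ _]; exact: cmeasJ.
have c1 g : hardy_bdd 1 g -> forall t, cabs (conjc (g t)) <= 1.
  by move=> [_ g1 _] t; rewrite cabsJ.
have [A A0 HA] := is_toep_bound; pose K : R := 2 `^ p.
have K0 : 0 < K by exact: powR_gt0.
apply/cvgrPdist_lt => e e0.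
(* The projection bound is used twice, on f - d and on its image, hence (A + 1)^2; two triangle
   inequalities with factor [K] account for 4 K (K + 1). *)
pose e1 := e / (4 * K * (K + 1) * (A + 1) * (A + 1)).
have A1 : 0 < A + 1 by rewrite ltr_wpDl.
have K1 : 0 < K + 1 by rewrite ltr_wpDl// ltW.
have e10 : 0 < e1 by rewrite divr_gt0// !mulr_gt0.
have alg (X Y Z W : R) : X < e / (4 * K * (K + 1)) -> Y <= K * (X + W) ->
    Z <= A * (A * e1) -> W <= A * (A * e1) -> K * (Z + Y) < e.
  have Ae : A * (A * e1) <= e / (4 * K * (K + 1)).
    have -> : A * (A * e1) = (A / (A + 1)) * (A / (A + 1)) * (e / (4 * K * (K + 1))).
      by rewrite /e1; field; rewrite !gt_eqF.
    have a0 : 0 <= A / (A + 1) by rewrite divr_ge0// ltW.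
    have a1 : A / (A + 1) <= 1 by rewrite ler_pdivrMr// mul1r lerDl.
    have E0 : 0 <= e / (4 * K * (K + 1)).
      by apply: divr_ge0; [exact: ltW|rewrite !mulr_ge0 ?(ltW K0) ?(ltW K1)].
    by rewrite -[leRHS]mul1r; apply: ler_wpM2r => //; apply: mulr_ile1.
  move: Ae; move: (A * (A * e1)) => B Ae h1 h3 h4 h5.
  set E := e / _ in Ae h1.
  have -> : e = K * (2 * E + K * (2 * E)) * 2.
    by rewrite /E; field; rewrite !gt_eqF.
  have EK : K * W <= K * E by rewrite ler_pM2l// (le_trans h5).
  have XK : K * X < K * E by rewrite ltr_pM2l.
  have E0 : 0 < E by rewrite divr_gt0// !mulr_gt0.
  have Y2 : Y <= 2 * (K * E) by lra.
  have h : K * (Z + Y) <= K * (E + 2 * (K * E)).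
    by rewrite ler_pM2l// lerD// (le_trans h4).
  have KE : 0 < K * E by rewrite mulr_gt0.
  have KKE : 0 < K * (K * E) by rewrite mulr_gt0.
  apply: (le_lt_trans h); rewrite -subr_gt0.
  have -> : K * (2 * E + K * (2 * E)) * 2 - K * (E + 2 * (K * E)) = 3 * (K * E) + 2 * (K * (K * E)) by ring.
  lra.
have [N [q Hq]] := trig_dense p0 (inLp_CI p1 fp) fp e10.
pose d := drop_poly N q; pose fd t := f t - d.[expi t].
have dp : inLp p (fun t => d.[expi t]) by exact: inLp_horner.
have fdp : inLp p fd by exact: inLpB.
have fdA : Np p fd <= A * e1.
  apply: (@le_trans _ _ (A * Np p (fun t => f t - trig N q t))); last by rewrite ler_wpM2l// ltW.
  (* Since [f] is its own projection, f - d is the projection of f - trig, and so it is small by the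
     bound with symbol 1. *)
  have T1 : is_toep (fun=> 1) (fun t => f t - trig N q t) fd.
    split; first exact: (inHpB fH (inHp_horner d)).
    case=> // k _; rewrite (_ : (fun t => _) = fun t => f t - trig N q t); last first.
      by apply/funext => t; rewrite mul1r.
    have ci := inLp_CI p1 fp; have di := inLp_CI p1 dp; have ti := CI_trig N q.
    by rewrite (fcoefB _ ci di) (fcoefB _ ci ti) fcoef_horner fcoef_trig.
  have c11 (t : R) : cabs (1 : C) <= 1 by rewrite cabs1.
  exact: (HA _ _ _ (cmeas_cst 1) c11 (inLpB p0 fp (inLp_trig N q p0)) T1).
have far g v : hardy_bdd 1 g -> is_toep (fun t => conjc (g t)) f v ->
    Np p (fun t => v t - (toep_poly g d).[expi t]) <= A * (A * e1).
  move=> gb vT; apply: (@le_trans _ _ (A * Np p fd)); last by rewrite ler_wpM2l.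
  exact: (HA _ _ _ (cm g gb) (c1 g gb) fdp
    (is_toepB (cm g gb) (c1 g gb) fp dp vT (is_toep_poly d gb))).
have pc : Np p (fun t => (toep_poly (G n) d).[expi t] - (toep_poly H d).[expi t]) @[n --> \oo] --> (0 : R).
  have Np0 : Np p (fun _ : R => 0 : C) = 0 by rewrite /Np cabs0 powR0 ?gt_eqF// avg_cst.
  pose S := \sum_(i < size d) \sum_(m < size d) cabs d`_m.
  have tE g (t : R) : (toep_poly g d).[expi t] =
      \sum_(i < size d) (\sum_(m < size d) d`_m * conjc (fcoef g (m%:Z - i%:Z))) * expi t ^+ i.
    by rewrite horner_poly.
  have tS g t : hardy_bdd 1 g -> cabs (toep_poly g d).[expi t] <= S.
    move=> gb; rewrite tE (le_trans (cabs_sum _ _ _))//; apply: ler_sum => i _.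
    rewrite cabsM cabsX cabs_expi expr1n mulr1 (le_trans (cabs_sum _ _ _))//.
    apply: ler_sum => m _; rewrite cabsM ler_piMr ?cabs_ge0// cabsJ.
    exact: cabs_fcoef_le gb.
  have S0 : 0 <= S by apply: sumr_ge0 => i _; apply: sumr_ge0 => m _; exact: cabs_ge0.
  rewrite -Np0; have [|||||_] := @Np_dct R p p0
    (fun n t => (toep_poly (G n) d).[expi t] - (toep_poly H d).[expi t]) (fun=> 0) (fun=> ((S + S)%:C)%C).
  - by move=> n; apply: cmeasB; exact: cmeas_horner.
  - exact: cmeas_cst.
  - exact: inLp_cst.
  - apply: aeT_all => t _; rewrite -(subrr (toep_poly H d).[expi t]).
    apply: ccvgD; last exact: ccvg_cst.
    rewrite tE (_ : (fun n => _) = fun n => \sum_(i < size d)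
        (\sum_(m < size d) d`_m * conjc (fcoef (G n) (m%:Z - i%:Z))) * expi t ^+ i); last first.
      by apply/funext => n; rewrite tE.
    apply: ccvg_sum => i; apply: ccvgM; last exact: ccvg_cst.
    apply: ccvg_sum => m; apply: ccvgZ; apply: ccvgJ.
    case: (m%:Z - i%:Z) => k; first exact: GH.
    have [_ _ ->//] := Hb; rewrite (_ : (fun n => _) = fun=> 0); first exact: ccvg_cst.
    by apply/funext => n; have [_ _ ->] := Gb n.
  - apply: aeT_all => t _ n; rewrite cabs_real ger0_norm ?addr_ge0//.
    by rewrite (le_trans (cabsB _ _))// lerD// tS.
  by [].
have e20 : 0 < e / (4 * K * (K + 1)) by rewrite divr_gt0// !mulr_gt0.
have /cvgrPdist_lt/(_ _ e20)[N0 _ HN] := pc.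
exists N0 => // n /= Nn; rewrite sub0r normrN ger0_norm ?Np_ge0//.
have := HN n Nn; rewrite /= sub0r normrN ger0_norm ?Np_ge0// => h1.
have [[up _] _] := uT n; have [[wp _] _] := wT.
have vp g : inLp p (fun t => (toep_poly g d).[expi t]) by exact: inLp_horner.
have h2 := Np_sub_add p0 up (vp (G n)) wp.
have h3 := Np_sub_add p0 (vp (G n)) (vp H) wp.
have h4 := far _ _ (Gb n) (uT n).
have h5 := far _ _ Hb wT; rewrite NpC in h5.
rewrite -/K in h2 h3.
apply: (le_lt_trans h2); apply: alg h1 h3 h4 h5.
Qed.

(** Passage from L^2 to L^p for functions bounded by 2: small values cost d^p, larger ones satisfy x
    / d >= 1. *)
Lemma powR_le_sqr (x d : R) : 0 < d -> 0 <= x <= 2 ->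
  x `^ p <= d `^ p + 2 `^ p / d ^+ 2 * x ^+ 2.
Proof.
move=> d0 /andP[x0 x2]; have [xd|dx] := leP x d.
  apply: le_trans (_ : d `^ p <= _).
    by apply: ge0_ler_powR; rewrite ?nnegrE ?(ltW p0) ?(ltW d0).
  by rewrite lerDl mulr_ge0 ?sqr_ge0// divr_ge0 ?powR_ge0// sqr_ge0.
apply: le_trans (_ : 2 `^ p <= _).
  by apply: ge0_ler_powR; rewrite ?nnegrE ?(ltW p0).
rewrite -[leLHS]add0r lerD ?powR_ge0// -mulrA ler_peMr ?powR_ge0//.
by rewrite mulrC ler_pdivlMr ?exprn_gt0// mul1r lerXn2r ?nnegrE ?(ltW d0) ?(ltW dx).
Qed.

(** Approximate [u] by a bounded trigonometric polynomial; against a bounded factor only the L^p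
    size of G n - H matters, and [powR_le_sqr] bounds it by the L^2 size. *)
Lemma mult_cvg (G : nat -> R -> C) H u : (forall n, hardy_bdd 1 (G n)) -> hardy_bdd 1 H ->
  Np 2 (fun t => G n t - H t) @[n --> \oo] --> (0 : R) -> inLp p u ->
  Np p (fun t => (G n t - H t) * u t) @[n --> \oo] --> (0 : R).
Proof.
move=> Gb Hb GH up; have [mH H1 _] := Hb.
pose K : R := 2 `^ p; have K0 : 0 < K by exact: powR_gt0.
have mD n : cmeas (fun t => G n t - H t) by apply: cmeasB => //; have [] := Gb n.
have D2 n t : cabs (G n t - H t) <= 2.
  rewrite (le_trans (cabsB _ _))// -[2]/(1 + 1) lerD//; have [] := Gb n => //.
apply/cvgrPdist_le => e e0.
have e10 : 0 < e / (2 * K * K) by rewrite divr_gt0// !mulr_gt0.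
have [N [q Hq]] := trig_dense p0 (inLp_CI p1 up) up e10.
have [S HS] := trig_bounded N q; set s := trig N q in Hq HS.
have S0 : 0 <= S by exact: le_trans (cabs_ge0 _) (HS 0).
pose S' := (S + 1) `^ p; have S'0 : 0 < S' by rewrite powR_gt0// ltr_wpDl.
(* The final bound is K (K e / (2 K K) + 2 a S') = e / 2 + e / 2; [d] is the p-th root of [a]. *)
pose a := e / (4 * K * S'); have a0 : 0 < a by rewrite divr_gt0// !mulr_gt0.
pose d := a `^ p^-1; have d0 : 0 < d by exact: powR_gt0.
have dp : d `^ p = a by rewrite /d -powRrM mulVf ?gt_eqF// powRr1// ltW.
have kd : 0 < K / d ^+ 2 by apply: divr_gt0 => //; exact: exprn_gt0.
have b0 : 0 < a / (K / d ^+ 2) by exact: divr_gt0.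
have /cvgrPdist_le/(_ _ b0)[N0 _ HN] := GH.
exists N0 => // n /= Nn; rewrite sub0r normrN ger0_norm ?Np_ge0//.
have := HN n Nn; rewrite /= sub0r normrN ger0_norm ?Np_ge0// => h1.
have sp : inLp p s by exact: inLp_trig.
have Dp q0 : 0 < q0 -> inLp q0 (fun t => G n t - H t).
  by move=> q00; apply: (@inLp_bounded _ _ q00 _ 2).
have h2 : Np p (fun t => G n t - H t) <= a + a.
  apply: (@le_trans _ _ (a + K / d ^+ 2 * Np 2 (fun t => G n t - H t))); last first.
    by rewrite lerD2l mulrC -ler_pdivlMr.
  have RS : RI (fun t => cabs (G n t - H t) ^+ 2) by apply: RI_sqr; exact: Dp.
  rewrite Np2E -avgZ// -[X in X + _](avg_cst a) -avgD; [|exact: RI_cst|exact: RIZ].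
  apply: avg_le; [by apply: inLp_RI; exact: Dp|by apply: RID; [exact: RI_cst|exact: RIZ]|].
  by move=> t _ /=; rewrite -dp; apply: powR_le_sqr; rewrite ?cabs_ge0/=.
have mul f : inLp p f -> inLp p (fun t => (G n t - H t) * f t).
  by move=> fp; exact: (inLpM p0 (mD n) (fun t _ => D2 n t)).
have h3 : Np p (fun t => (G n t - H t) * (u t - s t)) <= K * (e / (2 * K * K)).
  have usp : inLp p (fun t => u t - s t) by exact: inLpB.
  apply: (@le_trans _ _ (Np p (fun t => (2%:C)%C * (u t - s t)))).
    have i1 : inLp p (fun t => (G n t - H t) * (u t - s t)) by exact: mul.
    have i2 : inLp p (fun t => (2%:C)%C * (u t - s t)) by exact: inLpZ.
    apply: (Np_le p0 i1 i2) => t _.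
    rewrite !cabsM cabs_real ger0_norm//; apply: ler_wpM2r; [exact: cabs_ge0|exact: D2].
  rewrite (NpZ _ usp) cabs_real ger0_norm//.
  by apply: ler_wpM2l; [exact: ltW|exact: ltW Hq].
have h4 : Np p (fun t => (G n t - H t) * s t) <= S' * (a + a).
  have S1 : 0 <= S + 1 by rewrite addr_ge0.
  apply: (@le_trans _ _ (Np p (fun t => ((S + 1)%:C)%C * (G n t - H t)))).
    have i1 : inLp p (fun t => (G n t - H t) * s t) by exact: mul.
    have i2 : inLp p (fun t => ((S + 1)%:C)%C * (G n t - H t)) := inLpZ ((S + 1)%:C)%C (Dp p p0).
    apply: (Np_le p0 i1 i2) => t _.
    rewrite [leLHS]cabsM [leRHS]cabsM cabs_real ger0_norm// [leLHS]mulrC.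
    apply: ler_wpM2r; first exact: cabs_ge0.
    by apply: (le_trans (HS t)); rewrite lerDl.
  rewrite (NpZ _ (Dp p p0)) cabs_real ger0_norm//.
  by apply: ler_wpM2l => //; exact: ltW.
have -> : Np p (fun t => (G n t - H t) * u t) =
  Np p (fun t => (G n t - H t) * (u t - s t) + (G n t - H t) * s t).
  by apply: avg_eq => t _; congr (cabs _ `^ _); ring.
have usp : inLp p (fun t => (G n t - H t) * (u t - s t)) by apply: mul; exact: inLpB.
apply: (le_trans (Np_add p0 usp (mul _ sp))); rewrite -/K.
apply: (@le_trans _ _ (K * (K * (e / (2 * K * K)) + S' * (a + a)))).
  by rewrite ler_wpM2l ?(ltW K0)// lerD.
rewrite /a le_eqVlt; apply/orP; left; apply/eqP; field.
by rewrite !gt_eqF.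
Qed.
End Toeplitz.

(** * Partial products and the telescoping identity *)

Section PartialProducts.
Context {R : realType}.
Local Notation C := R[i].
Local Notation T := (@Tdom R).
Implicit Types (f g : R -> C) (b B : C -> C) (r t : R).

Lemma Hinf_ball_prod (b : nat -> C -> C) (s : seq nat) :
  (forall k, k \in s -> Hinf_ball (b k)) -> Hinf_ball (fun z => \prod_(k <- s) b k z).
Proof.
elim: s => [|j s IH] hs.
  rewrite (_ : (fun z => _) = fun=> 1); last by apply/funext => z; rewrite big_nil.
  split=> [z _|z _]; last by rewrite cabs1.
  apply: cdiff_cderivable; exact: cdiff_cst.
rewrite (_ : (fun z => _) = fun z => b j z * \prod_(k <- s) b k z); last first.
  by apply/funext => z; rewrite big_cons.
have [hj j1] := hs j (mem_head _ _).
have [hp p1] : Hinf_ball (fun z => \prod_(k <- s) b k z).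
  by apply: IH => k ks; apply: hs; rewrite inE ks orbT.
split=> z z1; last by rewrite cabsM mulr_ile1 ?cabs_ge0 ?j1 ?p1.
have [d1 H1] := cderivable_cdiff (hj z z1); have [d2 H2] := cderivable_cdiff (hp z z1).
exact: cdiff_cderivable (cdiffM H1 H2).
Qed.

Lemma partprodS (b : nat -> C -> C) n : partprod b n.+1 = fun z => partprod b n z * b n.+1 z.
Proof. by apply/funext => z; rewrite /partprod big_nat_recr. Qed.

Lemma circ_CI_ball b r : Hinf_ball b -> 0 <= r < 1 -> CI (circ b r).
Proof.
move=> [hb b1] r01; apply: (@circ_CI _ _ _ 1) => // t.
by have /andP[r0 r1] := r01; apply: b1; rewrite cabs_circ.
Qed.

Lemma fatou_ball b : Hinf_ball b -> exists g, [/\ hardy_bdd 1 g,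
  forall k : nat, fcoef g k = tcoef b k & aeT (fun t => radial b t (g t))].
Proof. by move=> [hb b1]; have [g [? ? ? ? ?]] := fatou hb b1; exists g. Qed.

(** Taylor coefficients are averages over the circle of radius 1/2, a compact set. *)
Lemma tcoef_cvg (Bn : nat -> C -> C) B (k : nat) : (forall n, Hinf_ball (Bn n)) -> Hinf_ball B ->
  (forall e : R, 0 < e -> exists N : nat, forall n, (N <= n)%N ->
    forall z, cabs z <= 2^-1 -> cabs (Bn n z - B z) < e) ->
  ccvg (fun n => tcoef (Bn n) k) (tcoef B k).
Proof.
move=> hn hB H; apply: ccvgZ; apply/cvgrPdist_le => e e0.
have [N HN] := H e e0.
have h : 0 <= (2^-1 : R) < 1 by apply/andP; split; lra.
have i2 := circ_CI_ball hB h.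
have bd n : (N <= n)%N -> cabs (fcoef (circ (Bn n) 2^-1) k - fcoef (circ B 2^-1) k) <= e.
  move=> Nn; have i1 := circ_CI_ball (hn n) h.
  rewrite -fcoefB// (le_trans (cabs_fcoef _ (CIB i1 i2)))// -[leRHS]avg_cst.
  apply: avg_le; [by apply: CI_abs; exact: CIB|exact: RI_cst|] => t _.
  by rewrite ltW// HN// cabs_circ//; case/andP: h.
exists N => // n Nn; apply: le_trans (bd n Nn); cbv beta.
by rewrite sub0r normrN ger0_norm// cabs_ge0.
Qed.

(** The difference conj(G) f - u lies in the kernel of P_+, and multiplication by conj(g) keeps it
    there; so the inner operator maps [u] to [u']. The outer one is mere multiplication, because g
    u' is already analytic. *)
Lemma Toep_telescope p b g G G' u u' f : 1 < p -> hardy_bdd 1 g -> hardy_bdd 1 G ->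
  aeT (fun t => bdry b t = g t) -> aeT (fun t => G' t = G t * g t) -> inHp p f ->
  is_toep p (fun t => conjc (G t)) f u -> is_toep p (fun t => conjc (G' t)) f u' ->
  aeT (fun t => Qb p b u t = u t - g t * u' t).
Proof.
move=> p1 gb Gb bg GG fH uT u'T; have p0 : 0 < p by exact: lt_trans p1.
have [mg g1 _] := gb; have [mG G1 _] := Gb; have [fp _] := fH.
have [[up _] uk] := uT; have [u'H u'k] := u'T; have [u'p _] := u'H.
have [cg c1] : cmeas (fun t => conjc (g t)) /\ forall t, cabs (conjc (g t)) <= 1.
  by split; [exact: cmeasJ|move=> t; rewrite cabsJ].
have [cG C1] : cmeas (fun t => conjc (G t)) /\ forall t, cabs (conjc (G t)) <= 1.
  by split; [exact: cmeasJ|move=> t; rewrite cabsJ].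
have cbg : aeT (fun t => cbdry b t = conjc (g t)).
  by apply: aeT1 bg => t _; rewrite /cbdry => ->.
have [vH vk] := Toep_is_toep p1 cg c1 cbg up; set v := Toep p (cbdry b) u in vH vk.
have vu : aeT (fun t => v t = u' t).
  apply: (inHp_unique p1) => // k k0; rewrite vk// u'k//.
  have Gfi : CI (fun t => conjc (G t) * f t).
    by apply: (inLp_CI p1); exact: (inLpM p0 cG (fun t _ => C1 t)).
  have ui := inLp_CI p1 up.
  have E : fcoef (fun t => conjc (g t) * (conjc (G t) * f t - u t)) k = 0.
    apply: (fcoef_conj_mul gb) => // [|j j0]; first exact: CIB.
    by rewrite fcoefB// uk// subrr.
  have -> : fcoef (fun t => conjc (G' t) * f t) k = fcoef (fun t => conjc (g t) * (conjc (G t) * f t)) k.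
    by apply: fcoef_ae_eq; apply: aeT1 GG => t _ ->; rewrite conjcM; ring.
  apply/eqP; rewrite -subr_eq0 -fcoefB; [|exact: (CI_mul cg (fun t _ => c1 t))..].
  apply/eqP; rewrite -oppr0 -E -[RHS]mulN1r -fcoefZ; last first.
    by apply: (CI_mul cg (fun t _ => c1 t)); exact: CIB.
  congr (fcoef _ k); apply/funext => t.
  by move: (conjc (g t)) (conjc (G t)) (f t) (u t) => x1 x2 x3 x4; ring.
have [vp _] := vH.
have [zH zk] := Toep_is_toep p1 mg g1 bg vp.
have zE : aeT (fun t => Toep p (bdry b) v t = g t * u' t).
  apply: (inHp_unique p1 zH (inHp_hardy_mul p1 gb u'H)) => k k0; rewrite zk//.
  by apply: fcoef_ae_eq; apply: aeT1 vu => t _ ->.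
by apply: aeT1 zE => t _; rewrite /Qb /Pb -/v => ->.
Qed.
End PartialProducts.

Theorem theorem3p2 (R : realType) (p : R) (b : nat -> R[i] -> R[i])
    (B : R[i] -> R[i]) :
  1 < p ->
  (* b_n := b n for n >= 1 lies in the closed unit ball of H^infty *)
  (forall n : nat, (1 <= n)%N -> Hinf_ball (b n)) ->
  Hinf B ->
  (* B_n = b_1 ... b_n converges to B uniformly on compact subsets of D *)
  (forall r : R, 0 <= r < 1 -> forall eps : R, 0 < eps ->
     exists N : nat, forall n : nat, (N <= n)%N ->
       forall z : R[i], cabs z <= r -> cabs (partprod b n z - B z) < eps) ->
  forall f : R -> R[i], inHp p f ->
    Lpnorm p (fun t => f t -
       (bdry B t * Toep p (cbdry B) f t
        + \sum_(1 <= n < N.+1)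
            bdry (partprod b n.-1) t *
            Qb p (b n) (Toep p (cbdry (partprod b n.-1)) f) t))
      @[N --> \oo] --> 0.
Proof.
move=> p1 hb [hB _] conv f fH; have p0 : 0 < p by exact: lt_trans p1.
have [fp fneg] := fH.
have ball n : Hinf_ball (partprod b n).
  by apply: Hinf_ball_prod => k; rewrite mem_index_iota => /andP[k1 _]; exact: hb.
(* Each value of [B] is a limit of values of modulus at most 1. *)
have Bball : Hinf_ball B.
  split => // z z1; apply/ler_addgt0Pl => e e0.
  have [|N HN] := conv (cabs z) _ e e0; first by rewrite cabs_ge0.
  have -> : B z = partprod b N z - (partprod b N z - B z) by ring.
  rewrite (le_trans (cabsB _ _))// addrC lerD//; first by rewrite ltW// HN.
  by have [_ /(_ z z1)] := ball N.
have [G HG] := choice (fun n => fatou_ball (ball n)).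
have [H [Hb Hk Hr]] := fatou_ball Bball.
have [g Hg] := choice (fun n => fatou_ball (hb n.+1 (ltn0Sn n))).
have Gb n : hardy_bdd 1 (G n) by have [] := HG n.
have gb n : hardy_bdd 1 (g n) by have [] := Hg n.
have bG n : aeT (fun t => bdry (partprod b n) t = G n t).
  by have [_ _] := HG n; apply: aeT1 => t _ /radial_bdry.
have bg n : aeT (fun t => bdry (b n.+1) t = g n t).
  by have [_ _] := Hg n; apply: aeT1 => t _ /radial_bdry.
have bH : aeT (fun t => bdry B t = H t) by apply: aeT1 Hr => t _ /radial_bdry.
have GS n : aeT (fun t => G n.+1 t = G n t * g n t).
  have [_ _ r1] := HG n; have [_ _ r2] := Hg n.
  apply: aeT2 (bG n.+1) _; last by apply: aeT2 r1 r2 => t _; exact: conj.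
  by move=> t _ <- [h1 h2]; rewrite partprodS; apply: radial_bdry; exact: radialM.
(* The quotient is the boundary function of b_(N+1) ... b_M, since radial limits are
   multiplicative. *)
have Gfactor N M : (N <= M)%N -> exists2 q, hardy_bdd 1 q & aeT (fun t => G M t = G N t * q t).
  move=> NM; have [|q [qb _ qr]] := @fatou_ball R (fun z => \prod_(N.+1 <= k < M.+1) b k z).
    apply: Hinf_ball_prod => k; rewrite mem_index_iota => /andP[k1 _].
    exact: hb (leq_trans _ k1).
  exists q => //; have [_ _ r1] := HG N.
  apply: aeT2 (bG M) _; last by apply: aeT2 r1 qr => t _; exact: conj.
  move=> t _ <- [h1 h2]; apply: radial_bdry.
  rewrite (_ : partprod b M = fun z => partprod b N z * \prod_(N.+1 <= k < M.+1) b k z).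
    exact: radialM.
  by apply/funext => z; rewrite /partprod -big_cat_nat.
have GH (k : nat) : ccvg (fun n => fcoef (G n) k) (fcoef H k).
  rewrite Hk (_ : (fun n => _) = fun n => tcoef (partprod b n) k); last first.
    by apply/funext => n; have [_ ->] := HG n.
  apply: tcoef_cvg => // e e0; apply: conv => //; apply/andP; split; lra.
have toep c q : hardy_bdd 1 q -> aeT (fun t => bdry c t = q t) ->
    is_toep p (fun t => conjc (q t)) f (Toep p (cbdry c) f).
  move=> [mq q1 _] cq; apply: (Toep_is_toep p1 (M := 1)) => //; first exact: cmeasJ.
    by move=> t; rewrite cabsJ.
  by apply: aeT1 cq => t _; rewrite /cbdry => ->.
pose u n := Toep p (cbdry (partprod b n)) f; pose w := Toep p (cbdry B) f.
have uT n : is_toep p (fun t => conjc (G n t)) f (u n) := toep _ _ (Gb n) (bG n).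
have wT : is_toep p (fun t => conjc (H t)) f w := toep _ _ Hb bH.
have [[wp _] wk] := wT.
have up n : inLp p (u n) by have [[]] := uT n.
have G0 : aeT (fun t => G 0 t = 1).
  apply: aeT1 (bG 0) => t _ <-; apply: radial_bdry => e e0.
  exists 0; first by rewrite lexx ltr01.
  by move=> r _; rewrite /circ /partprod big_geq// subrr cabs0.
have u0 : aeT (fun t => u 0 t = f t).
  have [u0H u0k] := uT 0%N; apply: (inHp_unique p1) => // k k0; rewrite u0k//.
  by apply: fcoef_ae_eq; apply: aeT1 G0 => t _ ->; rewrite conjc1 mul1r.
have Qu n : aeT (fun t => Qb p (b n.+1) (u n) t = u n t - g n t * u n.+1 t).
  exact: (Toep_telescope p1 (gb n) (Gb n) (bg n) (GS n) fH (uT n) (uT n.+1)).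
have resid N : aeT (fun t => f t - (bdry B t * w t + \sum_(1 <= n < N.+1)
      bdry (partprod b n.-1) t * Qb p (b n) (u n.-1) t) = G N t * u N t - H t * w t).
  have A1 : aeT (fun t => forall n, bdry (partprod b n) t = G n t) by exact: aeT_forall.
  have A2 : aeT (fun t => forall n, G n.+1 t = G n t * g n t) by exact: aeT_forall.
  have A3 : aeT (fun t => forall n, Qb p (b n.+1) (u n) t = u n t - g n t * u n.+1 t) by exact: aeT_forall.
  have A4 : aeT (fun t => G 0 t * u 0 t = f t) by apply: aeT2 G0 u0 => t _ -> ->; rewrite mul1r.
  have A12 := aeT2 (fun t _ => @conj _ _) A1 A2; have A34 := aeT2 (fun t _ => @conj _ _) A3 A4.
  have A5 := aeT2 (fun t _ => @conj _ _) A12 A34.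
  apply: aeT2 bH A5 => t _ -> [[a1 a2] [a3 a4]].
  (* Each term is G_(n-1) u_(n-1) - G_n u_n, and the first of these products is G_0 u_0 = f. *)
  have -> : \sum_(1 <= n < N.+1) bdry (partprod b n.-1) t * Qb p (b n) (u n.-1) t = f t - G N t * u N t.
    rewrite big_add1; have -> : N.+1.-1 = N by [].
    elim: N => [|N IH]; first by rewrite big_geq// a4 subrr.
    have -> : \sum_(0 <= n < N.+1) bdry (partprod b n.+1.-1) t * Qb p (b n.+1) (u n.+1.-1) t =
        \sum_(0 <= n < N) bdry (partprod b n.+1.-1) t * Qb p (b n.+1) (u n.+1.-1) t +
        bdry (partprod b N) t * Qb p (b N.+1) (u N) t by exact: big_nat_recr.
    rewrite IH (a1 N) (a3 N) (a2 N).
    by move: (G N t) (g N t) (u N t) (u N.+1 t) (f t) => x1 x2 x3 x4 x5; ring.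
  by ring.
have Np0 : Np p (fun t => G N t * u N t - H t * w t) @[N --> \oo] --> (0 : R).
  have c1 := toep_cvg p1 Gb Hb GH fH uT wT.
  have c2 : Np p (fun t => (G n t - H t) * w t) @[n --> \oo] --> (0 : R).
    have [[m Hm]|H0] := pselect (exists m : nat, fcoef H m != 0).
      exact: (mult_cvg p1 Gb Hb (strong_cvg Gb Hb GH Gfactor Hm) wp).
    (* All coefficients of the boundary function of [B] vanish, so it is zero almost everywhere, and
       so is its Toeplitz image [w]. *)
    have Hz : aeT (fun t => H t = 0).
      apply: fourier_unique0; first exact: hardy_bdd_CI Hb.
      case=> k; first by apply/eqP; apply: contra_notT H0 => Hk0; exists k.
      by have [_ _ ->] := Hb.
    have wz : aeT (fun t => w t = 0).
      apply: (@fourier_unique0 R); first exact: (inLp_CI p1).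
      case=> k; last by have [[_ ->]] := wT.
      rewrite wk// (@fcoef_ae_eq _ _ (fun=> 0)); first by rewrite fcoef_cst mul0rn.
      by apply: aeT1 Hz => t _ ->; rewrite conjc0 mul0r.
    rewrite (_ : (fun n => _) = fun=> 0); first exact: cvg_cst.
    apply/funext => n; rewrite (@Np_ae_eq _ p _ (fun=> 0)).
      by rewrite /Np cabs0 powR0 ?gt_eqF// avg_cst.
    by apply: aeT1 wz => t _ ->; rewrite mulr0.
  have mG n : cmeas (G n) by have [] := Gb n.
  have G1 n t : cabs (G n t) <= 1 by have [_ G1 _] := Gb n.
  have mH : cmeas H by have [] := Hb.
  have H1 t : cabs (H t) <= 1 by have [] := Hb.
  have d1 n : inLp p (fun t => u n t - w t) := inLpB p0 (up n) wp.
  have e1 n := inLpM p0 (mG n) (fun t _ => G1 n t) (d1 n).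
  have e2 n : inLp p (fun t => (G n t - H t) * w t).
    have d2 t : Tdom t -> cabs (G n t - H t) <= 2.
      by move=> _; rewrite (le_trans (cabsB _ _))// -[2]/(1 + 1) lerD.
    exact: (inLpM p0 (cmeasB (mG n) mH) d2 wp).
  apply: (@squeeze0 _ _ (fun n => 2 `^ p * (Np p (fun t => u n t - w t) + Np p (fun t => (G n t - H t) * w t)))).
    move=> n; rewrite Np_ge0/=.
    (* The remainder is G (u_n - w) + (G - H) w: the first term is handled by |G| <= 1 and
       [toep_cvg], the second by [c2]. *)
    have -> : Np p (fun t => G n t * u n t - H t * w t) =
        Np p (fun t => G n t * (u n t - w t) + (G n t - H t) * w t).
      by apply: avg_eq => t _; congr (cabs _ `^ _); ring.
    apply: (le_trans (Np_add p0 (e1 n) (e2 n))).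
    apply: ler_wpM2l; first exact: powR_ge0.
    rewrite lerD2r; apply: (Np_le p0 (e1 n) (d1 n)) => t _.
    by rewrite cabsM ler_piMl ?cabs_ge0.
  have c12 := @cvgMl_tmp _ _ _ _ _ (2 `^ p) _ (cvgD c1 c2).
  have E : 2 `^ p * (0 + 0) = 0 :> R by rewrite addr0 mulr0.
  by rewrite E in c12; exact: c12.
have q0 : 0 < p^-1 by rewrite invr_gt0.
have qn : p^-1 != 0 by rewrite gt_eqF.
rewrite -(powR0 qn).
rewrite (_ : (fun N => _) = fun N => Np p (fun t => G N t * u N t - H t * w t) `^ p^-1); last first.
  apply/funext => N; rewrite -(Np_ae_eq _ (resid N)); reflexivity.
by apply: cvg_powR => // n; exact: Np_ge0.
Qed.
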